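(* Let $\delta>(n-1)/2$, $0<\kappa<1$, $w\in A_1$ and $b\in BMO(\mathbb R^n)$. Then for any given $\sigma>0$ and any ball $B$, there exists a constant $C>0$ independent of $f$, $B$ and $\sigma$ such that $$\frac{1}{w(B)^\kappa}\, w\big(\{x\in B:|[b,T^\delta_*](f)(x)|>\sigma\}\big)\leq C\sup_{B'}\frac{1}{w(B')^\kappa}\int_{B'}\Phi\left(\frac{|f(x)|}{\sigma}\right) w(x)\,dx ,$$ where $\Phi(t)=t(1+\log^+t)$, $[b,T^\delta_*]$ is the maximal operator associated with the commutators of the Bochner–Riesz means of order $\delta$, and the supremum is over all balls $B'\subset\mathbb R^n$.
   Context: Here $f$ is a function on $\mathbb R^n$. The Bochner–Riesz means of order $\delta>0$ are defined initially for Schwartz functions by $\widehat{T^\delta_Rf}(\xi)=\big(1-|\xi|^2/R^2\big)^\delta_+\widehat f(\xi)$, $0<R<\infty$, where $\widehat f$ is the Fourier transform of $f$; they can be expressed as $T^\delta_Rf=\phi_{1/R}*f$, where $\phi_{1/R}(x)=R^n\phi(Rx)$ and $$\phi(x)=\pi^{-\delta}\Gamma(\delta+1)|x|^{-(n/2+\delta)}J_{n/2+\delta}(2\pi|x|),\qquad J_\mu(t)=\frac{(t/2)^\mu}{\Gamma(\mu+\frac12)\Gamma(\frac12)}\int_{-1}^1e^{its}(1-s^2)^{\mu-\frac12}\,ds .$$ The commutator is $[b,T^\delta_R](f)(x)=b(x)T^\delta_Rf(x)-T^\delta_R(bf)(x)=\int_{\mathbb R^n}[b(x)-b(y)]\phi_{1/R}(x-y)f(y)\,dy$,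 and $[b,T^\delta_*](f)(x)=\sup_{R>0}|[b,T^\delta_R](f)(x)|$. A weight is a non-negative locally integrable function, positive on a set of positive measure; $w(E)=\int_E w(x)\,dx$. A weight $w$ is in $A_1$ if there is a constant $C>0$ with $\frac1{|B|}\int_B w\le C\,\mathrm{ess\,inf}_{B}\,w$ for all balls $B$. $BMO(\mathbb R^n)$ is the space of locally integrable $b$ with $\sup_B\frac1{|B|}\int_B|b-b_B|<\infty$, $b_B=\frac1{|B|}\int_B b$. $\log^+t=\max(\log t,0)$, $\Phi(0)=0$. *)

(* Defs.v *)
From HB Require Import structures.
From mathcomp Require Import all_boot all_order all_algebra.
From mathcomp Require Import all_classical all_reals all_analysis.
From mathcomp Require Import complex.

Set Implicit Arguments.
Unset Strict Implicit.
Unset Printing Implicit Defensive.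

Import Order.TTheory GRing.Theory Num.Theory.
Import numFieldNormedType.Exports.

Local Open Scope classical_set_scope.
Local Open Scope ring_scope.
Local Open Scope complex_scope.

Definition Rn_borel_display : measure_display. Proof. exact. Qed.

Section borel_sigma_algebra.
Context {R : realType} (n : nat).

Let coord (i : 'I_n) (x : 'rV[R]_n) : R := x ord0 i.

HB.instance Definition _ := @isMeasurable.Build Rn_borel_display
  'rV[R]_n (g_sigma_preimage coord)
  (@sigma_algebra0 _ _ _) (@sigma_algebraC _ _)
  (@sigma_algebra_bigcup _ _ _).

End borel_sigma_algebra.

Section borel_lebesgue.
Context {R : realType}.

Definition cons_rV n (p : R * 'rV[R]_n) : 'rV[R]_n.+1 :=
  row_mx (p.1%:M : 'rV_1) p.2.

Lemma cons_rV0 n (p : R * 'rV[R]_n) : cons_rV p ord0 ord0 = p.1.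
Proof.
rewrite /cons_rV (_ : ord0 = lshift n ord0 :> 'I_(1 + n)); last exact/val_inj.
by rewrite (row_mxEl (p.1%:M : 'rV_1)) mxE eqxx mulr1n.
Qed.

Lemma cons_rVS n (p : R * 'rV[R]_n) i :
  cons_rV p ord0 (lift ord0 i) = p.2 ord0 i.
Proof.
rewrite /cons_rV (_ : lift ord0 i = rshift 1 i :> 'I_(1 + n)); last exact/val_inj.
by rewrite (row_mxEr (p.1%:M : 'rV_1)).
Qed.

Lemma measurable_cons_rV n :
  measurable_fun [set: R * 'rV[R]_n] (@cons_rV n).
Proof.
move=> _ Y mY; rewrite setTI.
suff /(_ Y mY) : @measurable _ 'rV[R]_n.+1 `<=`
    [set A | measurable (@cons_rV n @^-1` A)] by [].
apply: smallest_sub.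
  split => /=.
  - by rewrite preimage_set0; exact: measurable0.
  - by move=> A mA; rewrite setTD preimage_setC; exact: measurableC.
  - by move=> F mF; rewrite preimage_bigcup; exact: bigcupT_measurable.
rewrite -bigcup_seq/=; apply: bigcup_sub => i _ A [B mB <-] /=.
rewrite setTI -comp_preimage /comp /=.
have [->|] := eqVneq i ord0.
  under eq_fun do rewrite cons_rV0.
  by rewrite -[X in measurable X]setTI; exact: measurable_fst.
rewrite eq_sym => /unlift_some[j -> _].
under eq_fun do rewrite cons_rVS.
rewrite -[X in measurable X]setTI.
apply: (@measurable_snd _ _ R 'rV[R]_n measurableT [set v | B (v ord0 j)]).
apply: sub_sigma_algebra; rewrite -bigcup_seq/=.
by exists j => /=; [rewrite mem_index_enum|exists B => //; rewrite setTI].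
Qed.

Definition product_cons n (m : {measure set 'rV[R]_n -> \bar R}) :
  set 'rV[R]_n.+1 -> \bar R :=
  pushforward (lebesgue_measure \x^ m)%E (@cons_rV n).

HB.instance Definition _ n (m : {measure set 'rV[R]_n -> \bar R}) :=
  Measure.copy (product_cons m)
   (measure_function_pushforward__canonical__measure_function_Measure
     (lebesgue_measure \x^ m)%E (@measurable_cons_rV n)).

Fixpoint lebesgue_borel n : {measure set 'rV[R]_n -> \bar R} :=
  if n is n'.+1 then product_cons (lebesgue_borel n') else dirac (0 : 'rV_0).

Lemma measurable_rect n (A : 'I_n -> set R) :
  (forall i, measurable (A i)) ->
  measurable [set x : 'rV[R]_n | forall i, A i (x ord0 i)].
Proof.
move=> mA; rewrite (_ : [set _ | _] =
    \bigcap_(i in [set: 'I_n]) [set x : 'rV[R]_n | A i (x ord0 i)]).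
  apply: fin_bigcap_measurable => // i _.
  apply: sub_sigma_algebra; rewrite -bigcup_seq/=.
  by exists i => /=; [rewrite mem_index_enum|exists (A i) => //; rewrite setTI].
by apply/seteqP; split => [x Ax i _|x Ax i]; [exact: Ax|exact: (Ax i I)].
Qed.

Lemma lebesgue_borel_rect n (A : 'I_n -> set R) :
  (forall i, measurable (A i)) ->
  lebesgue_borel n [set x | forall i, A i (x ord0 i)] =
  (\prod_(i < n) lebesgue_measure (A i))%E.
Proof.
elim: n A => [|n ih] A mA.
  by rewrite big_ord0 /= diracE mem_set//= => -[].
rewrite big_ord_recl -ih//= /product_cons /pushforward.
have mA' : forall i : 'I_n, measurable (A (lift ord0 i)) by [].
rewrite -[RHS](@product_measure2E _ _ (measurableTypeR R) 'rV[R]_n R lebesgue_measure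
  (lebesgue_borel n) _ _ (mA ord0) (measurable_rect mA')).
congr (product_measure2 _ _ _); apply/seteqP; split => -[x v] /=.
  move=> Axv; split; first by have := Axv ord0; rewrite cons_rV0.
  by move=> i; have := Axv (lift ord0 i); rewrite cons_rVS.
move=> [Ax Av] i; have [->|i0] := eqVneq i ord0; first by rewrite cons_rV0.
move: i0; rewrite eq_sym => /unlift_some[j -> _].
by rewrite cons_rVS; exact: Av.
Qed.

End borel_lebesgue.

(* [Rn R n] is R^n with the sigma-algebra of Lebesgue measurable sets (the
   Caratheodory sets of the outer measure extending the Borel measure); its
   points are those of ['rV[R]_n], which carries the vector space structure
   and the topology. *)
Definition Rn (R : realType) (n : nat) :=
  caratheodory_type (mu_ext (@lebesgue_borel R n)).

Definition lebesgue_Rn {R : realType} (n : nat) :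
    {measure set (Rn R n) -> \bar R} :=
  @completed_measure_extension _ _ _ (@lebesgue_borel R n).

Section euclidean.
Context {R : realType} {n : nat}.
Implicit Types (x : 'rV[R]_n) (r : R) (B E K : set 'rV[R]_n).

Local Notation mu := (@lebesgue_Rn R n).

(* The library norm and [ball] of ['rV[R]_n] are those of the sup norm. *)
Definition enorm x : R := Num.sqrt (\sum_(i < n) x ord0 i ^+ 2).

Definition eball x r : set 'rV[R]_n := [set y | enorm (y - x) < r].

Definition euclidean_ball : set (set 'rV[R]_n) :=
  [set B | exists x r, 0 < r /\ B = eball x r].

Definition measurable_funC (f : 'rV[R]_n -> R[i]) : Prop :=
  measurable_fun [set: Rn R n] (fun x : Rn R n => complex.Re (f x)) /\
  measurable_fun [set: Rn R n] (fun x : Rn R n => complex.Im (f x)).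

Definition modulus (z : R[i]) : R := Normc.normc z.

Definition loc_integrable (h : 'rV[R]_n -> R) : Prop :=
  measurable_fun [set: Rn R n] (h : Rn R n -> R) /\
  forall K, compact K -> (\int[mu]_(x in K) `|h x|%:E < +oo)%E.

Definition loc_integrableC (f : 'rV[R]_n -> R[i]) : Prop :=
  measurable_funC f /\
  forall K, compact K -> (\int[mu]_(x in K) (modulus (f x))%:E < +oo)%E.

Definition weight (w : 'rV[R]_n -> R) : Prop :=
  [/\ forall x, 0 <= w x, loc_integrable w &
      (0 < mu [set x | (0 < w x)%R])%E].

Definition wmeasure (w : 'rV[R]_n -> R) E : \bar R :=
  (\int[mu]_(x in E) (w x)%:E)%E.

(* The library's [ess_inf], with the almost-everywhere condition restricted
   to E. *)
Definition ess_inf_in E (h : 'rV[R]_n -> R) : \bar R :=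
  ereal_sup [set y | \forall x \ae mu, E x -> (y <= (h x)%:E)%E].

Definition A1 (w : 'rV[R]_n -> R) : Prop :=
  weight w /\ exists C : R, 0 < C /\ forall B, euclidean_ball B ->
    ((mu B)^-1 * \int[mu]_(x in B) (w x)%:E <= C%:E * ess_inf_in B w)%E.

End euclidean.

Definition integralC d (T : measurableType d) (R : realType)
    (mu : {measure set T -> \bar R}) (D : set T) (f : T -> R[i]) : R[i] :=
  (\int[mu]_(x in D) complex.Re (f x)) +i* (\int[mu]_(x in D) complex.Im (f x)).

Section bmo.
Context {R : realType} {n : nat}.
Implicit Types (b : 'rV[R]_n -> R[i]) (B : set 'rV[R]_n).

Local Notation mu := (@lebesgue_Rn R n).

Definition average b B : R[i] := (fine (mu B))^-1%:C * integralC mu B b.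

Definition BMO b : Prop :=
  loc_integrableC b /\
  (ereal_sup [set (mu B)^-1 * \int[mu]_(x in B) (modulus (b x - average b B))%:E
    | B in euclidean_ball]%E < +oo)%E.

End bmo.

Section special_functions.
Context {R : realType}.

Definition Gamma (x : R) : R :=
  \int[lebesgue_measure]_(t in `]0, +oo[) (t `^ (x - 1) * expR (- t)).

Definition cis (t : R) : R[i] := cos t +i* sin t.

Definition besselJ (m t : R) : R[i] :=
  ((t / 2) `^ m / (Gamma (m + 2^-1) * Gamma 2^-1))%:C *
  integralC lebesgue_measure `[-1, 1]
    (fun s => cis (t * s) * ((1 - s ^+ 2) `^ (m - 2^-1))%:C).

End special_functions.

Section bochner_riesz.
Context {R : realType} {n : nat}.
Variable delta : R.
Implicit Types (x y : 'rV[R]_n) (r : R) (b f : 'rV[R]_n -> R[i]).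

Local Notation mu := (@lebesgue_Rn R n).

Definition br_phi x : R[i] :=
  (pi `^ (- delta) * Gamma (delta + 1) *
   enorm x `^ (- (n%:R / 2 + delta)))%:C *
  besselJ (n%:R / 2 + delta) (2 * pi * enorm x).

Definition br_kernel r x : R[i] := (r ^+ n)%:C * br_phi (r *: x).

(* On Schwartz functions this convolution is the Fourier multiplier operator
   with symbol (1 - |xi|^2 / r^2)_+^delta, for the normalisation
   e^{-2 pi i x.xi} of the Fourier transform; [br_kernel r] is phi_{1/r}. *)
Definition bochner_riesz r f x : R[i] :=
  integralC mu setT (fun y => br_kernel r (x - y) * f y).

Definition br_commutator b r f x : R[i] :=
  b x * bochner_riesz r f x - bochner_riesz r (fun y => b y * f y) x.

Definition br_max_commutator b f x : \bar R :=
  ereal_sup [set (modulus (br_commutator b r f x))%:E | r in `]0, +oo[].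

End bochner_riesz.

Section LlogL.
Context {R : realType}.

Definition log_plus (t : R) : R := Num.max (ln t) 0.

(* [Phi 0 = 0], since [ln] is 0 at 0. *)
Definition Phi (t : R) : R := t * (1 + log_plus t).

End LlogL.

(* Main.v *)
Require Import Defs.
From HB Require Import structures.
From mathcomp Require Import all_boot all_order all_algebra.
From mathcomp Require Import all_classical all_reals all_analysis.
From mathcomp Require Import measurable_realfun complex zify ring lra.

(** The level sets of the maximal commutator are contained in sets where averages over
    cubes are large. Write [h] for a large multiple of [|f| / sigma]. The kernel of order
    [delta] is bounded and decays like the power [- (n / 2 + delta + 1 / 2)] of the
    distance, and this exponent exceeds [n] exactly when [delta > (n - 1) / 2]. Such a
    kernel is dominated by a geometric sum of averages over cubes, whatever the dilation;
    so at a point [x] where the averages of [h] and of [`|b x - b y| * h y] over all the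
    cubes centred at [x] are at most 1, the maximal commutator is at most [sigma]
    ([br_max_commutator_le]). The decay of the kernel ([br_profile_bound]) is that of a
    Bessel function; it follows from the differential equation by monotonicity of an
    energy ([bessel_energy_decay]).

    It remains to bound the weight of the points of [B] around which one of these averages
    exceeds 1 ([cube_commutator_bound]). By the one-third trick, every cube is contained in
    a cell of comparable size in one of finitely many dyadic grids, so a single grid
    suffices ([cell_commutator_bound]). Let [P] be a cell containing [x] over which the
    average of [`|b x - b y| * h y] is large, and compare [b x] and [b y] with the constant
    [a] approximating [b] on [P]. By the John-Nirenberg inequality and Young's inequality,
    the average of [`|b y - a| * h y] is controlled by that of [Phi (h y)]; if it is large,
    then [P] is one of the cells where [Phi (h y)] has a large average. Otherwise [b x] is
    at distance about [m] from [a] for some [m], and the average of [h] over [P] is at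
    least of the order of [1 / m]. In the maximal cell containing [P] with such an average,
    [x] belongs to a subset of points far from the constant of that cell, which
    carries a proportion of its weight decaying geometrically with [m], by a weighted form
    of the John-Nirenberg inequality ([weighted_john_nirenberg]).

    The Morrey condition enters when these stopping cells are summed
    ([morrey_stopping]). The [A1] condition bounds the weight of a stopping cell by the
    integral of [h * w], or of [Phi (h) * w], over it; the stopping cells are disjoint, and
    they are either inside a cell comparable to [B], over which the integral is controlled
    by the Morrey bound, or a single cell containing [B], in which case its weight is
    bounded outright and an interpolation with the weight of [B] concludes. The geometric
    decay in [m] survives, with its exponent multiplied by [1 - kappa], and compensates the
    loss of a factor [m]. The level sets need not be measurable; they are always enclosed
    in measurable sets of the required weight. *)

Set Implicit Arguments.
Unset Strict Implicit.
Unset Printing Implicit Defensive.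

Import Order.TTheory GRing.Theory Num.Theory.
Import numFieldNormedType.Exports.

Local Open Scope classical_set_scope.
Local Open Scope ring_scope.


(** * Measures with density and stopping times in a nested sequence of partitions *)

Section density.
Context d (T : measurableType d) (R : realType).
Variable mu : {measure set T -> \bar R}.
Variable h : T -> R.
Hypothesis mh : measurable_fun [set: T] h.
Hypothesis h_ge0 : forall x, 0 <= h x.

Definition density of measurable_fun [set: T] h & (forall x, 0 <= h x) :
  set T -> \bar R := fun A => (\int[mu]_(x in A) (h x)%:E)%E.

Let density_ := density mh h_ge0.

Let density0 : density_ set0 = 0%E.
Proof. exact: integral_set0. Qed.

Let density_ge0 A : (0 <= density_ A)%E.
Proof. by apply: integral_ge0 => x _; rewrite lee_fin. Qed.

Let density_sigma_additive : semi_sigma_additive density_.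
Proof.
move=> F mF tF mUF; rewrite /density_ /density ge0_integral_bigcup//.
- by apply: is_cvg_ereal_nneg_natsum => n _; exact: density_ge0.
- apply/measurable_EFinP; exact: measurable_funTS.
- by move=> x _; rewrite lee_fin.
Qed.

HB.instance Definition _ := isMeasure.Build _ _ _ (density mh h_ge0)
  density0 density_ge0 density_sigma_additive.

End density.

Section filtration.
Context d (T : measurableType d) (R : realType) (I : countType).
Variable key : nat -> T -> I.

(** A partition into countably many cells is given by a function to a countable
    type, so that a set which is a union of cells is measurable. *)
Definition cell k i : set T := [set x | key k x = i].

Hypothesis mcell : forall k i, measurable (cell k i).
Hypothesis refine : forall k x y, key k.+1 x = key k.+1 y -> key k x = key k y.

Lemma key_le j k x y : (j <= k)%N -> key k x = key k y -> key j x = key j y.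
Proof.
move=> /subnK <-; elim: (k - j)%N => [//|m ih]; rewrite addSn => /refine; exact: ih.
Qed.

Lemma measurable_key k (A : set I) : measurable [set x | A (key k x)].
Proof.
rewrite (_ : [set x | _] = \bigcup_m
   (if pickle_inv m is Some i then cell k i `&` [set _ | A i] else set0)).
  apply: bigcupT_measurable => m; case: pickle_inv => [i|]; last exact: measurable0.
  have [Ai|nAi] := pselect (A i).
    by rewrite (_ : [set _ | _] = setT) ?setIT//; apply/seteqP; split.
  by rewrite (_ : [set _ | _] = set0) ?setI0//; apply/seteqP; split.
apply/seteqP; split => [x Ax|x [m _]].
  by exists (pickle (key k x)) => //; rewrite pickleK_inv.
by case: pickle_inv => // i [<-].
Qed.

Definition stops (S : nat -> I -> Prop) k0 k x :=
  [/\ (k0 <= k)%N, S k (key k x) &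
      forall j, (k0 <= j < k)%N -> ~ S j (key j x)].

Definition stopped S k0 (G : nat -> I -> set T) : set T :=
  [set x | exists k y, stops S k0 k y /\ G k (key k y) x].

Lemma stops_cell S k0 k x y : key k x = key k y -> stops S k0 k x ->
  stops S k0 k y.
Proof.
move=> xy [k0k Sx nS]; split => //; first by rewrite -xy.
move=> j /[dup] /nS + /andP[_ /ltnW jk].
by rewrite (key_le jk xy).
Qed.

Lemma stops_uniq S k0 k k' x : stops S k0 k x -> stops S k0 k' x -> k = k'.
Proof.
move=> [k0k Sk nS] [k0k' Sk' nS']; apply/eqP; rewrite eqn_leq; apply/andP; split.
  by rewrite leqNgt; apply/negP => k'k; apply: (nS k') => //; rewrite k0k'.
by rewrite leqNgt; apply/negP => k'k; apply: (nS' k) => //; rewrite k0k.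
Qed.

(** The index [k] bounds the stopping level: a selected cell lies inside the one
    at which its points stop. *)
Lemma ex_stops (S : nat -> I -> Prop) k0 k x : (k0 <= k)%N -> S k (key k x) ->
  exists k', stops S k0 k' x /\ (k' <= k)%N.
Proof.
move=> k0k Sk.
pose P j := ((k0 <= j)%N && `[< S j (key j x) >]).
have exP : exists j, P j by exists k; rewrite /P k0k/=; exact/asboolP.
case: (ex_minnP exP) => j /andP[k0j /asboolP Sj] jmin.
exists j; split; last by apply: jmin; rewrite /P k0k/=; exact/asboolP.
split => // i /andP[k0i ij] Si; have := jmin i.
by rewrite /P k0i/= leqNgt ij => /(_ (asboolT Si)).
Qed.

Lemma stopped_cellE S k0 :
  stopped S k0 cell = [set x | exists2 k, (k0 <= k)%N & S k (key k x)].
Proof.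
apply/seteqP; split => [x [k [y [[k0k Sk _]]]]|x [k k0k Sk]].
  by rewrite /cell/= => xy; exists k => //; rewrite xy.
by have [k' [sk' _]] := ex_stops k0k Sk; exists k', x.
Qed.

Let stop_seq S k0 (G : nat -> I -> set T) m : set T :=
  if pickle_inv m is Some (k, i) then
    [set x | (exists y, stops S k0 k y /\ key k y = i) /\ G k i x]
  else set0.

Let measurable_stop_seq S k0 G m : (forall k i, measurable (G k i)) ->
  measurable (stop_seq S k0 G m).
Proof.
move=> mG; rewrite /stop_seq; case: pickle_inv => [[k i]|]; last exact: measurable0.
have [h|h] := pselect (exists y, stops S k0 k y /\ key k y = i).
  by rewrite (_ : [set x | _] = G k i)//; apply/seteqP; split => x//= [].
by rewrite (_ : [set x | _] = set0)//; apply/seteqP; split => x//= [].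
Qed.

Let stop_seqE S k0 G : stopped S k0 G = \bigcup_m stop_seq S k0 G m.
Proof.
apply/seteqP; split => [x [k [y [sy Gx]]]|x [m _]].
  exists (pickle (k, key k y)) => //; rewrite /stop_seq pickleK_inv; split => //.
  by exists y.
rewrite /stop_seq; case: pickle_inv => // -[k i] [[y [sy yi]] Gx].
by exists k, y; rewrite yi.
Qed.

Lemma measurable_stopped S k0 G : (forall k i, measurable (G k i)) ->
  measurable (stopped S k0 G).
Proof.
by move=> mG; rewrite stop_seqE; apply: bigcupT_measurable => m;
  exact: measurable_stop_seq.
Qed.

Let trivIset_stop_seq S k0 : trivIset setT (stop_seq S k0 cell).
Proof.
move=> m1 m2 _ _ [x []]; rewrite /stop_seq.
have := @pickle_invK _ m1 : oapp pickle m1 (pickle_inv m1 : option (nat * I)) = m1.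
case: pickle_inv => [[k1 i1] /= <-|//].
have := @pickle_invK _ m2 : oapp pickle m2 (pickle_inv m2 : option (nat * I)) = m2.
case: pickle_inv => [[k2 i2] /= <-|//].
move=> [[y1 [sy1 yi1]] xi1] [[y2 [sy2 yi2]] xi2].
have sx1 : stops S k0 k1 x by apply: stops_cell sy1; rewrite yi1.
have sx2 : stops S k0 k2 x by apply: stops_cell sy2; rewrite yi2.
have k12 := stops_uniq sx1 sx2.
by move: xi1 xi2; rewrite /cell/= k12 => <- <-.
Qed.

(** The cells at which the points stop are pairwise disjoint, so that a bound on
    each of them adds up. *)
Lemma stopped_le (nu1 nu2 : {measure set T -> \bar R}) (r : R) S k0 G :
  0 <= r -> (forall k i, measurable (G k i)) ->
  (forall k x, stops S k0 k x ->
    nu1 (G k (key k x)) <= r%:E * nu2 (cell k (key k x)))%E ->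
  (nu1 (stopped S k0 G) <= r%:E * nu2 (stopped S k0 cell))%E.
Proof.
move=> r0 mG le12.
rewrite [X in (_ * nu2 X)%E]stop_seqE measure_bigcup//; last first.
  by move=> m _; exact: measurable_stop_seq.
rewrite -nneseriesZl//.
apply: (@le_trans _ _ (\sum_(m <oo) nu1 (stop_seq S k0 G m))%E).
  apply: measure_sigma_subadditive; last by rewrite stop_seqE.
  - by move=> m; exact: measurable_stop_seq.
  - exact: measurable_stopped.
under [leRHS]eq_eseriesl do rewrite in_setT.
apply: lee_nneseries => // m _; rewrite /stop_seq.
case: pickle_inv => [[k i]|]; last by rewrite !measure0 mule0.
have [h|h] := pselect (exists y, stops S k0 k y /\ key k y = i).
  rewrite (_ : [set x | _] = G k i); last by apply/seteqP; split => x//= [].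
  rewrite (_ : [set x | _] = cell k i); last by apply/seteqP; split => x//= [].
  by have [y [sy <-]] := h; exact: le12.
rewrite (_ : [set x | _] = set0); last by apply/seteqP; split => x//= [].
by rewrite measure0 mule_ge0.
Qed.

End filtration.

(** * Differentiation in a regular filtration *)

(** What the stopping time arguments use of a dyadic grid. Outer approximation by
    unions of cells is what differentiation of integrals rests on. *)
Record regular_filtration d (T : measurableType d) (R : realType)
    (I : countType) (mu : {measure set T -> \bar R}) (key : nat -> T -> I)
    (D : R) : Prop := RegularFiltration {
  rf_cell : forall k i, measurable (cell key k i) ;
  rf_refine : forall k x y, key k.+1 x = key k.+1 y -> key k x = key k y ;
  rf_gt0 : forall k x, (0 < mu (cell key k (key k x)))%E ;
  rf_fin : forall k x, (mu (cell key k (key k x)) < +oo)%E ;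
  rf_outer : forall k0 x0 (E : set T) (e : R), measurable E ->
    E `<=` cell key k0 (key k0 x0) -> 0 < e ->
    exists S, E `<=` stopped key S k0 (cell key) /\
      (mu (stopped key S k0 (cell key)) <= mu E + e%:E)%E ;
  rf_D_gt0 : 0 < D ;
  rf_doubling : forall k x, (mu (cell key k (key k x)) <=
    D%:E * mu (cell key k.+1 (key k.+1 x)))%E }.

Section differentiation.
Context d (T : measurableType d) (R : realType) (I : countType).
Variable mu : {measure set T -> \bar R}.
Variables (key : nat -> T -> I) (D : R).
Hypothesis F : regular_filtration mu key D.

Let mcell k i : measurable (cell key k i).
Proof. exact: rf_cell F _ _. Qed.

Let refine k x y : key k.+1 x = key k.+1 y -> key k x = key k y.
Proof. exact: rf_refine F _ _ _. Qed.

Lemma measurable_bounded_averages (Q : nat -> I -> Prop) k0 :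
  measurable [set x | forall k, (k0 <= k)%N -> Q k (key k x)].
Proof.
rewrite (_ : [set x | _] =
    \bigcap_(k in [set k | (k0 <= k)%N]) [set x | Q k (key k x)]).
  apply: bigcap_measurable => [|k _]; first by exists k0 => /=.
  exact: (measurable_key mcell).
by apply/seteqP; split => x h k; exact: h.
Qed.

(** Almost everywhere, a function is at most twice any bound on its averages over
    small cells. With the factor 2 the proof is a single covering: [E] has almost
    the same measure as a union of disjoint cells that meet it, on each of which the
    average is at most [l], whereas [h] exceeds [2 * l] on [E]. The sharp inequality
    would require a density argument. *)
Lemma lossy_differentiation (h : T -> R) (l : R) k0 x0 :
  measurable_fun [set: T] h -> (forall x, 0 <= h x) -> 0 < l ->
  let E := [set x | [/\ key k0 x = key k0 x0, 2 * l < h x &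
    forall k, (k0 <= k)%N -> (\int[mu]_(y in cell key k (key k x)) (h y)%:E <=
       l%:E * mu (cell key k (key k x)))%E]] in
  measurable E /\ mu E = 0%E.
Proof.
move=> mh h0 l0 E.
pose Q k i := (\int[mu]_(y in cell key k i) (h y)%:E <= l%:E * mu (cell key k i))%E.
have mE : measurable E.
  rewrite (_ : E = cell key k0 (key k0 x0) `&` (h @^-1` `]2 * l, +oo[) `&`
      [set x | forall k, (k0 <= k)%N -> Q k (key k x)]).
    apply: measurableI; last exact: (measurable_bounded_averages Q).
    by apply: measurableI => //; rewrite -[X in measurable X]setTI; exact: mh.
  apply/seteqP; split => x; first by case=> h1 h2 h3; split => //; split => //=;
    rewrite in_itv/= h2.
  by case=> -[h1 /=]; rewrite in_itv/= andbT => h2 h3.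
have Ecell : E `<=` cell key k0 (key k0 x0) by move=> x [].
have Efin : (mu E < +oo)%E.
  by apply: le_lt_trans (le_measure mu _ _ Ecell) (rf_fin F k0 x0); rewrite inE.
have mEl : ((2 * l)%:E * mu E <= \int[mu]_(y in E) (h y)%:E)%E.
  rewrite -integral_cst//; apply: ge0_le_integral => //.
  - by move=> x _; rewrite lee_fin mulr_ge0// ltW.
  - by apply/measurable_EFinP; apply: measurable_funTS.
  - by move=> x [_ /ltW]; rewrite lee_fin.
have key_bound (e : R) : 0 < e -> ((2 * l)%:E * mu E <= l%:E * (mu E + e%:E))%E.
  move=> e0; have [S [ES Se]] := rf_outer F mE Ecell e0.
  pose S' k i := S k i /\ exists2 x, E x & key k x = i.
  have ES' : E `<=` stopped key S' k0 (cell key).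
    move=> x Ex; have := ES _ Ex; rewrite !stopped_cellE// => -[k k0k Sk].
    by exists k => //; split => //; exists x.
  have S'S : stopped key S' k0 (cell key) `<=` stopped key S k0 (cell key).
    by rewrite !stopped_cellE// => x [k k0k [Sk _]]; exists k.
  have mS S1 : measurable (stopped key S1 k0 (cell key)).
    exact: measurable_stopped.
  apply: le_trans mEl _; apply: (@le_trans _ _
      (density mu mh h0 (stopped key S' k0 (cell key)))).
    by apply: ge0_subset_integral => //;
      [apply/measurable_EFinP; exact: measurable_funTS|move=> x _; rewrite lee_fin].
  apply: (@le_trans _ _ (l%:E * mu (stopped key S' k0 (cell key)))%E).
    apply: (stopped_le mcell refine (nu1 := density mu mh h0)) => //; first exact: ltW.
    by move=> k x [k0k [_ [y [_ _ Ey] <-]] _]; exact: Ey.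
  rewrite lee_pmul2l//; apply: le_trans _ Se.
  by apply: le_measure; rewrite ?inE.
split=> //; apply/eqP; rewrite eq_le measure_ge0 andbT.
apply/lee_addgt0Pr => e e0; rewrite add0e.
have := key_bound _ e0.
have : mu E \is a fin_num by rewrite ge0_fin_numE.
move: (mu E) => [m| |]//= _; rewrite -EFinD -!EFinM !lee_fin => h1.
rewrite -(ler_pM2l l0); lra.
Qed.

End differentiation.

(** * The John-Nirenberg inequality for a weight *)

(** One generation of stopping cells moves the constants by at most [2 * A * D + A],
    and the distance to the constant is at most [4 * A] at almost every point which
    is never stopped: a step exceeds both. *)
Definition jn_step (R : realType) (A D : R) : R := 2 * A * D + 5 * A.

(** An [A1] weight of constant [K] gives a subset of at most half the measure of a
    cell at most this proportion of the weight of the cell. *)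
Definition jn_ratio (R : realType) (K : R) : R := 1 - (2 * K)^-1.

Section john_nirenberg.
Context d (T : measurableType d) (R : realType) (I : countType).
Variable mu : {measure set T -> \bar R}.
Variables (key : nat -> T -> I) (D : R).
Hypothesis F : regular_filtration mu key D.

Let mcell k i : measurable (cell key k i).
Proof. exact: rf_cell F _ _. Qed.

Let refine k x y : key k.+1 x = key k.+1 y -> key k x = key k y.
Proof. exact: rf_refine F _ _ _. Qed.

Let cell_gt0 k x : (0 < mu (cell key k (key k x)))%E.
Proof. exact: rf_gt0 F _ _. Qed.

Let cell_fin k x : (mu (cell key k (key k x)) < +oo)%E.
Proof. exact: rf_fin F _ _. Qed.

Let D_gt0 : 0 < D := rf_D_gt0 F.

Variables (b : T -> R) (c : nat -> I -> R) (A : R).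
Hypothesis mb : measurable_fun [set: T] b.
Hypothesis A_gt0 : 0 < A.
Hypothesis osc : forall k x, (\int[mu]_(y in cell key k (key k x))
  `|b y - c k (key k x)|%:E <= A%:E * mu (cell key k (key k x)))%E.

Let mdist a : measurable_fun [set: T] (fun y => `|b y - a|).
Proof. by apply: measurableT_comp => //; exact: measurable_funB. Qed.

Let emdist a E : measurable_fun E (fun y => `|b y - a|%:E).
Proof. by apply/measurable_EFinP; apply: measurable_funTS. Qed.

(** The constants of the oscillation condition are determined up to a multiple of
    [A]. *)
Lemma dist_constants k x a r :
  (\int[mu]_(y in cell key k (key k x)) `|b y - a|%:E <=
     r%:E * mu (cell key k (key k x)))%E ->
  `|c k (key k x) - a| <= r + A.
Proof.
move=> ha; set P := cell _ _ _ in ha *.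
have mP : measurable P by exact: mcell.
have Pfin : mu P \is a fin_num by rewrite ge0_fin_numE//; exact: cell_fin.
have P0 : (0 < mu P)%E by exact: cell_gt0.
rewrite -lee_fin -(@lee_pmul2r _ (mu P)) // EFinD muleDl//.
apply: (@le_trans _ _ (\int[mu]_(y in P) (`|b y - a|%:E + `|b y - c k (key k x)|%:E))%E).
  rewrite -integral_cst//; apply: ge0_le_integral => //.
  - by move=> y _; rewrite lee_fin.
  - by apply: emeasurable_funD; exact: emdist.
  move=> y _; rewrite /= -EFinD lee_fin.
  rewrite (_ : c k _ - a = (b y - a) - (b y - c k (key k x))); last by ring.
  exact: ler_normB.
by rewrite ge0_integralD//; apply: leeD => //; exact: osc.
Qed.

(** Including the constants of the smaller cells makes this set large enough to
    contain the points at which an average over a small cell is compared with the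
    constant of a much larger one. *)
Definition far t k i : set T := [set x | key k x = i /\
  (t <= `|b x - c k i| \/
   exists2 k', (k <= k')%N & t <= `|c k' (key k' x) - c k i|)].

Lemma measurable_far t k i : measurable (far t k i).
Proof.
rewrite (_ : far t k i = cell key k i `&`
   ((fun x => `|b x - c k i|) @^-1` `[t, +oo[ `|`
    \bigcup_(k' in [set k' | (k <= k')%N])
      [set x | t <= `|c k' (key k' x) - c k i|])).
  apply: measurableI => //; apply: measurableU.
    by rewrite -[X in measurable X]setTI; exact: mdist.
  apply: bigcup_measurable => k' _.
  exact: (measurable_key mcell k' [set j | t <= `|c k' j - c k i|]).
apply/seteqP; split => x [xk].
  move=> [tb|[k' kk' tk']]; split => //; first by left; rewrite /= in_itv/= tb.
  by right; exists k'.
rewrite /= in_itv/= andbT => -[tb|[k' kk' tk']]; split => //; first by left.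
by right; exists k'.
Qed.

Variable w : T -> R.
Hypothesis mw : measurable_fun [set: T] w.
Hypothesis w_ge0 : forall x, 0 <= w x.
Let W := density mu mw w_ge0.
Hypothesis W_fin : forall k x, (W (cell key k (key k x)) < +oo)%E.
Variable K : R.
Hypothesis K_ge1 : 1 <= K.
Hypothesis a1 : forall k x (E : set T), measurable E ->
  E `<=` cell key k (key k x) ->
  (W (cell key k (key k x)) * mu E <=
     K%:E * mu (cell key k (key k x)) * W E)%E.

(* The cells where the average distance to the constant of the cell of [x] first
   doubles. *)
Let U k x := stopped key (fun k' i => (exists y, key k' y = i /\ key k y = key k x) /\
  ((2 * A)%:E * mu (cell key k' i) <
     \int[mu]_(y in cell key k' i) `|b y - c k (key k x)|%:E)%E) k (cell key).

Let U_sub k x : U k x `<=` cell key k (key k x).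
Proof.
move=> y; rewrite /U stopped_cellE// => -[k' kk' [[z [zy zx]] _]].
by rewrite /cell/= -zx; apply: (key_le refine kk').
Qed.

Let measurable_U k x : measurable (U k x).
Proof. exact: measurable_stopped. Qed.

Let mu_U k x : (2%:E * mu (U k x) <= mu (cell key k (key k x)))%E.
Proof.
have h0 : forall y, 0 <= `|b y - c k (key k x)| by [].
pose nu := density mu (mdist (c k (key k x))) h0.
have le1 : (mu (U k x) <= (2 * A)^-1%:E * nu (U k x))%E.
  apply: (stopped_le mcell refine (nu2 := nu)) => //.
    by rewrite invr_ge0 mulr_ge0// ltW.
  move=> k' y [_ [_ /ltW leU _]]; rewrite /nu /= /density.
  by rewrite lee_pdivlMl// mulr_gt0.
have le2 : (nu (U k x) <= A%:E * mu (cell key k (key k x)))%E.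
  by apply: le_trans _ (osc k x); apply: ge0_subset_integral.
rewrite -(@lee_pmul2l _ A%:E)//.
apply: le_trans _ le2; rewrite muleA -EFinM mulrC.
by rewrite -lee_pdivlMl// mulr_gt0.
Qed.

Let ratio := jn_ratio K.

Let W_U k x : (W (U k x) <= ratio%:E * W (cell key k (key k x)))%E.
Proof.
set P := cell key k (key k x).
have sub : P `\` U k x `<=` P by move=> y [].
have mP : measurable (P `\` U k x) by apply: measurableD; [exact: mcell|exact: measurable_U].
have := a1 mP sub.
have muP : mu P \is a fin_num by rewrite ge0_fin_numE//; exact: cell_fin.
have WP : W P \is a fin_num by rewrite ge0_fin_numE//; exact: W_fin.
have muU : mu (U k x) \is a fin_num.
  rewrite ge0_fin_numE//; apply: le_lt_trans _ (cell_fin k x).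
  by apply: le_measure; rewrite ?inE//; exact: U_sub.
have WU : W (U k x) \is a fin_num.
  rewrite ge0_fin_numE//; apply: le_lt_trans _ (W_fin k x).
  by apply: le_measure; rewrite ?inE//; exact: U_sub.
have PU : P `&` U k x = U k x by apply: setIidr; exact: U_sub.
have mP' : measurable P by exact: mcell.
have -> : mu (P `\` U k x) = (mu P - mu (U k x))%E.
  by rewrite measureD ?PU//; exact: cell_fin.
have -> : W (P `\` U k x) = (W P - W (U k x))%E.
  by rewrite /W measureD ?PU//; exact: W_fin.
rewrite -/P.
have := mu_U k x; rewrite -/P; have := cell_gt0 k x; rewrite -/P.
have : (0 <= W P)%E by exact: measure_ge0.
move: muP WP muU WU.
move: (mu P) (W P) (mu (U k x)) (W (U k x)) => [p| |]// [q| |]// [u| |]// [v| |]// _ _ _ _.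
rewrite -!EFinM !lee_fin lte_fin => q0 p0 up h.
have K0 : 0 < K by exact: lt_le_trans ltr01 K_ge1.
have : q * (p / 2) <= K * p * (q - v) by apply: le_trans _ h; rewrite ler_wpM2l//; lra.
rewrite (_ : K * p * (q - v) = p * (K * (q - v))); last by ring.
rewrite (_ : q * (p / 2) = p * (q / 2)); last by ring.
rewrite ler_pM2l// => h1.
have : (2 * K)^-1 * q <= q - v by rewrite ler_pdivrMl ?mulr_gt0//; lra.
by rewrite /ratio /jn_ratio mulrBl mul1r => h2; lra.
Qed.

Let step := jn_step A D.

Let W_null (N : set T) : measurable N -> mu N = 0%E -> W N = 0%E.
Proof.
move=> mN N0; apply: null_set_integral => //.
by apply/measurable_EFinP; apply: measurable_funTS.
Qed.

Let ratio_ge0 : 0 <= ratio.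
Proof.
rewrite /ratio /jn_ratio subr_ge0 invf_le1; first by have := K_ge1; lra.
by rewrite mulr_gt0// (lt_le_trans ltr01 K_ge1).
Qed.

(** By induction on [m]: up to a null set, a point far from the constant of a cell
    lies in a stopping cell, whose constant is within one step of the former since
    the parent of that cell is not selected; so the point is still far, by one step
    less, from the constant of the stopping cell. The stopping cells carry a
    proportion [ratio] of the weight. *)
Lemma weighted_john_nirenberg m k x :
  (W (far (m%:R * step)%R k (key k x)) <=
     (ratio ^+ m)%:E * W (cell key k (key k x)))%E.
Proof.
elim: m k x => [|m ih] k x.
  rewrite expr0 mul1e; apply: le_measure; rewrite ?inE//; first exact: measurable_far.
  by move=> y [].
set P := cell key k (key k x); pose a := c k (key k x).
pose S := fun k' i => (exists y, key k' y = i /\ key k y = key k x) /\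
  ((2 * A)%:E * mu (cell key k' i) <
     \int[mu]_(y in cell key k' i) `|b y - a|%:E)%E.
(* points never stopped, and yet far: negligible by differentiation *)
pose N := [set y | [/\ key k y = key k x, 2 * (2 * A) < `|b y - a| &
  forall k', (k <= k')%N -> (\int[mu]_(z in cell key k' (key k' y)) `|b z - a|%:E
    <= (2 * A)%:E * mu (cell key k' (key k' y)))%E]].
have [mN N0] : measurable N /\ mu N = 0%E.
  by apply: (lossy_differentiation F);
    rewrite ?mulr_gt0.
have step_ge : 5 * A <= step.
  by rewrite /step /jn_step lerDr ?mulr_ge0// ltW ?mulr_gt0.
have stepm : step <= m.+1%:R * step.
  by rewrite ler_peMl ?ler1n//; apply: le_trans step_ge; rewrite mulr_ge0// ltW.
have notS k' y : (k <= k')%N -> key k y = key k x -> ~ S k' (key k' y) ->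
    (\int[mu]_(z in cell key k' (key k' y)) `|b z - a|%:E
       <= (2 * A)%:E * mu (cell key k' (key k' y)))%E.
  move=> kk' yx nS; rewrite leNgt; apply/negP => h; apply: nS; split => //.
  by exists y.
have far_sub : far (m.+1%:R * step) k (key k x) `<=`
    N `|` stopped key S k (far (m%:R * step)).
  move=> y [yx]; rewrite -/a => fy.
  have near_before k' : (k <= k')%N -> ~ S k' (key k' y) ->
      ~ m.+1%:R * step <= `|c k' (key k' y) - a|.
    move=> kk' nS le1; have := dist_constants (notS _ _ kk' yx nS).
    by have := A_gt0; move: (le_trans stepm le1) => {}le1; lra.
  have [[k' kk' Sk']|nS] := pselect (exists2 k', (k <= k')%N & S k' (key k' y)).
    right; have [k1 [[kk1 S1 nS1] _]] := ex_stops kk' Sk'.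
    exists k1, y; split; first by split.
    (* the cell [k] itself is not selected, so the stopping cell has a parent *)
    have lt_k_k1 : (k < k1)%N.
      rewrite ltn_neqAle kk1 andbT; apply/negP => /eqP kE.
      move: S1; rewrite -kE yx => -[_]; apply/negP; rewrite -leNgt.
      apply: le_trans (osc k x) _; rewrite lee_pmul2r//.
        by rewrite lee_fin; have := A_gt0; lra.
      by rewrite ge0_fin_numE.
    have kE : k1 = k1.-1.+1 by rewrite prednK// (leq_ltn_trans _ lt_k_k1).
    have dist1 : `|c k1 (key k1 y) - a| <= 2 * A * D + A.
      apply: dist_constants.
      have kk1' : (k <= k1.-1)%N by rewrite -ltnS -kE.
      have := notS _ _ kk1' yx (nS1 k1.-1 _).
      rewrite kk1' -ltnS -kE ltnS leqnn => /(_ isT) le1.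
      apply: (@le_trans _ _ (\int[mu]_(z in cell key k1.-1 (key k1.-1 y)) `|b z - a|%:E)%E).
        apply: ge0_subset_integral => //.
        by move=> z; rewrite /cell/= kE; exact: refine.
      apply: le_trans le1 _.
      rewrite (EFinM (2 * A) D) -muleA lee_pmul2l ?lte_fin ?mulr_gt0//.
      by rewrite [in leRHS]kE; exact: rf_doubling F _ _.
    split => //; case: fy => [fy|[k2 kk2 fy]].
      left; have := ler_distD (c k1 (key k1 y)) (b y) a.
      move: fy; rewrite -natr1 mulrDl mul1r /step /jn_step; have := A_gt0; lra.
    have [k12|k21] := leqP k1 k2.
      right; exists k2 => //.
      have := ler_distD (c k1 (key k1 y)) (c k2 (key k2 y)) a.
      move: fy; rewrite -natr1 mulrDl mul1r /step /jn_step; have := A_gt0; lra.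
    have nS2 : ~ S k2 (key k2 y) by apply: nS1; rewrite kk2.
    by have := near_before _ kk2 nS2 fy.
  left; split => //.
    case: fy => [fy|[k2 kk2 fy]].
      by have := le_trans stepm fy; have := A_gt0; lra.
    have nS2 : ~ S k2 (key k2 y) by move=> S2; apply: nS; exists k2.
    by have := near_before _ kk2 nS2 fy.
  by move=> k' kk'; apply: notS => // S2; apply: nS; exists k'.
have mG : measurable (stopped key S k (far (m%:R * step))).
  by apply: measurable_stopped => *; exact: measurable_far.
apply: (@le_trans _ _ (W (N `|` stopped key S k (far (m%:R * step))))).
  apply: le_measure => //; rewrite inE; first exact: measurable_far.
  exact: measurableU.
apply: le_trans (measureU2 _ mN mG) _; rewrite [X in (X + _)%E](W_null mN N0) [leLHS]add0e.
apply: (@le_trans _ _ ((ratio ^+ m)%:E * W (U k x))%E).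
  apply: (stopped_le mcell refine (nu1 := W) (nu2 := W)).
  - by rewrite exprn_ge0.
  - by move=> *; exact: measurable_far.
  - by move=> k' y _; exact: ih.
by rewrite exprSr EFinM -muleA lee_wpmul2l ?lee_fin ?exprn_ge0.
Qed.

End john_nirenberg.

(** * Geometric series, and Young's inequality for [Phi] *)

Lemma nneseries_geometric_le (R : realType) (x : R) : 0 <= x < 1 ->
  (\sum_(m <oo) (x ^+ m)%:E <= ((1 - x)^-1)%:E)%E.
Proof.
move=> /andP[x0 x1]; apply: lime_le.
  by apply: is_cvg_ereal_nneg_natsum => m _; rewrite lee_fin exprn_ge0.
apply: nearW => n; rewrite sumEFin lee_fin.
move: x0; rewrite le_eqVlt => /predU1P[<-|x0].
  rewrite subr0 invr1; case: n => [|n]; first by rewrite big_geq.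
  rewrite big_nat_recl// expr0 big1 ?addr0// => i _.
  by rewrite expr0n.
have := @geometric_le_lim R n 1 x ler01 x0.
rewrite (ger0_norm (ltW x0)) mul1r => /(_ x1); apply: le_trans.
by rewrite /series/=; apply: ler_sum => i _; rewrite mul1r.
Qed.

Lemma natSM_geometric_le (R : realType) (x : R) m : 0 < x < 1 ->
  m.+1%:R * x ^+ m <= (1 - x)^-1.
Proof.
move=> /andP[x0 x1].
have := @geometric_le_lim R m.+1 1 x ler01 x0.
rewrite (ger0_norm (ltW x0)) mul1r => /(_ x1); apply: le_trans.
rewrite /series/= big_mkord mulr_natl -[X in _ *+ X]card_ord -sumr_const.
apply: ler_sum => i _; rewrite mul1r.
by apply: ler_wiXn2l; rewrite ?ltW// -ltnS.
Qed.

Section phi.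
Context {R : realType}.
Implicit Types s t : R.

Lemma log_plus_ge0 t : 0 <= log_plus t.
Proof. by rewrite /log_plus le_max lexx orbT. Qed.

Lemma le_Phi t : 0 <= t -> t <= Phi t.
Proof. by move=> t0; rewrite /Phi ler_peMr// lerDl log_plus_ge0. Qed.

Lemma Phi_ge0 t : 0 <= t -> 0 <= Phi t.
Proof. by move=> t0; apply: le_trans _ (le_Phi t0). Qed.

Lemma measurable_Phi : measurable_fun [set: R] (@Phi R).
Proof.
apply: measurable_funM => //; apply: measurable_funD => //.
by apply: measurable_maxr => //; exact: measurable_ln.
Qed.

Lemma log_plusM s t : 0 < s -> 0 <= t -> log_plus (s * t) <= log_plus s + log_plus t.
Proof.
move=> s0; rewrite le_eqVlt => /predU1P[<-|t0].
  rewrite mulr0 {1}/log_plus ln0// maxxx addr_ge0// log_plus_ge0//.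
rewrite {1}/log_plus ge_max addr_ge0 ?log_plus_ge0// andbT.
by rewrite lnM ?posrE// lerD// /log_plus le_max lexx.
Qed.

Lemma PhiM s t : 0 < s -> 0 <= t -> Phi (s * t) <= s * (1 + log_plus s) * Phi t.
Proof.
move=> s0 t0; rewrite /Phi -!mulrA ler_pM2l// [leRHS]mulrCA ler_wpM2l//.
have := log_plusM s0 t0; have := log_plus_ge0 s; have := log_plus_ge0 t.
move: (log_plus _) (log_plus _) (log_plus _) => u v r; nra.
Qed.

(** The constant [tau] in front of the exponential can be taken small, at the cost
    of the constant in front of [Phi]; the exponential is a discrete one, fit for
    the level sets of the John-Nirenberg inequality. *)
Lemma young_Phi (step tau : R) : 0 < step -> 0 < tau ->
  exists2 C : R, 0 < C & forall s t m, 0 <= t -> s <= m.+1%:R * step ->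
    s * t <= C * Phi t + tau * (3 / 2) ^+ m.
Proof.
move=> step0 tau0.
pose th := Num.min 1 (tau / (6 * step)).
have th0 : 0 < th by rewrite /th lt_min ltr01 divr_gt0// mulr_gt0.
have th1 : th <= 1 by rewrite /th ge_min lexx.
have lnth : 0 <= - ln th by rewrite oppr_ge0 ln_le0.
pose L : R := ln (5 / 4).
have L0 : 0 < L by rewrite ln_gt0//; lra.
have C0 : 0 < 1 + (1 - ln th) / L by rewrite addr_gt0// divr_gt0//; lra.
exists (step * (1 + (1 - ln th) / L)); first by rewrite mulr_gt0.
move=> s t m t0 sm; have P0 := Phi_ge0 t0.
(* [5/4] leaves room below [3/2] for the factor [m.+1]; if [t] is larger than this
   exponential, then [m] is at most a multiple of [1 + log_plus t] *)
have [tle|tgt] := leP t (th * (5 / 4) ^+ m).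
  apply: (@le_trans _ _ (tau * (3 / 2) ^+ m)); last first.
    by rewrite lerDr; apply: mulr_ge0 => //; apply/ltW/mulr_gt0 => //; exact: mulr_gt0.
  apply: (@le_trans _ _ (m.+1%:R * step * (th * (5 / 4) ^+ m))).
    apply: (le_trans (ler_wpM2r t0 sm)).
    by rewrite ler_wpM2l// mulr_ge0// ltW.
  have h56 : m.+1%:R * (5 / 6) ^+ m <= (6 : R).
    have := @natSM_geometric_le R (5 / 6) m; rewrite (_ : (1 - 5 / 6)^-1 = 6 :> R).
      by apply; apply/andP; split; lra.
    by rewrite (_ : 1 - 5 / 6 = 6^-1 :> R) ?invrK//; lra.
  have e54 : (5 / 4) ^+ m = (5 / 6) ^+ m * (3 / 2) ^+ m :> R.
    by rewrite -exprMn; congr (_ ^+ m); lra.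
  have thle : th * (6 * step) <= tau.
    by rewrite -ler_pdivlMr ?mulr_gt0// /th ge_min lexx orbT.
  rewrite e54; have h32 : 0 <= (3 / 2 : R) ^+ m by rewrite exprn_ge0//; lra.
  rewrite [leLHS](_ : _ = m.+1%:R * (5 / 6) ^+ m * (step * th) * (3 / 2) ^+ m); last by ring.
  rewrite ler_wpM2r//; apply: le_trans _ thle.
  rewrite [leRHS](_ : _ = 6 * (step * th)); last by ring.
  by rewrite ler_wpM2r// mulr_ge0// ltW.
have t_gt0 : 0 < t.
  apply: le_lt_trans _ tgt; apply: mulr_ge0; first exact: ltW.
  by apply: exprn_ge0; lra.
apply: (@le_trans _ _ (step * (1 + (1 - ln th) / L) * Phi t)); last first.
  rewrite lerDl; apply: mulr_ge0; first exact: ltW.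
  by apply: exprn_ge0; lra.
have mL : m%:R * L <= log_plus t - ln th.
  rewrite lerBrDr /L mulr_natl -lnXn; last by lra.
  have h54 : 0 < (5 / 4 : R) by lra.
  rewrite addrC -lnM ?posrE ?exprn_gt0//.
  apply: (@le_trans _ _ (ln t)); last by rewrite /log_plus le_max lexx.
  rewrite ler_ln ?posrE//; first exact: ltW.
  by apply: mulr_gt0 => //; apply: exprn_gt0; lra.
have mle : m.+1%:R <= (1 + (1 - ln th) / L) * (1 + log_plus t).
  have : m%:R <= (log_plus t - ln th) / L by rewrite ler_pdivlMr.
  rewrite -natr1; have := log_plus_ge0 t; move: (log_plus t) => p p0 h.
  have : 0 <= L^-1 by rewrite invr_ge0 ltW.
  move: h lnth; move: (ln th) L^-1 m%:R => q l x h1 h2 h3.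
  have : 0 <= p * l by rewrite mulr_ge0.
  have : 0 <= - q * l by rewrite mulr_ge0.
  have : 0 <= p * l * - q by rewrite mulr_ge0// mulr_ge0.
  nra.
apply: (le_trans (ler_wpM2r t0 sm)); rewrite /Phi.
rewrite [leRHS](_ : _ = step * t * ((1 + (1 - ln th) / L) * (1 + log_plus t))); last by ring.
rewrite [leLHS](_ : _ = step * t * m.+1%:R); last by ring.
by rewrite ler_wpM2l// mulr_ge0// ltW.
Qed.

End phi.

(** * The product of an oscillation with a function *)

Section oscillation_product.
Context d (T : measurableType d) (R : realType) (I : countType).
Variable mu : {measure set T -> \bar R}.
Variables (key : nat -> T -> I) (D : R).
Hypothesis F : regular_filtration mu key D.
Variables (b : T -> R) (c : nat -> I -> R) (A : R).
Hypothesis mb : measurable_fun [set: T] b.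
Hypothesis A_gt0 : 0 < A.
Hypothesis osc : forall k x, (\int[mu]_(y in cell key k (key k x))
  `|b y - c k (key k x)|%:E <= A%:E * mu (cell key k (key k x)))%E.

Let step := jn_step A D.

Let step_gt0 : 0 < step.
Proof.
by rewrite /step /jn_step addr_gt0 ?mulr_gt0// (rf_D_gt0 F).
Qed.

Let mcell k i : measurable (cell key k i).
Proof. exact: rf_cell F _ _. Qed.

Let john_nirenberg m k x : (mu (far key b c (m%:R * step)%R k (key k x)) <=
  (2^-1 ^+ m)%:E * mu (cell key k (key k x)))%E.
Proof.
pose one := fun _ : T => 1 : R.
have m1 : measurable_fun [set: T] one by exact: measurable_cst.
have one_ge0 : forall x, 0 <= one x by [].
have oneE E : measurable E -> density mu m1 one_ge0 E = mu E.
  by move=> mE; rewrite -[RHS]mul1e -integral_cst.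
have mf := measurable_far F c mb.
have := @weighted_john_nirenberg _ _ _ _ _ _ _ F b c A mb A_gt0 osc one m1
  one_ge0 _ 1 _ _ m k x.
rewrite !oneE// /jn_ratio mulr1 (_ : 1 - 2^-1 = 2^-1 :> R); last by lra.
apply => //.
  by move=> k' x'; rewrite oneE//; exact: rf_fin F _ _.
by move=> k' x' E mE _; rewrite !oneE// mul1e.
Qed.

(** Young's inequality, with [m] the number of steps between [b y] and the constant
    of the cell: the sum of the exponentials is integrable because [(3/2) ^+ m] grows
    more slowly than the measure [2 ^- m] of the level sets decays. *)
Lemma oscillation_product (C tau : R) (h : T -> R) k x :
  0 <= C -> 0 <= tau ->
  (forall s t m, 0 <= t -> s <= m.+1%:R * step ->
     s * t <= C * Phi t + tau * (3 / 2) ^+ m) ->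
  measurable_fun [set: T] h -> (forall y, 0 <= h y) ->
  (\int[mu]_(y in cell key k (key k x)) (`|b y - c k (key k x)| * h y)%:E <=
    C%:E * \int[mu]_(y in cell key k (key k x)) (Phi (h y))%:E +
    (4 * tau)%:E * mu (cell key k (key k x)))%E.
Proof.
move=> C0 tau0 young mh h0; set P := cell key k (key k x); set a := c k (key k x).
pose f m := far key b c (m%:R * step)%R k (key k x).
have mf m : measurable (f m) by exact: (measurable_far F c mb).
have mP : measurable P by exact: mcell.
pose v m y : \bar R := (tau * (3 / 2) ^+ m * \1_(f m) y)%:E.
have v0 m y : (0 <= v m y)%E.
  rewrite lee_fin; apply: mulr_ge0 => //; apply: mulr_ge0 => //.
have mv m : measurable_fun P (v m).
  by apply/measurable_EFinP; apply: measurable_funM => //; exact: measurable_indic.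
have mV : measurable_fun P (fun y => \sum_(m <oo) v m y)%E.
  by apply: ge0_emeasurable_sum => // m y _ _; exact: v0.
have mPhi : measurable_fun P (fun y => (Phi (h y))%:E).
  apply/measurable_EFinP; apply: measurable_funTS.
  by apply: measurableT_comp mh; exact: measurable_Phi.
have Phi0 y : (0 <= (Phi (h y))%:E)%E by rewrite lee_fin Phi_ge0.
apply: (@le_trans _ _
   (\int[mu]_(y in P) (C%:E * (Phi (h y))%:E + \sum_(m <oo) v m y))%E).
  apply: ge0_le_integral => //.
  - by move=> y _; rewrite lee_fin mulr_ge0.
  - apply/measurable_EFinP; apply: measurable_funTS; apply: measurable_funM => //.
    by apply: measurableT_comp => //; exact: measurable_funB.
  - by apply: emeasurable_funD => //; exact: measurable_funeM.
  move=> y Py; pose m := Num.truncn (`|b y - a| / step).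
  have fy : f m y.
    split => //; left; rewrite -ler_pdivlMr// truncn_le divr_ge0// ltW//.
  apply: (@le_trans _ _ (C%:E * (Phi (h y))%:E + v m y)%E).
    rewrite /v indicE mem_set// mulr1 -EFinM -EFinD lee_fin.
    by apply: young => //; rewrite -ler_pdivrMr// ltW// truncnS_gt.
  apply: leeD => //.
  have := @nneseries_lim_ge R (v ^~ y) xpredT 0%N m.+1.
  rewrite big_nat_recr//= => /(_ (fun _ _ _ => v0 _ _)); apply: le_trans.
  by rewrite leeDr// sume_ge0.
rewrite ge0_integralD//; last 3 first.
- by move=> y _; rewrite mule_ge0// lee_fin.
- exact: measurable_funeM.
- by move=> y _; apply: nneseries_ge0 => m _ _.
apply: leeD.
  by rewrite ge0_integralZl// lee_fin.
rewrite integral_nneseries//.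
have [p p0 pE] : exists2 p : R, 0 <= p & mu P = p%:E.
  exists (fine (mu P)); first by rewrite fine_ge0.
  by rewrite fineK// ge0_fin_numE//; exact: (rf_fin F).
have h32 m : 0 <= (3 / 2 : R) ^+ m by apply: exprn_ge0; lra.
have h34 m : 0 <= (3 / 4 : R) ^+ m by apply: exprn_ge0; lra.
apply: (@le_trans _ _ (\sum_(m <oo) ((tau * p)%:E * ((3 / 4) ^+ m)%:E))%E).
  apply: lee_nneseries => [m _ _|m _]; first by apply: integral_ge0.
  rewrite /v; under eq_integral do rewrite EFinM.
  rewrite ge0_integralZl//; last 2 first.
  - by apply/measurable_EFinP; exact: measurable_indic.
  - by rewrite lee_fin mulr_ge0.
  rewrite integral_indic// (setIidl (_ : f m `<=` P)); last by move=> y [].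
  apply: (le_trans (lee_wpmul2l _ (john_nirenberg m k x))).
    by rewrite lee_fin mulr_ge0.
  rewrite -/P pE -!EFinM lee_fin.
  have -> : (3 / 4) ^+ m = (3 / 2) ^+ m * 2^-1 ^+ m :> R.
    by rewrite -exprMn; congr (_ ^+ m); lra.
  by move: ((3 / 2) ^+ m) (2^-1 ^+ m) => r1 r2; lra.
rewrite nneseriesZl; last by move=> m _; rewrite lee_fin.
have lt34 : 0 <= (3 / 4 : R) < 1 by apply/andP; split; lra.
apply: (le_trans (lee_wpmul2l _ (nneseries_geometric_le lt34))).
  by rewrite lee_fin mulr_ge0.
rewrite pE -!EFinM lee_fin (_ : 1 - 3 / 4 = 4^-1); last by lra.
by rewrite invrK; lra.
Qed.

End oscillation_product.

(** * The weight of a union of stopping cells *)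

Lemma le_powR_interp (R : realType) (v q r kappa : R) : 0 < kappa < 1 ->
  0 <= v -> v <= q -> v <= r -> v <= q `^ kappa * r `^ (1 - kappa).
Proof.
move=> /andP[k0 k1] v0 vq vr.
have [->|v_neq0] := eqVneq v 0; first by rewrite mulr_ge0 ?powR_ge0.
have -> : v = v `^ kappa * v `^ (1 - kappa).
  by rewrite -powRD ?v_neq0 ?implybT// addrC subrK powRr1.
apply: ler_pM; rewrite ?powR_ge0//.
  by apply: ge0_ler_powR; rewrite ?nnegrE//; [exact: ltW|exact: le_trans vq].
apply: ge0_ler_powR; rewrite ?nnegrE//; last exact: le_trans vr.
by rewrite subr_ge0 ltW.
Qed.

(** The [A1] condition on the cells; the essential infimum is expressed by an
    inequality at almost every point. *)
Record cell_A1 d (T : measurableType d) (R : realType) (I : countType)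
    (mu : {measure set T -> \bar R}) (key : nat -> T -> I)
    (w : T -> R) (K : R) : Prop := CellA1 {
  ca_meas : measurable_fun [set: T] w ;
  ca_ge0 : forall x, 0 <= w x ;
  ca_fin : forall k x, (\int[mu]_(y in cell key k (key k x)) (w y)%:E < +oo)%E ;
  ca_gt0 : forall k x, (0 < \int[mu]_(y in cell key k (key k x)) (w y)%:E)%E ;
  ca_K_ge1 : 1 <= K ;
  ca_ae : forall k x, {ae mu, forall z, cell key k (key k x) z ->
    (\int[mu]_(y in cell key k (key k x)) (w y)%:E <=
       (K * w z)%:E * mu (cell key k (key k x)))%E} }.

Section weights.
Context d (T : measurableType d) (R : realType) (I : countType).
Variable mu : {measure set T -> \bar R}.
Variables (key : nat -> T -> I) (D : R).
Hypothesis F : regular_filtration mu key D.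
Variables (w : T -> R) (K : R).
Hypothesis Hw : cell_A1 mu key w K.

Let mcell k i : measurable (cell key k i).
Proof. exact: rf_cell F _ _. Qed.

Let refine k x y : key k.+1 x = key k.+1 y -> key k x = key k y.
Proof. exact: rf_refine F _ _ _. Qed.

Let mw := ca_meas Hw.
Let w_ge0 := ca_ge0 Hw.
Let W := density mu mw w_ge0.
Let K_gt0 : 0 < K := lt_le_trans ltr01 (ca_K_ge1 Hw).

(** The average of [h] over a cell is at most a constant times its average for the
    measure of density [w]. *)
Lemma A1_transfer k x (E : set T) (h : T -> R) :
  measurable E -> E `<=` cell key k (key k x) ->
  measurable_fun [set: T] h -> (forall y, 0 <= h y) ->
  (W (cell key k (key k x)) * \int[mu]_(y in E) (h y)%:E <=
   K%:E * mu (cell key k (key k x)) * \int[mu]_(y in E) (h y * w y)%:E)%E.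
Proof.
move=> mE EP mh h0; set P := cell key k (key k x).
have W0 : (0 <= W P)%E by exact: measure_ge0.
have mhw : measurable_fun E (fun y => (h y * w y)%:E).
  apply/measurable_EFinP; apply: measurable_funTS; exact: measurable_funM.
have mhE : measurable_fun E (fun y => (h y)%:E).
  by apply/measurable_EFinP; apply: measurable_funTS.
rewrite -ge0_integralZl//; last by move=> y _; rewrite lee_fin.
rewrite -ge0_integralZl//; last 2 first.
- by move=> y _; rewrite lee_fin mulr_ge0.
- by rewrite mule_ge0// lee_fin ltW.
apply: ae_ge0_le_integral => //.
- by move=> y _; rewrite mule_ge0// lee_fin.
- exact: measurable_funeM.
- move=> y _; rewrite mule_ge0//; last by rewrite lee_fin mulr_ge0.
  by rewrite mule_ge0// lee_fin ltW.
- exact: measurable_funeM.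
have := ca_ae Hw k x; apply: filterS => y h1 Ey.
have /(lee_wpmul2r _) := h1 (EP _ Ey).
move=> /(_ (h y)%:E); rewrite lee_fin => /(_ (h0 y)) /le_trans; apply.
rewrite EFinM [in leRHS]EFinM le_eqVlt; apply/orP; left; apply/eqP.
by rewrite -!muleA; congr (_ * _)%E; rewrite muleC -muleA.
Qed.

Lemma A1_sets k x (E : set T) : measurable E ->
  E `<=` cell key k (key k x) ->
  (W (cell key k (key k x)) * mu E <= K%:E * mu (cell key k (key k x)) * W E)%E.
Proof.
move=> mE EP; have := @A1_transfer k x E (fun=> 1) mE EP.
under [X in _ -> _ -> (_ <= _ * X)%E]eq_integral do rewrite mul1r.
rewrite integral_cst// mul1e; apply => //.
Qed.

Variables (B : set T) (K0 : nat) (x0 : T) (CB kappa : R).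
Hypothesis mB : measurable B.
Hypothesis B_cell : B `<=` cell key K0 (key K0 x0).
Hypothesis CB_ge1 : 1 <= CB.
Hypothesis W_B : (W (cell key K0 (key K0 x0)) <= CB%:E * W B)%E.
Hypothesis kappa01 : 0 < kappa < 1.

Variables (h : T -> R) (N : R).
Hypothesis mh : measurable_fun [set: T] h.
Hypothesis h_ge0 : forall y, 0 <= h y.
Hypothesis N_ge0 : 0 <= N.
Hypothesis morrey : forall k x,
  (\int[mu]_(y in cell key k (key k x)) (h y * w y)%:E <=
    (N * fine (W (cell key k (key k x))) `^ kappa)%:E)%E.

Let mhw : measurable_fun [set: T] (fun y => h y * w y).
Proof. exact: measurable_funM. Qed.

Let hw_ge0 y : 0 <= h y * w y.
Proof. exact: mulr_ge0. Qed.

Let WE k x : exists2 p : R, 0 < p & W (cell key k (key k x)) = p%:E.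
Proof.
exists (fine (W (cell key k (key k x)))).
  by rewrite fine_gt0// (ca_gt0 Hw)/= (ca_fin Hw).
by rewrite fineK// ge0_fin_numE ?measure_ge0//; exact: (ca_fin Hw).
Qed.

Let WB_fin : exists2 q : R, 0 <= q & W B = q%:E.
Proof.
exists (fine (W B)); first by rewrite fine_ge0// measure_ge0.
rewrite fineK// ge0_fin_numE ?measure_ge0//.
apply: le_lt_trans _ (ca_fin Hw K0 x0).
by apply: le_measure; rewrite ?inE.
Qed.

Variables (l eta : R) (G : nat -> I -> set T).
Hypothesis l_gt0 : 0 < l.
Hypothesis eta01 : 0 <= eta <= 1.
Hypothesis mG : forall k i, measurable (G k i).
Hypothesis G_cell : forall k i, G k i `<=` cell key k i.
Hypothesis W_G : forall k x, (W (G k (key k x)) <=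
  eta%:E * W (cell key k (key k x)))%E.

Let S k i : Prop := (l%:E * mu (cell key k i) < \int[mu]_(y in cell key k i) (h y)%:E)%E.

Let W_stop k x : S k (key k x) ->
  (W (cell key k (key k x)) <=
   (K / l)%:E * \int[mu]_(y in cell key k (key k x)) (h y * w y)%:E)%E.
Proof.
move=> /ltW Sx; have := A1_transfer (mcell k _) (@subset_refl _ _) mh h_ge0.
move=> /(_ x) tr; have P0 := rf_gt0 F k x; have Pf := rf_fin F k x.
move: Sx tr P0 Pf.
set P := cell _ _ _.
have : (0 <= \int[mu]_(y in P) (h y * w y)%:E)%E.
  by apply: integral_ge0 => y _; rewrite lee_fin.
have [p p0 ->] := WE k x; rewrite -/P.
move: (mu P) => [m| |]// ; move: (\int[mu]_(y in P) (h y * w y)%:E)%E => [r| |]//.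
  move=> r0 h1 h2; rewrite lte_fin => m0 _.
  have : (p%:E * (l%:E * m%:E) <= K%:E * m%:E * r%:E)%E.
    by apply: le_trans _ h2; apply: lee_wpmul2l => //; rewrite lee_fin ltW.
  rewrite -!EFinM !lee_fin => h3; rewrite mulrAC ler_pdivlMr//.
  by rewrite -(ler_pM2r m0); move: h3; lra.
move=> *; rewrite gt0_muley ?leey// lte_fin divr_gt0//.
Qed.

(** If the stopping cells that meet [B] are inside the cell around [B], then the
    integral of [h * w] over their union is at most that over this cell, and so is
    controlled by the Morrey bound. Otherwise [B] lies inside a single stopping cell,
    of weight [p]: the Morrey bound gives [p `^ (1 - kappa) <= K * N / l], and the
    weight of the part of [B] under study, being at most that of [B] and at most
    [eta * p], is bounded by interpolation. This interpolation turns the factor [eta]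
    into [eta `^ (1 - kappa)]. *)
Lemma morrey_stopping :
  (W (B `&` stopped key S 0 G) <=
   (K * CB * eta `^ (1 - kappa) * (N / l) * fine (W B) `^ kappa)%:E)%E.
Proof.
have /andP[k0 k1] := kappa01; have /andP[eta0 eta1] := eta01.
have [q q0 WBq] := WB_fin; rewrite [in leRHS]WBq /=.
have mBS : measurable (B `&` stopped key S 0 G).
  by apply: measurableI => //; exact: measurable_stopped.
have K_ge0 := ltW K_gt0.
(* is some ancestor of the cell around [B] selected? *)
have [[k kK0 Sk]|nS] := pselect (exists2 k, (k < K0)%N & S k (key k x0)).
  have [k1' [st1 k1k]] := ex_stops (leq0n k) Sk.
  have sub : B `&` stopped key S 0 G `<=` G k1' (key k1' x0).
    move=> x [Bx [j [y [sty Gx]]]].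
    have xy : key j x = key j y := G_cell Gx.
    have x0x : key k1' x0 = key k1' x.
      by apply: (key_le refine (ltnW (leq_ltn_trans k1k kK0))); rewrite (B_cell Bx).
    have jk : j = k1'.
      apply: (@stops_uniq _ _ _ key S 0 j k1' x).
        exact: (stops_cell refine (esym xy) sty).
      exact: (stops_cell refine x0x st1).
    by rewrite x0x -jk xy.
  have [_ S1 _] := st1; have := W_stop S1; have := morrey k1' x0; have := W_G k1' x0.
  have [p p0 ->] := WE k1' x0; rewrite /=.
  have : (W (B `&` stopped key S 0 G) <= W (G k1' (key k1' x0)))%E.
    by apply: le_measure; rewrite ?inE.
  have : (W (B `&` stopped key S 0 G) <= W B)%E.
    by apply: le_measure; rewrite ?inE.
  have : (0 <= W (B `&` stopped key S 0 G))%E by exact: measure_ge0.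
  rewrite WBq.
  move: (W (B `&` _)) => [v| |]//; rewrite !lee_fin => v0 vq vG Gp Hm Hs.
  have vp : v <= eta * p.
    by have := le_trans vG Gp; rewrite -EFinM lee_fin.
  have pN : p <= K / l * (N * p `^ kappa).
    rewrite -lee_fin; apply: (le_trans Hs); rewrite (EFinM (K / l)) lee_wpmul2l//.
    by rewrite lee_fin divr_ge0// ltW.
  have pN' : p `^ (1 - kappa) <= K * (N / l).
    rewrite -(ler_pM2r (powR_gt0 kappa p0)) -powRD; last first.
      by rewrite (gt_eqF p0)// implybT.
    rewrite subrK (powRr1 (ltW p0)); apply: (le_trans pN).
    by rewrite le_eqVlt; apply/orP; left; apply/eqP; ring.
  apply: (le_trans (le_powR_interp kappa01 v0 vq vp)).
  rewrite (powRM _ eta0 (ltW p0)).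
  rewrite [leLHS](_ : _ = 1 * (q `^ kappa * eta `^ (1 - kappa) * p `^ (1 - kappa))); last by ring.
  rewrite [leRHS](_ : _ = CB * (q `^ kappa * eta `^ (1 - kappa) * (K * (N / l)))); last by ring.
  apply: ler_pM => //; first by rewrite !mulr_ge0// ?powR_ge0.
  by rewrite ler_wpM2l// mulr_ge0// powR_ge0.
pose S' k i := S k i /\ exists y, key k y = i /\ key K0 y = key K0 x0.
have sub : B `&` stopped key S 0 G `<=` stopped key S' K0 G.
  move=> x [Bx [j [y [sty Gx]]]].
  have xy : key j x = key j y := G_cell Gx.
  have [_ Sj nSj] : stops key S 0 j x by exact: (stops_cell refine (esym xy) sty).
  exists j, x; split; last by rewrite xy.
  have K0j : (K0 <= j)%N.
    rewrite leqNgt; apply/negP => jK0; apply: nS; exists j => //.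
    by rewrite -(key_le refine (ltnW jK0) (B_cell Bx)).
  split => //; first by split => //; exists x; rewrite (B_cell Bx).
  by move=> i /andP[K0i ij] [Si _]; apply: (nSj i).
pose V := stopped key S' K0 (cell key).
have V_sub : V `<=` cell key K0 (key K0 x0).
  move=> x; rewrite /V stopped_cellE// => -[k K0k [_ [y [yx yx0]]]].
  by rewrite /cell/= -yx0; apply: (key_le refine K0k).
have mV : measurable V by exact: measurable_stopped.
apply: (@le_trans _ _ (W (stopped key S' K0 G))).
  by apply: le_measure; rewrite ?inE//; exact: measurable_stopped.
apply: (@le_trans _ _ (eta%:E * W V)%E).
  by apply: (stopped_le mcell refine (nu1 := W) (nu2 := W)).
pose HW := density mu mhw hw_ge0.
have WV : (W V <= (K / l)%:E * HW V)%E.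
  apply: (stopped_le mcell refine (nu1 := W) (nu2 := HW)) => //.
    by rewrite divr_ge0// ltW.
  by move=> k x [_ [Sk _] _]; exact: W_stop.
have HV : (HW V <= (N * fine (W (cell key K0 (key K0 x0))) `^ kappa)%:E)%E.
  apply: le_trans _ (morrey K0 x0); apply: ge0_subset_integral => //.
    by apply/measurable_EFinP; apply: measurable_funTS.
  by move=> y _; rewrite lee_fin.
have kge0 : 0 <= K / l by rewrite divr_ge0// ltW.
apply: (le_trans (lee_wpmul2l _ WV)); first by rewrite lee_fin.
have kge0' : (0 <= (K / l)%:E)%E by rewrite lee_fin.
have eta0' : (0 <= eta%:E)%E by rewrite lee_fin.
apply: (le_trans (lee_wpmul2l eta0' (lee_wpmul2l kge0' HV))).
have [p p0 pE] := WE K0 x0; rewrite pE -!EFinM lee_fin /=.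
have pq : p `^ kappa <= CB * q `^ kappa.
  have CB0 : 0 <= CB by exact: le_trans ler01 CB_ge1.
  have : p <= CB * q by have := W_B; rewrite pE WBq -EFinM lee_fin.
  move=> /(ge0_ler_powR (ltW k0)); rewrite !nnegrE (ltW p0) mulr_ge0//.
  move=> /(_ isT isT) /le_trans; apply; rewrite powRM// ler_wpM2r ?powR_ge0//.
  by apply: ler1_powR => //; exact: ltW.
have eta_le : eta <= eta `^ (1 - kappa).
  by have := @le_powR_interp R eta 1 eta kappa kappa01; rewrite powR1 mul1r; apply.
rewrite [leLHS](_ : _ = (K * (N / l)) * (eta * p `^ kappa)); last by ring.
rewrite [leRHS](_ : _ = (K * (N / l)) * (eta `^ (1 - kappa) * (CB * q `^ kappa))); last by ring.
apply: ler_wpM2l; first by rewrite !mulr_ge0// invr_ge0 ltW.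
by apply: ler_pM; rewrite ?powR_ge0.
Qed.

End weights.

(** * The commutator bound in a filtration *)

(** Let [P] be a cell around [x] over which the average of [`|b x - b y| * h y]
    exceeds 1, and let [a] be its constant. Either the average of [`|b y - a| * h y]
    is large, and then so is that of [Phi \o h], by [oscillation_product]; or
    [`|b x - a|] is of the order of some [m], while the average of [h] exceeds a
    multiple of [1 / m]. In the latter case [P] lies inside a stopping cell for this
    level, and [b x] or [a] is far from the constant of the stopping cell: the point
    [x] is in one of the sets [far] of the John-Nirenberg inequality, whose
    weight decays geometrically in [m] and compensates the factor [m] lost in the
    level. *)
Theorem cell_commutator_bound d (T : measurableType d) (R : realType)
    (I : countType) (mu : {measure set T -> \bar R}) (D A K CB kappa : R) :
  0 < D -> 0 < A -> 1 <= K -> 1 <= CB -> 0 < kappa < 1 ->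
  exists2 C : R, 0 < C &
  forall (key : nat -> T -> I) (w b h : T -> R) (c : nat -> I -> R)
    (B : set T) (K0 : nat) (x0 : T) (N : R),
  regular_filtration mu key D -> cell_A1 mu key w K ->
  measurable_fun [set: T] b ->
  (forall k x, (\int[mu]_(y in cell key k (key k x))
     `|b y - c k (key k x)|%:E <= A%:E * mu (cell key k (key k x)))%E) ->
  measurable B -> B `<=` cell key K0 (key K0 x0) ->
  (\int[mu]_(y in cell key K0 (key K0 x0)) (w y)%:E <=
     CB%:E * \int[mu]_(y in B) (w y)%:E)%E ->
  measurable_fun [set: T] h -> (forall y, 0 <= h y) -> 0 <= N ->
  (forall k x, (\int[mu]_(y in cell key k (key k x)) (Phi (h y) * w y)%:E <=
    (N * fine (\int[mu]_(y in cell key k (key k x)) (w y)%:E) `^ kappa)%:E)%E) ->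
  exists E, [/\ measurable E,
    B `&` [set x | exists k,
      (mu (cell key k (key k x)) <
         \int[mu]_(y in cell key k (key k x)) (h y)%:E)%E \/
      (mu (cell key k (key k x)) <
         \int[mu]_(y in cell key k (key k x)) (`|b x - b y| * h y)%:E)%E]
      `<=` E &
    (\int[mu]_(y in E) (w y)%:E <=
       (C * N * fine (\int[mu]_(y in B) (w y)%:E) `^ kappa)%:E)%E].
Proof.
move=> D0 A0 K1 CB1 kappa01; have /andP[k0 k1] := kappa01.
pose step := jn_step A D; pose ratio := jn_ratio K.
have K0' : 0 < K by apply: lt_le_trans K1.
have CB0 : 0 < CB by apply: lt_le_trans CB1.
have step0 : 0 < step by rewrite /step /jn_step addr_gt0 ?mulr_gt0.
have ratio01 : 0 < ratio < 1.
  have i0 : 0 < (2 * K)^-1 by rewrite invr_gt0 mulr_gt0.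
  have : (2 * K)^-1 <= 2^-1 by rewrite lef_pV2 ?posrE ?mulr_gt0//; lra.
  by rewrite /ratio /jn_ratio => h; apply/andP; split; lra.
have /andP[ratio0 ratio1] := ratio01.
(* one power of [s] absorbs the factor [m.+1], the other one is summed *)
pose s := ratio `^ ((1 - kappa) / 2).
have s0 : 0 < s by rewrite powR_gt0.
have s1 : s < 1.
  have e0 : 0 < (1 - kappa) / 2 by lra.
  have := @gt0_ltr_powR R _ e0 ratio 1; rewrite /= powR1; apply => //.
    by rewrite nnegrE ltW.
  by rewrite nnegrE.
have sE m : (ratio ^+ m) `^ (1 - kappa) = s ^+ m * s ^+ m.
  rewrite /s -!powR_mulrn ?powR_ge0 ?(ltW ratio0)// -!powRrM -powRD; last first.
    by rewrite (gt_eqF ratio0) implybT.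
  by congr (_ `^ _); field.
have [C0 C00 young] := @young_Phi R step (1 / 16) step0 ltac:(by lra).
pose l0 : R := Num.min 1 (4 * C0)^-1.
have l00 : 0 < l0 by rewrite /l0 lt_min ltr01/= invr_gt0 mulr_gt0.
have l01 : l0 <= 1 by rewrite /l0 ge_min lexx.
have s1' : 0 < (1 - s)^-1 by rewrite invr_gt0 subr_gt0.
exists (K * CB * (l0^-1 + 4 * step * ((1 - s)^-1 * (1 - s)^-1))).
  apply: mulr_gt0; first exact: mulr_gt0.
  by apply: addr_gt0; [rewrite invr_gt0|rewrite !mulr_gt0].
move=> key w b h c B K0 x0 N F Hw mb osc mB Bcell WB mh h0 N0 morrey.
pose W := density mu (ca_meas Hw) (ca_ge0 Hw).
have mcell := rf_cell F; have refine := rf_refine F.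
have mPhih : measurable_fun [set: T] (fun y => Phi (h y)).
  by apply: measurableT_comp mh; exact: measurable_Phi.
have Phih0 y : 0 <= Phi (h y) by exact: Phi_ge0.
have morrey_h k x : (\int[mu]_(y in cell key k (key k x)) (h y * w y)%:E <=
    (N * fine (W (cell key k (key k x))) `^ kappa)%:E)%E.
  apply: le_trans _ (morrey k x); apply: ge0_le_integral => //.
  - by move=> y _; rewrite lee_fin mulr_ge0// (ca_ge0 Hw).
  - apply/measurable_EFinP; apply: measurable_funTS.
    by apply: measurable_funM => //; exact: ca_meas Hw.
  - apply/measurable_EFinP; apply: measurable_funTS.
    by apply: measurable_funM => //; exact: ca_meas Hw.
  - by move=> y _; rewrite lee_fin ler_wpM2r ?(ca_ge0 Hw)// le_Phi.
pose q := fine (W B) `^ kappa.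
have q0 : 0 <= q by exact: powR_ge0.
(* points of a cell where the average of [Phi \o h] is large *)
pose S0 k i : Prop := (l0%:E * mu (cell key k i) <
  \int[mu]_(y in cell key k i) (Phi (h y))%:E)%E.
pose E0 := B `&` stopped key S0 0 (cell key).
have mE0 : measurable E0 by apply: measurableI => //; exact: measurable_stopped.
have WE0 : (W E0 <= (K * CB * l0^-1 * N * q)%:E)%E.
  have := @morrey_stopping _ _ _ _ mu key D F w K Hw B K0 x0 CB kappa mB Bcell
    CB1 WB kappa01 (fun y => Phi (h y)) N mPhih Phih0 N0 morrey l0 1 (cell key)
    l00 _ mcell _ _.
  rewrite powR1 mulr1 => le0.
  rewrite (_ : K * CB * l0^-1 * N * q = K * CB * (N / l0) * q); last by ring.
  apply: le0; first by rewrite lexx ler01.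
  - by move=> k i.
  - by move=> k x; rewrite mul1e.
(* points far from the constant of a cell where the average of [h] is not small *)
pose l m := (4 * step * m.+1%:R)^-1.
have l_gt0 m : 0 < l m by rewrite invr_gt0 !mulr_gt0.
pose S m k i : Prop := ((l m)%:E * mu (cell key k i) <
  \int[mu]_(y in cell key k i) (h y)%:E)%E.
pose G m k i := far key b c (m%:R * step)%R k i.
have mG m k i : measurable (G m k i) by exact: (measurable_far F c mb).
pose E m := B `&` stopped key (S m) 0 (G m).
have mE m : measurable (E m) by apply: measurableI => //; exact: measurable_stopped.
have WE m : (W (E m) <=
    (K * CB * (4 * step * (1 - s)^-1) * N * q)%:E * (s ^+ m)%:E)%E.
  have := @morrey_stopping _ _ _ _ mu key D F w K Hw B K0 x0 CB kappa mB Bcell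
    CB1 WB kappa01 h N mh h0 N0 morrey_h (l m) (ratio ^+ m) (G m)
    (l_gt0 m) _ (mG m) _ _.
  rewrite sE => le0; apply: le_trans (le0 _ _ _) _.
  - by rewrite exprn_ge0 ?(ltW ratio0)// exprn_ile1 ?(ltW ratio0)// ltW.
  - by move=> k i x [].
  - move=> k x.
    exact: (@weighted_john_nirenberg _ _ _ _ _ _ _ F b c A mb A0 osc w
      (ca_meas Hw) (ca_ge0 Hw) (ca_fin Hw) K K1 (A1_sets Hw) m k x).
  rewrite -EFinM lee_fin /l invrK.
  have s01 : 0 < s < 1 by rewrite s0 s1.
  have := natSM_geometric_le m s01 => h1.
  rewrite [leLHS](_ : _ = (K * CB * N * q * (4 * step) * s ^+ m) *
    (m.+1%:R * s ^+ m)); last by rewrite -/q; ring.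
  rewrite [leRHS](_ : _ = (K * CB * N * q * (4 * step) * s ^+ m) *
    (1 - s)^-1); last by ring.
  apply: ler_wpM2l => //.
  by rewrite !mulr_ge0 ?exprn_ge0 ?(ltW step0) ?(ltW K0') ?(ltW CB0) ?(ltW s0).
exists (E0 `|` \bigcup_m E m); split.
- by apply: measurableU => //; exact: bigcupT_measurable.
- move=> x [Bx [k hx]]; set P := cell key k (key k x) in hx.
  have P0 : (0 < mu P)%E by exact: rf_gt0 F _ _.
  have Pfin : mu P \is a fin_num by rewrite ge0_fin_numE//; exact: rf_fin F _ _.
  have mP : measurable P by exact: mcell.
  have toE0 : (l0%:E * mu P < \int[mu]_(y in P) (Phi (h y))%:E)%E -> E0 x.
    move=> Sx; split => //; rewrite stopped_cellE//; by exists k.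
  have h_Phi : (\int[mu]_(y in P) (h y)%:E <= \int[mu]_(y in P) (Phi (h y))%:E)%E.
    apply: ge0_le_integral => //.
    + by move=> y _; rewrite lee_fin.
    + by apply/measurable_EFinP; apply: measurable_funTS.
    + by apply/measurable_EFinP; apply: measurable_funTS.
    + by move=> y _; rewrite lee_fin le_Phi.
  case: hx => hx.
    left; apply: toE0; apply: le_lt_trans _ (lt_le_trans hx h_Phi).
    by rewrite -[leRHS]mul1e; apply: lee_wpmul2r => //; rewrite lee_fin.
  pose a := c k (key k x).
  have mdist (z : R) : measurable_fun [set: T] (fun y => `|b y - z|).
    by apply: measurableT_comp => //; exact: measurable_funB.
  have mhP : measurable_fun P (fun y => (h y)%:E).
    by apply/measurable_EFinP; apply: measurable_funTS.
  have mbh : measurable_fun P (fun y => (`|b y - a| * h y)%:E).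
    by apply/measurable_EFinP; apply: measurable_funTS; exact: measurable_funM.
  (* triangle inequality through the constant [a] of the cell *)
  have split_osc : (\int[mu]_(y in P) (`|b x - b y| * h y)%:E <=
      `|b x - a|%:E * \int[mu]_(y in P) (h y)%:E +
      \int[mu]_(y in P) (`|b y - a| * h y)%:E)%E.
    apply: (@le_trans _ _ (\int[mu]_(y in P)
        (`|b x - a|%:E * (h y)%:E + (`|b y - a| * h y)%:E))%E).
      apply: ge0_le_integral => //.
      + by move=> y _; rewrite lee_fin mulr_ge0.
      + apply/measurable_EFinP; apply: measurable_funTS; apply: measurable_funM => //.
        by apply: measurableT_comp => //; exact: measurable_funB.
      + by apply: emeasurable_funD => //; exact: measurable_funeM.
      + move=> y _; rewrite -EFinM -EFinD lee_fin -mulrDl ler_wpM2r//.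
        by rewrite (distrC (b y)); exact: ler_distD.
    rewrite ge0_integralD//; last 3 first.
    + by move=> y _; rewrite mule_ge0// lee_fin.
    + exact: measurable_funeM.
    + by move=> y _; rewrite lee_fin mulr_ge0.
    by apply: leeD => //; rewrite ge0_integralZl// => y _; rewrite lee_fin.
  have [big|small] := ltP (2^-1%:E * mu P)%E
      (`|b x - a|%:E * \int[mu]_(y in P) (h y)%:E)%E.
    right; pose u := `|b x - a|.
    have u0 : 0 <= u by exact: normr_ge0.
    pose m := Num.truncn (u / (2 * step)).
    have ss0 : 0 < 2 * step by rewrite mulr_gt0.
    have um : u < 2 * step * m.+1%:R by rewrite mulrC -ltr_pdivrMr// truncnS_gt.
    have mu_ : m%:R * (2 * step) <= u.
      by rewrite -ler_pdivlMr// truncn_le divr_ge0// ltW.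
    have Sm : S m k (key k x).
      rewrite /S -/P; move: big; rewrite -/u.
      have : (0 <= \int[mu]_(y in P) (h y)%:E)%E.
        by apply: integral_ge0 => y _; rewrite lee_fin.
      move: Pfin P0; move: (mu P) => [p| |]// _; rewrite lte_fin => p0.
      move: (\int[mu]_(y in P) (h y)%:E)%E => [r| |]//; last by rewrite -EFinM ltry.
      rewrite -!EFinM !lte_fin lee_fin => r0 lt_pu.
      rewrite /l mulrC ltr_pdivrMr ?mulr_gt0//.
      have : u * r <= 2 * step * m.+1%:R * r by rewrite ler_wpM2r// ltW.
      by move: lt_pu; nra.
    exists m => //; split => //.
    have [k' [[k0k' Sk' nS'] k'k]] := ex_stops (leq0n k) Sm.
    exists k', x; split => //; split => //.
    have [|lt1] := leP (m%:R * step) `|b x - c k' (key k' x)|; first by left.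
    right; exists k => //.
    have := ler_distD (c k' (key k' x)) (b x) a; rewrite -/u (distrC (c k' _) a) -/a.
    by move: mu_ lt1; lra.
  left; apply: toE0; rewrite ltNge; apply/negP => Phi_le.
  have t0 : 0 <= 1 / 16 :> R by lra.
  have osc_P := oscillation_product F mb A0 osc k x (ltW C00) t0 young mh h0.
  have l0C : C0 * l0 <= 4^-1.
    have : l0 <= (4 * C0)^-1 by rewrite /l0 ge_min lexx orbT.
    rewrite -(ler_pM2l C00) => /le_trans; apply.
    by rewrite invfM mulrCA mulfV ?gt_eqF// mulr1.
  have C0' : (0 <= C0%:E)%E by rewrite lee_fin ltW.
  have {}osc_P := le_trans osc_P (leeD (lee_wpmul2l C0' Phi_le) (lexx _)).
  have := lt_le_trans hx (le_trans split_osc (leeD small osc_P)).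
  rewrite -/P; move: Pfin P0; move: (mu P) => [p| |]// _; rewrite lte_fin => p0.
  rewrite -!EFinM -!EFinD lte_fin.
  have : C0 * (l0 * p) <= 4^-1 * p by rewrite mulrA ler_wpM2r// ltW.
  by lra.
apply: (@le_trans _ _ (W E0 + W (\bigcup_m E m))%E).
  by apply: measureU2 => //; exact: bigcupT_measurable.
have WEs : (W (\bigcup_m E m) <= (K * CB * (4 * step * ((1 - s)^-1 * (1 - s)^-1)) * N * q)%:E)%E.
  apply: (@le_trans _ _ (\sum_(m <oo) W (E m))%E).
    by apply: measure_sigma_subadditive => //; exact: bigcupT_measurable.
  apply: (@le_trans _ _ (\sum_(m <oo)
      ((K * CB * (4 * step * (1 - s)^-1) * N * q)%:E * (s ^+ m)%:E))%E).
    by apply: lee_nneseries => // m _; exact: measure_ge0.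
  rewrite nneseriesZl; last by move=> m _; rewrite lee_fin exprn_ge0// ltW.
  have s01 : 0 <= s < 1 by rewrite (ltW s0) s1.
  have c0 : (0 <= (K * CB * (4 * step * (1 - s)^-1) * N * q)%:E)%E.
    by rewrite lee_fin !mulr_ge0 ?(ltW step0) ?(ltW K0') ?(ltW CB0) ?(ltW s1').
  apply: (le_trans (lee_wpmul2l c0 (nneseries_geometric_le s01))).
  by rewrite -EFinM lee_fin le_eqVlt; apply/orP; left; apply/eqP; ring.
apply: (le_trans (leeD WE0 WEs)).
by rewrite -EFinD lee_fin le_eqVlt; apply/orP; left; apply/eqP; rewrite -/q; ring.
Qed.

(** * Cubes and balls in R^n *)

Lemma measurable_sqrt (R : realType) : measurable_fun [set: R] (@Num.sqrt R).
Proof. by apply: continuous_measurable_fun; exact: sqrt_continuous. Qed.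

Section lebesgue_Rn_basics.
Context {R : realType} {n : nat}.
Local Notation T := (Rn R n).
Local Notation mu := (@lebesgue_Rn R n).

Lemma borel_measurable_Rn (A : set 'rV[R]_n) :
  measurable A -> measurable (A : set T).
Proof.
by move=> mA; apply: sub_caratheodory; exact: sub_sigma_algebra.
Qed.

Lemma lebesgue_Rn_borel (A : set 'rV[R]_n) :
  measurable A -> mu A = lebesgue_borel n A.
Proof. exact: measurable_mu_extE. Qed.

Lemma measurable_preimage_coord i (A : set R) : measurable A ->
  measurable [set x : 'rV[R]_n | A (x ord0 i)].
Proof.
move=> mA; apply: sub_sigma_algebra; rewrite -bigcup_seq/=.
by exists i => /=; [rewrite mem_index_enum|exists A => //; rewrite setTI].
Qed.

Lemma measurable_coord i : measurable_fun [set: T] (fun x : T => (x : 'rV[R]_n) ord0 i).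
Proof.
move=> _ A mA; rewrite setTI.
exact: (borel_measurable_Rn (measurable_preimage_coord i mA)).
Qed.

Definition cube (x : 'rV[R]_n) r : set 'rV[R]_n :=
  [set y | forall i, `|y ord0 i - x ord0 i| < r].

Lemma cubeE x r : cube x r =
  [set y | forall i, `](x ord0 i - r), (x ord0 i + r)[%classic (y ord0 i)].
Proof.
apply/seteqP; split => y h i; move: (h i); rewrite /= in_itv/= ltr_distl; exact: id.
Qed.

Lemma borel_cube x r : measurable (cube x r).
Proof.
rewrite cubeE; apply: (measurable_rect (A := fun i => `](x ord0 i - r), (x ord0 i + r)[%classic)).
by move=> i; exact: measurable_itv.
Qed.

Lemma measurable_cube x r : measurable (cube x r : set T).
Proof. exact: (borel_measurable_Rn (borel_cube x r)). Qed.

(** The types of the ends of the intervals are left free, for open cubes and for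
    the half-open cells of a grid. *)
Lemma lebesgue_box (a b : 'I_n -> R) (l : R) c c' : 0 < l -> (forall i, b i - a i = l) ->
  lebesgue_borel n [set y : 'rV[R]_n | forall i,
     [set` Interval (BSide c (a i)) (BSide c' (b i))] (y ord0 i)] = (l ^+ n)%:E.
Proof.
move=> l0 ab.
rewrite (lebesgue_borel_rect (A := fun i => [set` Interval (BSide c (a i)) (BSide c' (b i))])) => [|i]; last exact: measurable_itv.
rewrite (eq_bigr (fun=> l%:E)) => [|i _].
  by rewrite prodEFin big_const_ord iter_mulr_1.
by rewrite lebesgue_measure_itv/= lte_fin -subr_gt0 ab l0 -EFinB ab.
Qed.

Lemma lebesgue_cube x r : 0 < r -> mu (cube x r) = ((2 * r) ^+ n)%:E.
Proof.
move=> r0; rewrite lebesgue_Rn_borel; last exact: (borel_cube x r).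
by rewrite cubeE (@lebesgue_box _ _ (2 * r)) ?mulr_gt0// => i; ring.
Qed.

Lemma cubeS x r s : r <= s -> cube x r `<=` cube x s.
Proof. by move=> rs y h i; apply: lt_le_trans rs. Qed.

Lemma enorm_ge0 (x : 'rV[R]_n) : 0 <= enorm x.
Proof. exact: sqrtr_ge0. Qed.

Lemma coord_le_enorm (x : 'rV[R]_n) i : `|x ord0 i| <= enorm x.
Proof.
rewrite -sqrtr_sqr ler_sqrt ?sumr_ge0// => [|j _]; last exact: sqr_ge0.
by rewrite (bigD1 i)//= lerDl sumr_ge0// => j _; exact: sqr_ge0.
Qed.

Lemma enorm_lt (x : 'rV[R]_n) r : (0 < n)%N -> (forall i, `|x ord0 i| < r) ->
  enorm x < n%:R * r.
Proof.
move=> n0 xr; have r0 : 0 < r by apply: le_lt_trans (xr (Ordinal n0)).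
have nr0 : 0 < n%:R * r by rewrite mulr_gt0// ltr0n.
rewrite -(ger0_norm (ltW nr0)) -sqrtr_sqr ltr_sqrt ?exprn_gt0//.
apply: (@lt_le_trans _ _ (\sum_(i < n) r ^+ 2)).
  apply: ltr_sum => [|i _].
    by apply/hasP; exists (Ordinal n0); rewrite ?mem_index_enum.
  rewrite -[X in X < _]real_normK ?num_real// ltr_pXn2r ?nnegrE ?(ltW r0)//; exact: xr.
rewrite sumr_const card_ord exprMn -[leLHS]mulr_natl ler_wpM2r ?sqr_ge0//.
by rewrite expr2 ler_peMr ?ler1n.
Qed.

Lemma eball_cube (x : 'rV[R]_n) r : eball x r `<=` cube x r.
Proof.
by move=> y xy i; have := coord_le_enorm (y - x) i; rewrite !mxE => /le_lt_trans; apply.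
Qed.

Lemma cube_eball (x : 'rV[R]_n) r : (0 < n)%N -> cube x r `<=` eball x (n%:R * r).
Proof. by move=> n0 y xy; apply: enorm_lt => // i; rewrite !mxE; exact: xy. Qed.

Lemma measurable_enormB (x : 'rV[R]_n) :
  measurable_fun [set: T] (fun y : T => enorm (x - (y : 'rV[R]_n))).
Proof.
rewrite /enorm; apply: (measurableT_comp (@measurable_sqrt R)).
apply: measurable_sum => i; apply: measurable_funX.
under eq_fun do rewrite !mxE.
by apply: measurable_funB => //; exact: measurable_coord.
Qed.

Lemma measurable_eball (x : 'rV[R]_n) r : measurable (eball x r : set T).
Proof.
rewrite (_ : eball x r = (fun y : T => enorm (x - (y : 'rV[R]_n))) @^-1` `]-oo, r[).
  by rewrite -[X in measurable X]setTI; exact: measurable_enormB.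
apply/seteqP; split => y; rewrite /eball /= in_itv/=;
  by rewrite (_ : enorm (x - y) = enorm (y - x))// /enorm;
     congr (Num.sqrt _); apply: eq_bigr => i _; rewrite !mxE -sqrrN opprB.
Qed.

End lebesgue_Rn_basics.

(** * Outer regularity of Lebesgue measure *)

Lemma nonincreasing_mu_small d (T : measurableType d) (R : realType)
    (mu : {measure set T -> \bar R}) (F : (set T)^nat) (e : R) :
  (mu (F 0%N) < +oo)%E -> (forall i, measurable (F i)) ->
  \bigcap_i F i = set0 -> (forall m p, (m <= p)%N -> F p `<=` F m) -> 0 < e ->
  exists N, (mu (F N) <= e%:E)%E.
Proof.
move=> F0 mF F_eq0 ndF e0.
have : mu (F m) @[m --> \oo] --> (0 : \bar R)%E.
  rewrite -(measure0 mu) -F_eq0; apply: nonincreasing_cvg_mu => //.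
    by rewrite F_eq0.
  by move=> m p mp; apply/subsetPset; exact: ndF.
move=> /fine_cvgP[fin /cvgrPdist_le /(_ _ e0) small].
near \oo => N; exists N.
have finN : mu (F N) \is a fin_num by near: N.
have : `|0 - fine (mu (F N))| <= e by near: N; exact: small.
rewrite sub0r normrN ger0_norm ?fine_ge0// => le_e.
by rewrite -(fineK finN) lee_fin.
Unshelve. all: by end_near. Qed.

Section regularity.
Context {R : realType} {n : nat}.
Local Notation T := (Rn R n).
Local Notation mu := (@lebesgue_Rn R n).
Local Notation mb := (@lebesgue_borel R n).

Definition cube_open (U : set 'rV[R]_n) :=
  forall x, U x -> exists2 r, 0 < r & cube x r `<=` U.

Lemma cube_open_bigcup (U : (set 'rV[R]_n)^nat) :
  (forall j, cube_open (U j)) -> cube_open (\bigcup_j U j).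
Proof.
move=> oU x [j _ Ujx]; have [r r0 xr] := oU j x Ujx; exists r => // y /xr Uy.
by exists j.
Qed.

Lemma cube_openI (U V : set 'rV[R]_n) :
  cube_open U -> cube_open V -> cube_open (U `&` V).
Proof.
move=> oU oV x [Ux Vx]; have [r r0 xr] := oU _ Ux; have [s s0 xs] := oV _ Vx.
exists (Num.min r s); first by rewrite lt_min r0.
move=> y xy; split; [apply: xr|apply: xs]; apply: cubeS xy; rewrite ge_min lexx//.
by rewrite orbT.
Qed.

Lemma cube_open_cube x r : cube_open (cube x r).
Proof.
move=> y xy; pose s i := r - `|y ord0 i - x ord0 i|.
exists (\big[Num.min/1]_i s i).
  by apply: lt_bigmin => // i _; rewrite /s subr_gt0.
move=> z yz i; have := ler_distD (y ord0 i) (z ord0 i) (x ord0 i).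
by have := lt_le_trans (yz i) (bigmin_le 1 i s); rewrite /s; lra.
Qed.

Section in_cube.
Variables (x0 : 'rV[R]_n) (r0 : R).
Hypothesis r0_gt0 : 0 < r0.
Let Q := cube x0 r0.

(** Enclosing both [A] and its complement makes the property stable under
    complements. The restriction to a cube of finite measure allows the passage to
    the limit along decreasing sequences. *)
Definition regular (A : set 'rV[R]_n) := forall e : R, 0 < e -> exists U V,
  [/\ cube_open U /\ cube_open V, measurable U /\ measurable V,
      A `<=` U, ~` A `<=` V & (mb (U `&` V `&` Q) <= e%:E)%E].

Let mQ : measurable Q. Proof. exact: borel_cube. Qed.

Let Q_fin : (mb Q < +oo)%E.
Proof. by rewrite -lebesgue_Rn_borel// lebesgue_cube// ltry. Qed.

Lemma regular0 : regular set0.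
Proof.
move=> e e0; exists set0, setT; split => //.
- by split=> // x _; exists 1.
- by rewrite !set0I measure0 lee_fin ltW.
Qed.

Lemma regularC A : regular A -> regular (~` A).
Proof.
move=> rA e e0; have [U [V [[oU oV] [mU mV] AU AV UV]]] := rA e e0.
by exists V, U; split => //; rewrite ?setCK// (setIC V).
Qed.

(** The union of the outer sets is approximated by finitely many of them, so that
    the complement is enclosed in a finite intersection of open sets. *)
Lemma regular_bigcup (A : (set 'rV[R]_n)^nat) :
  (forall j, regular (A j)) -> regular (\bigcup_j A j).
Proof.
move=> rA e e0.
have e20 : 0 < e / 2 by rewrite divr_gt0.
have /choice[UV hUV] : forall j, exists p : set 'rV[R]_n * set 'rV[R]_n,
    [/\ cube_open p.1 /\ cube_open p.2, measurable p.1 /\ measurable p.2,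
      A j `<=` p.1, ~` A j `<=` p.2 &
      (mb (p.1 `&` p.2 `&` Q) <= (e / 2 / (2 ^ j.+1)%:R)%:E)%E].
  move=> j; have [|U [V h]] := rA j (e / 2 / (2 ^ j.+1)%:R).
    by rewrite divr_gt0// ltr0n expn_gt0.
  by exists (U, V).
pose U j := (UV j).1; pose V j := (UV j).2.
have mU j : measurable (U j) by have [_ []] := hUV j.
have mV j : measurable (V j) by have [_ []] := hUV j.
have oU j : cube_open (U j) by have [[]] := hUV j.
have oV j : cube_open (V j) by have [[]] := hUV j.
have AU j : A j `<=` U j by have [] := hUV j.
have AV j : ~` A j `<=` V j by have [] := hUV j.
have UVe j : (mb (U j `&` V j `&` Q) <= (e / 2 / (2 ^ j.+1)%:R)%:E)%E.
  by have [] := hUV j.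
pose UU := \bigcup_j U j.
have mUU : measurable UU by exact: bigcupT_measurable.
pose F N := Q `&` (UU `\` \big[setU/set0]_(j < N) U j).
have mF N : measurable (F N).
  by apply: measurableI => //; apply: measurableD => //; exact: bigsetU_measurable.
have [|||||N FN] := @nonincreasing_mu_small _ _ _ mb F (e / 2).
- apply: le_lt_trans _ Q_fin; apply: le_measure; rewrite ?inE//; exact: subIsetl.
- exact: mF.
- rewrite -subset0 => x Fx; have [_ [[j _ Ujx] _]] := Fx 0%N I.
  have [_ [_]] := Fx j.+1 I; apply.
  by rewrite big_ord_recr/=; right.
- move=> m p mp x [Qx [UUx nx]]; split => //; split => // mx; apply: nx.
  by apply: subset_bigsetU mx.
- exact: e20.
pose VN := \bigcap_(j in `I_N) V j.
have mVN : measurable VN by apply: bigcap_measurableType => *; exact: mV.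
have oVN : cube_open VN.
  rewrite /VN; elim: N {FN VN mVN} => [|N ih].
    by rewrite II0 bigcap_set0 => x _; exists 1.
  by rewrite IIS bigcap_setU bigcap_set1; apply: cube_openI.
exists UU, VN; split => //.
- by split => //; exact: cube_open_bigcup.
- by move=> x [j _ Ax]; exists j => //; exact: AU.
- by move=> x nAx j _; apply: AV => Ajx; apply: nAx; exists j.
pose W := \bigcup_j (U j `&` V j `&` Q).
have mW : measurable W.
  by apply: bigcupT_measurable => j; apply: measurableI => //; exact: measurableI.
apply: (@le_trans _ _ (mb (F N `|` W))).
  apply: le_measure; rewrite ?inE.
  - by apply: measurableI => //; exact: measurableI.
  - exact: measurableU.
  move=> x [[UUx Vx] Qx].
  have [[j jN Ujx]|nU] := pselect (exists2 j, (j < N)%N & U j x).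
    by right; exists j => //; split => //; split => //; exact: Vx.
  left; split => //; split => //; rewrite -bigcup_mkord => -[j /= jN Ujx].
  by apply: nU; exists j.
apply: (le_trans (measureU2 mb (mF N) mW)).
have We : (mb W <= (e / 2)%:E)%E.
  apply: (@le_trans _ _ (\sum_(j <oo) mb (U j `&` V j `&` Q))%E).
    apply: measure_sigma_subadditive => // j.
    by apply: measurableI => //; exact: measurableI.
  apply: le_trans _ (epsilon_trick0 xpredT (ltW e20)).
  by apply: lee_nneseries => // j _; exact: UVe.
by apply: (le_trans (leeD FN We)); rewrite -EFinD lee_fin; lra.
Qed.

Lemma regular_sigma_algebra : sigma_algebra setT regular.
Proof.
split; [exact: regular0| |exact: regular_bigcup].
by move=> A /regularC; rewrite setTD.
Qed.

Lemma regular_halfspace i (a : R) : regular [set x | x ord0 i < a].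
Proof.
move=> e e0; pose U := [set x : 'rV[R]_n | x ord0 i < a].
pose V m := [set x : 'rV[R]_n | a - m.+1%:R^-1 < x ord0 i].
have mU : measurable U.
  have := measurable_preimage_coord i (measurable_itv `]-oo, a[).
  by congr measurable; apply/seteqP; split => x; rewrite /= in_itv.
have mV m : measurable (V m).
  have := measurable_preimage_coord i (measurable_itv `](a - m.+1%:R^-1), +oo[).
  by congr measurable; apply/seteqP; split => x; rewrite /= in_itv/= andbT.
have oU : cube_open U.
  move=> x /= xa; exists (a - x ord0 i); first by rewrite subr_gt0.
  by move=> y /(_ i); rewrite /U/= => /ltr_normlW; lra.
have oV m : cube_open (V m).
  move=> x /= xa; exists (x ord0 i - (a - m.+1%:R^-1)); first by rewrite subr_gt0.
  by move=> y /(_ i); rewrite /V/= distrC => /ltr_normlW; rewrite ltrD2l ltrN2.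
have [|||||N FN] := @nonincreasing_mu_small _ _ _ mb (fun m => U `&` V m `&` Q) e.
- apply: le_lt_trans _ Q_fin; apply: le_measure; rewrite ?inE//.
  by apply: measurableI => //; exact: measurableI.
- by move=> m; apply: measurableI => //; exact: measurableI.
- rewrite -subset0 => x Fx.
  have xa : x ord0 i < a by have [[]] := Fx 0%N I.
  have ax0 : 0 < a - x ord0 i by rewrite subr_gt0.
  have [[_ /= Vx] _] := Fx (Num.truncn (a - x ord0 i)^-1) I.
  have := truncnS_gt (a - x ord0 i)^-1.
  rewrite -ltf_pV2 ?posrE ?invr_gt0// invrK; move: Vx.
  by rewrite /V/=; move: (_.+1%:R^-1) => u; lra.
- move=> m p mp x [[Ux Vx] Qx]; split => //; split => //.
  rewrite /V/=; apply: le_lt_trans Vx; rewrite lerD2l lerN2.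
  by rewrite lef_pV2 ?posrE// ler_nat.
- exact: e0.
exists U, (V N); split => //.
move=> x /= /negP; rewrite -leNgt => ax; rewrite /V /=.
by apply: lt_le_trans ax; rewrite ltrBlDr ltrDl invr_gt0.
Qed.

Lemma regular_measurable A : measurable A -> regular A.
Proof.
apply: smallest_sub; first exact: regular_sigma_algebra.
rewrite -bigcup_seq/=; apply: bigcup_sub => i _ C [B mB <-] /=.
rewrite setTI; move: B mB.
have genR : forall B : set R, measurable B -> (@RGenInftyO.G R).-sigma.-measurable B.
  by move=> B mB; rewrite -RGenInftyO.measurableE.
suff sub : (@RGenInftyO.G R).-sigma.-measurable `<=`
    [set B | regular ((fun x : 'rV[R]_n => x ord0 i) @^-1` B)].
  by move=> B /genR /sub.
apply: smallest_sub.
  split => /=.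
  - by rewrite preimage_set0; exact: regular0.
  - by move=> B /regularC; rewrite setTD preimage_setC.
  - by move=> B rB; rewrite preimage_bigcup; exact: regular_bigcup.
move=> _ [a ->] /=.
have := regular_halfspace i a; congr regular.
Qed.

(** A Lebesgue measurable set is covered by a sequence of Borel sets of almost the
    same total measure, by the definition of the outer measure; each of these sets
    is regular. *)
Lemma outer_regular (E : set T) (e : R) : measurable E -> E `<=` Q -> 0 < e ->
  exists U : set 'rV[R]_n, [/\ cube_open U, measurable U, E `<=` U &
    (mu U <= mu E + e%:E)%E].
Proof.
move=> mE EQ e0.
have e20 : 0 < e / 2 by rewrite divr_gt0.
have muE : mu E \is a fin_num.
  rewrite ge0_fin_numE//; apply: le_lt_trans _ Q_fin.
  rewrite -lebesgue_Rn_borel//; apply: le_measure => //; rewrite inE//.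
  exact: (borel_measurable_Rn mQ).
have [_ [A [mA EA] <-] lt_e] := @lb_ereal_inf_adherent _ _ _ e20 muE.
have /choice[U hU] : forall j, exists U : set 'rV[R]_n,
   [/\ cube_open U, measurable U, A j `&` Q `<=` U &
   (mb U <= mb (A j `&` Q) + (e / 2 / (2 ^ j.+1)%:R)%:E)%E].
  move=> j; have [|U [V [[oU _] [mU mV] AU AV UVe]]] :=
    regular_measurable (mA j) (e := e / 2 / (2 ^ j.+1)%:R).
    by rewrite divr_gt0// ltr0n expn_gt0.
  exists (U `&` Q); split.
  - by apply: cube_openI => //; exact: cube_open_cube.
  - exact: measurableI.
  - by move=> x [Ax Qx]; split => //; exact: AU.
  apply: (@le_trans _ _ (mb ((A j `&` Q) `|` (U `&` V `&` Q)))).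
    apply: le_measure; rewrite ?inE.
    + exact: measurableI.
    + by apply: measurableU; [exact: measurableI|apply: measurableI => //; exact: measurableI].
    move=> x [Ux Qx]; have [Ax|nAx] := pselect (A j x); first by left.
    by right; split => //; split => //; exact: AV.
  have mAQ : measurable (A j `&` Q) by exact: measurableI.
  have mUVQ : measurable (U `&` V `&` Q) by apply: measurableI => //; exact: measurableI.
  by apply: (le_trans (measureU2 mb mAQ mUVQ)); apply: leeD.
have mU j : measurable (U j) by have [] := hU j.
exists (\bigcup_j U j); split.
- by apply: cube_open_bigcup => j; have [] := hU j.
- exact: bigcupT_measurable.
- move=> x Ex; have [j _ Ax] := EA _ Ex; exists j => //.
  by have [_ _ + _] := hU j; apply; split => //; exact: EQ.
rewrite lebesgue_Rn_borel; last exact: bigcupT_measurable.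
apply: (@le_trans _ _ (\sum_(j <oo) mb (U j))%E).
  by apply: measure_sigma_subadditive => //; exact: bigcupT_measurable.
apply: (@le_trans _ _ (\sum_(j <oo) (mb (A j) + (e / 2 / (2 ^ j.+1)%:R)%:E))%E).
  apply: lee_nneseries => // j _.
  have [_ _ _] := hU j => /le_trans; apply; apply: leeD => //.
  by apply: le_measure; rewrite ?inE//; exact: measurableI.
apply: (le_trans (epsilon_trick xpredT (fun j => measure_ge0 mb (A j)) (ltW e20))).
apply: (le_trans (leeD (ltW lt_e) (lexx _))).
rewrite -[X in (X + _ + _)%E]/(mu E) -addeA -EFinD.
by rewrite (_ : e / 2 + e / 2 = e)//; lra.
Qed.

End in_cube.
End regularity.

(** * Dyadic grids *)

Lemma floor_eqP (R : realType) (z : R) (m : int) :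
  Num.floor z = m <-> m%:~R <= z < (m + 1)%:~R.
Proof. by split => [<-|/floor_def//]; exact: floor_itv. Qed.

Lemma floor_double (R : realType) (z z' : R) :
  Num.floor (2 * z) = Num.floor (2 * z') -> Num.floor z = Num.floor z'.
Proof.
move=> e; apply/esym/floor_eqP.
have /andP[l1 l2] := floor_itv z.
have e1 : (2 * Num.floor z)%:~R <= 2 * z' :> R.
  rewrite -floor_ge_int -e floor_ge_int intrM ler_pM2l//.
have e2 : 2 * z' < (2 * (Num.floor z + 1))%:~R.
  rewrite -floor_lt_int -e floor_lt_int intrM ltr_pM2l//.
by move: e1 e2; rewrite !intrM ler_pM2l// ltr_pM2l// => -> ->.
Qed.

Section grid.
Context {R : realType} {n : nat}.
Local Notation T := (Rn R n).
Local Notation mu := (@lebesgue_Rn R n).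
Implicit Types (o : 'I_n -> R) (s : R).

Definition grid o s k (y : 'rV[R]_n) : {ffun 'I_n -> int} :=
  [ffun i => Num.floor ((y ord0 i - o i) / (s / 2 ^+ k))].

Definition mesh s k : R := s / 2 ^+ k.

Lemma mesh_gt0 s k : 0 < s -> 0 < mesh s k.
Proof. by move=> s0; rewrite divr_gt0// exprn_gt0. Qed.

Lemma meshS s k : mesh s k = 2 * mesh s k.+1.
Proof. by rewrite /mesh exprS; field; rewrite expf_neq0. Qed.

Variables (o : 'I_n -> R) (s : R).
Hypothesis s_gt0 : 0 < s.
Local Notation key := (@grid o s : nat -> T -> {ffun 'I_n -> int}).

Lemma grid_cellE k v : cell key k v = [set y : 'rV[R]_n | forall i,
  `[(o i + (v i)%:~R * mesh s k), (o i + (v i + 1)%:~R * mesh s k)[%classic (y ord0 i)].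
Proof.
have m0 := mesh_gt0 k s_gt0.
apply/seteqP; split => y.
  move=> + i; rewrite /cell/= => /ffunP /(_ i); rewrite ffunE => /floor_eqP.
  by rewrite in_itv/= -/(mesh s k) ler_pdivlMr// ltr_pdivrMr// lerBrDl ltrBlDl.
move=> h; apply/ffunP => i; rewrite ffunE; apply/floor_eqP.
have := h i; rewrite /= in_itv/= -/(mesh s k).
by rewrite ler_pdivlMr// ltr_pdivrMr// lerBrDl ltrBlDl.
Qed.

Lemma borel_grid_cell k v : measurable (cell key k v : set 'rV[R]_n).
Proof.
rewrite grid_cellE; apply: (measurable_rect (A := fun i =>
  `[(o i + (v i)%:~R * mesh s k), (o i + (v i + 1)%:~R * mesh s k)[%classic)).
by move=> i; exact: measurable_itv.
Qed.

Lemma lebesgue_grid_cell k v : mu (cell key k v) = (mesh s k ^+ n)%:E.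
Proof.
rewrite lebesgue_Rn_borel; last exact: borel_grid_cell.
rewrite grid_cellE (@lebesgue_box _ _ _ _ (mesh s k))//; first exact: mesh_gt0.
by move=> i; rewrite intrD; ring.
Qed.

Lemma grid_cell_cube k x : cell key k (key k x) `<=` cube x (mesh s k).
Proof.
move=> y yx i.
have hx : cell key k (key k x) x by [].
move: yx hx; rewrite grid_cellE => /(_ i) + /(_ i).
rewrite /= !in_itv/= intrD mulrDl mul1r => /andP[h1 h2] /andP[h3 h4].
by rewrite ltr_norml; apply/andP; split; lra.
Qed.

Lemma mesh_small r k0 : 0 < r -> exists2 k, (k0 <= k)%N & mesh s k <= r.
Proof.
move=> r0; pose k := Num.truncn (s / r).
exists (maxn k0 k); first exact: leq_maxl.
rewrite /mesh ler_pdivrMr ?exprn_gt0// mulrC -ler_pdivrMr//.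
apply: (le_trans (ltW (truncnS_gt _))); rewrite -natrX ler_nat.
apply: (@leq_trans (2 ^ k)); first exact: ltn_expl.
by rewrite leq_exp2l// leq_maxr.
Qed.

(** Outer approximation: an open set containing [E] contains, around each point of
    [E], a small cell. *)
Lemma grid_filtration : regular_filtration mu key (2 ^+ n).
Proof.
have mk k := mesh_gt0 k s_gt0.
split => //.
- by move=> k v; exact: (borel_measurable_Rn (borel_grid_cell k v)).
- move=> k x y /ffunP e; apply/ffunP => i; have := e i; rewrite !ffunE => {}e.
  apply: floor_double; move: e.
  rewrite -/(mesh s k.+1) -/(mesh s k) (meshS s k).
  have h z : 2 * (z / (2 * mesh s k.+1)) = z / mesh s k.+1.
    by field; rewrite gt_eqF.
  by rewrite !h.
- by move=> k x; rewrite lebesgue_grid_cell lte_fin exprn_gt0.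
- by move=> k x; rewrite lebesgue_grid_cell ltry.
- move=> k0 x0 E e mE Ecell e0.
  have EQ : E `<=` cube x0 (mesh s k0) by move=> x /Ecell; exact: grid_cell_cube.
  have [U [oU mU EU Ue]] := outer_regular (mk k0) mE EQ e0.
  exists (fun k v => cell key k v `<=` U); split.
    move=> x Ex; rewrite stopped_cellE.
    have [r r0 xr] := oU _ (EU _ Ex); have [k k0k kr] := mesh_small k0 r0.
    exists k => //; apply: subset_trans xr; apply: subset_trans (cubeS kr).
    exact: grid_cell_cube.
  apply: le_trans _ Ue; apply: le_measure.
  - rewrite inE; apply: measurable_stopped => k v.
    exact: (borel_measurable_Rn (borel_grid_cell k v)).
  - by rewrite inE; exact: borel_measurable_Rn mU.
  - by move=> x [k [y [[_ sub _] xy]]]; exact: sub.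
- by move=> k x; rewrite !lebesgue_grid_cell -EFinM lee_fin -exprMn -meshS.
Qed.

End grid.

(** * The one-third trick *)

Lemma floor_neq_between (R : realType) (u v : R) :
  Num.floor v <> Num.floor u -> exists z : int, `|z%:~R - u| <= `|v - u|.
Proof.
move=> neq; have [uv|vu] := leP u v.
  exists (Num.floor v); have /andP[h1 h2] := floor_itv v.
  have uz : u < (Num.floor v)%:~R.
    rewrite ltNge; apply/negP => zu; apply: neq; apply/esym/floor_eqP.
    by rewrite zu (le_lt_trans uv).
  by rewrite !ger0_norm ?subr_ge0 ?(ltW uz)// lerD2r.
exists (Num.floor u); have /andP[h1 h2] := floor_itv u.
have vz : v < (Num.floor u)%:~R.
  rewrite ltNge; apply/negP => zv; apply: neq; apply/floor_eqP.
  by rewrite zv (lt_trans vu).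
by rewrite distrC [leRHS]distrC !ger0_norm ?subr_ge0 ?(ltW vu)// lerD2l lerN2 ltW.
Qed.

Lemma small_int (R : realType) (m : int) : `|m%:~R| < 1 :> R -> m = 0.
Proof. by rewrite -intr_norm (ltrz1 R); case: m => [[|m]|m]. Qed.

(** A power of two is not a multiple of three, so the integers and their
    translates by a third of a power of two are well separated. *)
Lemma third_shift (R : realType) (u : R) k :
  (forall v, `|v - u| < 6^-1 -> Num.floor v = Num.floor u) \/
  (forall v, `|v - (u - 2 ^+ k / 3)| < 6^-1 ->
     Num.floor v = Num.floor (u - 2 ^+ k / 3)).
Proof.
apply: contrapT => /not_orP[/existsNP[v /not_implyP[vu /floor_neq_between[z zv]]]].
move=> /existsNP[v' /not_implyP[vu' /floor_neq_between[z' zv']]].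
have {vu}zu := le_lt_trans zv vu; have {vu'}zu' := le_lt_trans zv' vu'.
have : `|(3 * (z' - z) + 2 ^+ k)%:~R| < 1 :> R.
  rewrite intrD intrM intrB rmorphXn/=.
  move: zu zu'; rewrite !ltr_norml => /andP[h1 h2] /andP[h3 h4].
  by apply/andP; split; lra.
move=> /small_int e0.
have : (3 %| 2 ^ k)%N.
  have : (3 %| (2 ^+ k : int))%Z.
    by rewrite (_ : 2 ^+ k = 3 * (z - z')) ?dvdz_mulr//; lia.
  by rewrite dvdzE abszX.
by rewrite Euclid_dvdX.
Qed.

(** [1 / 2 - m / 3] is an odd multiple of [1 / 6], so it is at distance at least
    [1 / 6] from every integer. *)
Lemma half_shift (R : realType) (m : nat) (v : R) :
  `|v - (2^-1 - m%:R / 3)| < 6^-1 ->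
  Num.floor v = Num.floor (2^-1 - m%:R / 3 : R).
Proof.
move=> hv; apply: contrapT => /floor_neq_between[z /le_lt_trans /(_ hv) zv].
have : `|(6 * z - 3 + 2 * m%:Z)%:~R| < 1 :> R.
  rewrite intrD intrB !intrM -pmulrn.
  move: zv; rewrite !ltr_norml => /andP[h1 h2].
  by apply/andP; split; lra.
by move=> /small_int; lia.
Qed.

Section shifted_grids.
Context {R : realType} {n : nat}.
Local Notation T := (Rn R n).
Local Notation mu := (@lebesgue_Rn R n).

Definition shifted (a : 'I_n -> R) (s : R) (e : {ffun 'I_n -> bool}) i : R :=
  a i + (e i)%:R * (s / 3).

Lemma shifted_position a s e i k (y : R) : 0 < s ->
  (y - shifted a s e i) / mesh s k = (y - a i) / mesh s k - (e i)%:R * (2 ^+ k / 3).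
Proof.
move=> s0; rewrite /shifted /mesh; field.
by rewrite expf_neq0 ?gt_eqF.
Qed.

(** Shifting the coordinates of the grid by a third of its largest mesh moves the
    positions, in units of the mesh of level [k], by a third of a power of two: in
    each coordinate one of the two grids has no face near [x]. *)
Lemma one_third_trick a s (x : 'rV[R]_n) r k : 0 < s -> 6 * r <= mesh s k ->
  exists e, forall y, cube x r y ->
    grid (shifted a s e) s k y = grid (shifted a s e) s k x.
Proof.
move=> s0 rk; have m0 := mesh_gt0 k s0.
pose u i := (x ord0 i - a i) / mesh s k.
pose e := [ffun i => ~~ `[< forall v, `|v - u i| < 6^-1 -> Num.floor v = Num.floor (u i) >]].
exists e => y xy; apply/ffunP => i; rewrite !ffunE -!/(mesh s k) !shifted_position//.
have dist : `|(y ord0 i - a i) / mesh s k - u i| < 6^-1.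
  rewrite /u -mulrBl normrM normfV (gtr0_norm m0) ltr_pdivrMr//.
  rewrite (_ : _ - a i - _ = y ord0 i - x ord0 i); last by ring.
  by apply: (lt_le_trans (xy i)); lra.
rewrite /e ffunE; case: asboolP => [h|nh] /=.
  by rewrite !mul0r !subr0; apply: h.
rewrite !mul1r; have [//|h] := third_shift (u i) k.
apply: h; rewrite (_ : _ - _ - _ = (y ord0 i - a i) / mesh s k - u i)//; ring.
Qed.

(** The cube is at the centre of a cell, and remains away from the faces for all the
    shifts, a third of an integer being never close to a half-integer. *)
Lemma centered_grid s (x0 y : 'rV[R]_n) r k e : 0 < s -> 6 * r <= mesh s k ->
  cube x0 r y ->
  let a i := x0 ord0 i - mesh s k / 2 in
  grid (shifted a s e) s k y = grid (shifted a s e) s k x0.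
Proof.
move=> s0 rk xy a; have m0 := mesh_gt0 k s0.
apply/ffunP => i; rewrite !ffunE -!/(mesh s k) !shifted_position//.
have -> : (x0 ord0 i - a i) / mesh s k = 2^-1.
  by rewrite /a; field; rewrite gt_eqF.
have -> : (e i)%:R * (2 ^+ k / 3) = (e i * 2 ^ k)%:R / 3 :> R.
  by rewrite natrM natrX; ring.
apply: half_shift.
rewrite (_ : _ - _ - _ = (y ord0 i - x0 ord0 i) / mesh s k); last first.
  by rewrite /a; field; rewrite gt_eqF.
rewrite normrM normfV (gtr0_norm m0) ltr_pdivrMr//.
by apply: (lt_le_trans (xy i)); lra.
Qed.

End shifted_grids.

(** * Weights and functions of bounded mean oscillation on cubes and on grids *)

Lemma ae_mono d (T : measurableType d) (R : realType)
    (mu : {measure set T -> \bar R}) (P Q : T -> Prop) :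
  (forall x, P x -> Q x) -> {ae mu, forall x, P x} -> {ae mu, forall x, Q x}.
Proof. by move=> PQ; apply: filterS. Qed.

Section cube_weights.
Context {R : realType} {n : nat}.
Local Notation T := (Rn R n).
Local Notation mu := (@lebesgue_Rn R n).

(** As for cells, with the measure [(2 * r) ^+ n] of the cube written out. *)
Record cube_A1 (w : 'rV[R]_n -> R) (K : R) : Prop := CubeA1 {
  qa_meas : measurable_fun [set: T] (w : T -> R) ;
  qa_ge0 : forall x, 0 <= w x ;
  qa_fin : forall x r, (\int[mu]_(y in cube x r) (w y)%:E < +oo)%E ;
  qa_gt0 : forall x r, 0 < r -> (0 < \int[mu]_(y in cube x r) (w y)%:E)%E ;
  qa_K_ge1 : 1 <= K ;
  qa_ae : forall x r, 0 < r -> {ae mu, forall z, cube x r z ->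
    (\int[mu]_(y in cube x r) (w y)%:E <= (K * (2 * r) ^+ n * w z)%:E)%E} }.

Variables (w : 'rV[R]_n -> R) (K : R).
Hypothesis Hw : cube_A1 w K.
Let mw := qa_meas Hw.
Let w_ge0 := qa_ge0 Hw.
Let W (P : set T) := (\int[mu]_(y in P) (w y)%:E)%E.
Let K_gt0 : 0 < K := lt_le_trans ltr01 (qa_K_ge1 Hw).

Let mwE (P : set T) : measurable_fun P (fun y : T => (w y)%:E).
Proof. by apply/measurable_EFinP; apply: measurable_funTS. Qed.

Lemma cube_A1_subset x r (P : set T) : 0 < r -> measurable P ->
  P `<=` cube x r ->
  (W (cube x r) * mu P <= (K * (2 * r) ^+ n)%:E * W P)%E.
Proof.
move=> r0 mP Psub.
have c0 : 0 <= K * (2 * r) ^+ n.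
  by rewrite mulr_ge0 ?(ltW K_gt0)// exprn_ge0// mulr_ge0// ltW.
have Wfin : W (cube x r) \is a fin_num.
  rewrite ge0_fin_numE ?(qa_fin Hw)//.
  by apply: integral_ge0 => y _; rewrite lee_fin w_ge0.
rewrite -(fineK Wfin) -integral_cst// -ge0_integralZl//; last first.
  by move=> y _; rewrite lee_fin w_ge0.
apply: ae_ge0_le_integral => //.
- by move=> y _; rewrite /= fineK//; apply: integral_ge0 => z _; rewrite lee_fin w_ge0.
- by move=> y _; rewrite mule_ge0// lee_fin w_ge0.
- exact: measurable_funeM.
apply: (ae_mono _ (qa_ae Hw x r0)) => y h Py.
by rewrite /= fineK// -EFinM; exact: h (Psub _ Py).
Qed.

Lemma cell_A1_grid o s : 0 < s ->
  cell_A1 mu (grid o s : nat -> T -> _) w (2 ^+ n * K).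
Proof.
move=> s0; have mk k := mesh_gt0 k s0.
have mcell k v : measurable (cell (grid o s : nat -> T -> _) k v : set T).
  exact: (borel_measurable_Rn (borel_grid_cell o s0 k v)).
have mc x r : measurable (cube x r : set T) by exact: measurable_cube.
have le_cube k x : (W (cell (grid o s : nat -> T -> _) k (grid o s k x)) <=
    W (cube x (mesh s k)))%E.
  apply: ge0_subset_integral => //; first by move=> y _; rewrite lee_fin w_ge0.
  exact: grid_cell_cube.
split => //.
- by move=> k x; apply: le_lt_trans (le_cube k x) (qa_fin Hw x (mesh s k)).
- move=> k x; have := cube_A1_subset (mk k) (mcell k _) (grid_cell_cube s0 (x := x)).
  rewrite lebesgue_grid_cell//.
  have := qa_gt0 Hw x (mk k); rewrite -/(W _).
  set P := cell _ _ _; have : (0 <= W P)%E.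
    by apply: integral_ge0 => y _; rewrite lee_fin w_ge0.
  rewrite le_eqVlt => /predU1P[<-|//] W0.
  rewrite mule0 leNgt mule_gt0// lte_fin exprn_gt0//.
- have : 1 <= (2 : R) ^+ n by rewrite exprn_ege1// ler1n.
  by have := qa_K_ge1 Hw; nra.
- move=> k x; apply: (ae_mono _ (qa_ae Hw x (mk k))) => y h Py.
  apply: (le_trans (le_cube k x)).
  have := h (grid_cell_cube s0 Py); rewrite -/(W _) => /le_trans; apply.
  rewrite lebesgue_grid_cell// -EFinM lee_fin exprMn.
  by rewrite le_eqVlt; apply/orP; left; apply/eqP; ring.
Qed.

End cube_weights.

Section cube_oscillation.
Context {R : realType} {n : nat}.
Local Notation T := (Rn R n).
Local Notation mu := (@lebesgue_Rn R n).

(** The constants are arbitrary rather than averages: a cell inherits that of a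
    cube which contains it. *)
Definition cube_BMO (b : 'rV[R]_n -> R) (A : R) : Prop :=
  measurable_fun [set: T] (b : T -> R) /\
  forall x r, 0 < r -> exists c : R,
    (\int[mu]_(y in cube x r) `|b y - c|%:E <= (A * (2 * r) ^+ n)%:E)%E.

Lemma cell_BMO_grid b A o s : cube_BMO b A -> 0 < s ->
  exists c : nat -> {ffun 'I_n -> int} -> R, forall k (x : T),
  (\int[mu]_(y in cell (grid o s : nat -> T -> _) k (grid o s k x))
     `|b y - c k (grid o s k x)|%:E <=
   (2 ^+ n * A)%:E * mu (cell (grid o s : nat -> T -> _) k (grid o s k x)))%E.
Proof.
move=> [mb bA] s0; have mk k := mesh_gt0 k s0.
pose z k (v : {ffun 'I_n -> int}) : 'rV[R]_n := \row_i (o i + (v i)%:~R * mesh s k).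
have /choice[c hc] : forall kv : nat * {ffun 'I_n -> int}, exists c : R,
    (\int[mu]_(y in cube (z kv.1 kv.2) (mesh s kv.1)) `|b y - c|%:E <=
      (A * (2 * mesh s kv.1) ^+ n)%:E)%E.
  by move=> [k v]; exact: bA.
exists (fun k v => c (k, v)) => k x; have := hc (k, grid o s k x).
rewrite lebesgue_grid_cell// -EFinM /= => h.
rewrite (_ : 2 ^+ n * A * _ = A * (2 * mesh s k) ^+ n); last first.
  by rewrite [in RHS]exprMn; ring.
apply: le_trans _ h; apply: ge0_subset_integral => //.
- exact: (borel_measurable_Rn (borel_grid_cell o s0 k _)).
- exact: measurable_cube.
- apply/measurable_EFinP; apply: measurable_funTS; apply: measurableT_comp => //.
  exact: measurable_funB.
- move=> y; rewrite grid_cellE// => hy i; have := hy i.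
  rewrite /= in_itv/= mxE intrD mulrDl mul1r => /andP[h1 h2].
  by rewrite ltr_norml; apply/andP; split; have := mk k; lra.
Qed.

End cube_oscillation.

(** * The commutator bound for one grid *)

Lemma measure_bigsetU_le d (T : measurableType d) (R : realType) (I : Type)
    (mu : {measure set T -> \bar R}) (F : I -> set T) (M : R) (s : seq I) :
  (forall i, measurable (F i)) -> (forall i, mu (F i) <= M%:E)%E ->
  (mu (\big[setU/set0]_(i <- s) F i) <= ((size s)%:R * M)%:E)%E.
Proof.
move=> mF FM; elim: s => [|i s ih]; first by rewrite big_nil measure0 mul0r.
rewrite big_cons /= -natr1 mulrDl mul1r addrC EFinD.
apply: le_trans _ (leeD (FM i) ih); apply: measureU2 => //.
by apply: bigsetU_measurable.
Qed.

(** A bound on the measures of sets that eventually contain [A] passes to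
    their inferior limit, which contains [A]. *)
Lemma measure_liminf_le d (T : measurableType d) (R : realType)
    (mu : {measure set T -> \bar R}) (F : (set T)^nat) (M : R) :
  (forall j, measurable (F j)) -> (forall j, mu (F j) <= M%:E)%E ->
  let E := \bigcup_i \bigcap_(j in [set j | (i <= j)%N]) F j in
  measurable E /\ (mu E <= M%:E)%E.
Proof.
move=> mF FM E.
have mG i : measurable (\bigcap_(j in [set j | (i <= j)%N]) F j).
  by apply: bigcap_measurableType => *; exact: mF.
have mE : measurable E by exact: bigcupT_measurable.
split => //.
have cv : mu (\bigcap_(j in [set j | (i <= j)%N]) F j) @[i --> \oo] --> mu E.
  apply: nondecreasing_cvg_mu => // i i' ii'; apply/subsetPset => x h j /= i'j.
  by apply: h => /=; exact: leq_trans i'j.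
rewrite -(cvg_lim _ cv)//; apply: lime_le; first by apply/cvg_ex; exists (mu E).
apply: nearW => i; apply: le_trans _ (FM i); apply: le_measure; rewrite ?inE//.
by move=> x; apply => /=.
Qed.

Section comparisons.
Context d (T : measurableType d) (R : realType).
Variable mu : {measure set T -> \bar R}.

Lemma lt_integral_scale (P Q : set T) (g : T -> R) (a : R) :
  measurable P -> measurable Q -> Q `<=` P -> 0 < a ->
  (mu P <= a%:E * mu Q)%E ->
  measurable_fun [set: T] g -> (forall y, 0 <= g y) ->
  (mu Q < \int[mu]_(y in Q) (g y)%:E)%E ->
  (mu P < \int[mu]_(y in P) (a * g y)%:E)%E.
Proof.
move=> mP mQ QP a0 muP mg g0 lt_g; apply: (le_lt_trans muP).
apply: (@lt_le_trans _ _ (a%:E * \int[mu]_(y in Q) (g y)%:E)%E).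
  by rewrite lte_pmul2l.
under [leRHS]eq_integral do rewrite EFinM.
have mgP : measurable_fun P (fun y => (g y)%:E).
  by apply/measurable_EFinP; apply: measurable_funTS.
rewrite ge0_integralZl//; last 2 first.
- by move=> y _; rewrite lee_fin.
- by rewrite lee_fin ltW.
apply: lee_wpmul2l; first by rewrite lee_fin ltW.
by apply: ge0_subset_integral => // y _; rewrite lee_fin.
Qed.

Lemma integral_Phi_scale (P Q : set T) (h w : T -> R) (a : R) :
  measurable P -> measurable Q -> P `<=` Q -> 0 < a ->
  measurable_fun [set: T] h -> (forall y, 0 <= h y) ->
  measurable_fun [set: T] w -> (forall y, 0 <= w y) ->
  (\int[mu]_(y in P) (Phi (a * h y) * w y)%:E <=
   (a * (1 + log_plus a))%:E * \int[mu]_(y in Q) (Phi (h y) * w y)%:E)%E.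
Proof.
move=> mP mQ PQ a0 mh h0 mw w0; set c := a * _.
have c0 : 0 <= c by rewrite mulr_ge0 ?addr_ge0 ?log_plus_ge0// ltW.
have mPhi (a' : R) : measurable_fun [set: T] (fun y => Phi (a' * h y) * w y).
  apply: measurable_funM => //; apply: measurableT_comp; first exact: measurable_Phi.
  exact: measurable_funM.
have mPhi1 : measurable_fun [set: T] (fun y => Phi (h y) * w y).
  by have := mPhi 1; under eq_fun do rewrite mul1r.
have Phi0 (a' : R) y : 0 <= a' -> 0 <= Phi (a' * h y) * w y.
  by move=> a'0; rewrite mulr_ge0// Phi_ge0// mulr_ge0.
have Phi1 y : 0 <= Phi (h y) * w y by rewrite mulr_ge0// Phi_ge0.
have <- : (\int[mu]_(y in Q) (c%:E * (Phi (h y) * w y)%:E) =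
    c%:E * \int[mu]_(y in Q) (Phi (h y) * w y)%:E)%E.
  apply: ge0_integralZl_EFin => //; first by move=> y _; rewrite lee_fin.
  by apply/measurable_EFinP; apply: measurable_funTS.
apply: (@le_trans _ _ (\int[mu]_(y in P) (c%:E * (Phi (h y) * w y)%:E))%E).
  apply: ge0_le_integral => //.
  - by move=> y _; rewrite lee_fin Phi0// ltW.
  - by apply/measurable_EFinP; apply: measurable_funTS.
  - by apply: measurable_funeM; apply/measurable_EFinP; apply: measurable_funTS.
  - by move=> y _; rewrite -EFinM lee_fin mulrA ler_wpM2r// PhiM.
apply: ge0_subset_integral => //.
  by apply: measurable_funeM; apply/measurable_EFinP; apply: measurable_funTS.
by move=> y _; rewrite mule_ge0// lee_fin.
Qed.

Lemma measurable_dist_mul (b h : T -> R) (a : R) :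
  measurable_fun [set: T] b -> measurable_fun [set: T] h ->
  measurable_fun [set: T] (fun y => `|a - b y| * h y).
Proof.
move=> mb mh; apply: measurable_funM => //; apply: measurableT_comp => //.
exact: measurable_funB.
Qed.

End comparisons.

Section cube_commutator.
Context {R : realType} {n : nat}.
Local Notation T := (Rn R n).
Local Notation mu := (@lebesgue_Rn R n).
Implicit Types (w b h : 'rV[R]_n -> R) (K A kappa CB N : R) (B : set T).

(** A cube of radius [r] is to be compared with a cell of mesh at least [6 * r], as
    the one-third trick requires, and of comparable measure. *)
Lemma mesh_comparable (s r : R) : 0 < s -> 0 < r -> 6 * r <= s ->
  exists2 k, 6 * r <= mesh s k & mesh s k <= 6 * (2 * r).
Proof.
move=> s0 r0 rs.
have exk : exists k, mesh s k < 6 * r.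
  have r3 : 0 < 3 * r by rewrite mulr_gt0.
  have [k _ mk] := mesh_small s 0 r3; exists k.
  by apply: le_lt_trans mk _; lra.
case: (ex_minnP exk) => -[|k] mk kmin.
  by move: mk; rewrite /mesh expr0 divr1 ltNge rs.
exists k; last by rewrite meshS; move: mk; lra.
by rewrite leNgt; apply/negP => /kmin; rewrite ltnn.
Qed.

Lemma cube_A1_ge0 w K (P : set T) : cube_A1 w K ->
  (0 <= \int[mu]_(y in P) (w y)%:E)%E.
Proof.
by move=> Hw; apply: integral_ge0 => y _; rewrite lee_fin; exact: qa_ge0 Hw y.
Qed.

Lemma cube_A1_measurable w K (P : set T) : cube_A1 w K ->
  measurable_fun P (fun y : T => (w y)%:E).
Proof.
by move=> Hw; apply/measurable_EFinP; apply: measurable_funTS; exact: qa_meas Hw.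
Qed.

Lemma cube_A1_cell w K o s k (x : T) (kappa : R) : cube_A1 w K -> 0 < s ->
  0 <= kappa <= 1 ->
  fine (\int[mu]_(y in cube x (mesh s k)) (w y)%:E) `^ kappa <=
  2 ^+ n * K * fine (\int[mu]_(y in cell (grid o s : nat -> T -> _) k (grid o s k x))
    (w y)%:E) `^ kappa.
Proof.
move=> Hw s0 /andP[k0 k1]; have m0 := mesh_gt0 k s0.
have K2_ge1 : 1 <= 2 ^+ n * K.
  by rewrite mulr_ege1 ?(qa_K_ge1 Hw)// exprn_ege1// ler1n.
have K2_ge0 : 0 <= 2 ^+ n * K by exact: le_trans ler01 K2_ge1.
have mP := borel_measurable_Rn (borel_grid_cell o s0 k (grid o s k x)).
have := cube_A1_subset Hw m0 mP (grid_cell_cube s0 (x := x)).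
have := ca_fin (cell_A1_grid Hw o s0) k x.
have := qa_fin Hw x (mesh s k).
have := cube_A1_ge0 (cube x (mesh s k)) Hw.
have := cube_A1_ge0 (cell (grid o s : nat -> T -> _) k (grid o s k x)) Hw.
rewrite lebesgue_grid_cell//.
move: (\int[mu]_(y in cell _ _ _) _)%E (\int[mu]_(y in cube _ _) _)%E.
move=> [v| |]// [u| |]//; rewrite !lee_fin => v0 u0 _ _ /=.
have mn0 : 0 < mesh s k ^+ n by rewrite exprn_gt0.
move=> uv; have {}uv : u <= 2 ^+ n * K * v.
  rewrite -(ler_pM2r mn0); apply: (le_trans uv).
  rewrite exprMn; move: (2 ^+ n) (mesh s k ^+ n) => r1 r2.
  by rewrite le_eqVlt; apply/orP; left; apply/eqP; ring.
have := uv; move=> /(ge0_ler_powR k0).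
rewrite !nnegrE u0 mulr_ge0// => /(_ isT isT) /le_trans; apply.
by rewrite powRM// ler_wpM2r ?powR_ge0//; apply: ler1_powR.
Qed.

(** The Morrey bound passes from a cube to the cell inside it by doubling. *)
Lemma cell_morrey w K h N kappa o s k (x : T) (a : R) : cube_A1 w K -> 0 < s ->
  0 <= kappa <= 1 -> 0 < a -> 0 <= N ->
  measurable_fun [set: T] (h : T -> R) -> (forall y, 0 <= h y) ->
  (forall x r, 0 < r -> (\int[mu]_(y in cube x r) (Phi (h y) * w y)%:E <=
    (N * fine (\int[mu]_(y in cube x r) (w y)%:E) `^ kappa)%:E)%E) ->
  (\int[mu]_(y in cell (grid o s : nat -> T -> _) k (grid o s k x))
      (Phi (a * h y) * w y)%:E <=
   (a * (1 + log_plus a) * (2 ^+ n * K) * N *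
     fine (\int[mu]_(y in cell (grid o s : nat -> T -> _) k (grid o s k x))
       (w y)%:E) `^ kappa)%:E)%E.
Proof.
move=> Hw s0 k01 a0 N0 mh h0 morrey; have m0 := mesh_gt0 k s0.
have c0 : 0 <= a * (1 + log_plus a).
  by rewrite mulr_ge0 ?addr_ge0 ?log_plus_ge0// ltW.
have mP := borel_measurable_Rn (borel_grid_cell o s0 k (grid o s k x)).
have mQ := measurable_cube x (mesh s k).
have PQ := grid_cell_cube (o := o) s0 (x := x) (k := k).
apply: (le_trans (integral_Phi_scale mu mP mQ PQ a0 mh h0 (qa_meas Hw) (qa_ge0 Hw))).
have c0' : (0 <= (a * (1 + log_plus a))%:E)%E by rewrite lee_fin.
apply: (le_trans (lee_wpmul2l c0' (morrey x _ m0))).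
rewrite -EFinM lee_fin.
have := cube_A1_cell o k x Hw s0 k01.
move: (fine _ `^ _) (fine _ `^ _) => v u uv.
rewrite [leRHS](_ : _ = a * (1 + log_plus a) * N * (2 ^+ n * K * v)); last by ring.
by rewrite [leLHS]mulrA ler_wpM2l// mulr_ge0.
Qed.

(** An average over a cube of comparable measure contained in a cell is at most
    [6 ^+ n] times the average over the cell; the factor is put on [h]. *)
Lemma grid_commutator_bound w b K A kappa CB :
  cube_A1 w K -> cube_BMO b A -> 0 < A -> 0 < kappa < 1 -> 1 <= CB ->
  exists2 C : R, 0 < C & forall h N B (x0 : T) r0 o s j,
  0 < s -> mesh s j = 6 * r0 -> measurable B ->
  (forall y, B y -> grid o s j y = grid o s j x0) ->
  (\int[mu]_(y in cube x0 (6 * r0)%R) (w y)%:E <=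
     CB%:E * \int[mu]_(y in B) (w y)%:E)%E ->
  measurable_fun [set: T] (h : T -> R) -> (forall y, 0 <= h y) -> 0 <= N ->
  (forall x r, 0 < r -> (\int[mu]_(y in cube x r) (Phi (h y) * w y)%:E <=
    (N * fine (\int[mu]_(y in cube x r) (w y)%:E) `^ kappa)%:E)%E) ->
  exists E : set T, [/\ measurable E,
    B `&` [set x | exists2 r, 0 < r & (exists2 k, mesh s k <= 6 * (2 * r) &
        cube x r `<=` cell (grid o s : nat -> T -> _) k (grid o s k x)) /\
      ((mu (cube x r) < \int[mu]_(y in cube x r) (h y)%:E)%E \/
       (mu (cube x r) < \int[mu]_(y in cube x r) (`|b x - b y| * h y)%:E)%E)]
      `<=` E &
    (\int[mu]_(y in E) (w y)%:E <=
      (C * N * fine (\int[mu]_(y in B) (w y)%:E) `^ kappa)%:E)%E].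
Proof.
move=> Hw Hb A0 kappa01 CB1; have /andP[/ltW k0 /ltW k1] := kappa01.
have K2_ge1 : 1 <= 2 ^+ n * K.
  by rewrite mulr_ege1 ?(qa_K_ge1 Hw)// exprn_ege1// ler1n.
have K2_gt0 : 0 < 2 ^+ n * K by exact: lt_le_trans ltr01 K2_ge1.
have D0 : 0 < (2 : R) ^+ n by rewrite exprn_gt0.
have A0' : 0 < 2 ^+ n * A by rewrite mulr_gt0.
have [Cd Cd0 cell_bound] := @cell_commutator_bound _ T R {ffun 'I_n -> int} mu
  (2 ^+ n) (2 ^+ n * A) (2 ^+ n * K) CB kappa D0 A0' K2_ge1 CB1 kappa01.
have six_gt0 : 0 < (6 : R) ^+ n by rewrite exprn_gt0.
pose cK : R := 6 ^+ n * (1 + log_plus (6 ^+ n)) * (2 ^+ n * K).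
have cK0 : 0 < cK by rewrite mulr_gt0// mulr_gt0// ltr_pwDl// log_plus_ge0.
exists (Cd * cK); first by rewrite mulr_gt0.
move=> h N B x0 r0 o s j s0 meshj mB Bsub WB mh h0 N0 morrey.
pose key : nat -> T -> {ffun 'I_n -> int} := grid o s.
have [c hc] := cell_BMO_grid o Hb s0.
have mh' : measurable_fun [set: T] (fun y : T => 6 ^+ n * h y : R).
  exact: measurable_funM.
have h'0 y : 0 <= 6 ^+ n * h y by apply: mulr_ge0; [exact: ltW|exact: h0].
have cKN : 0 <= cK * N by apply: mulr_ge0; [exact: ltW|exact: N0].
have WB' : (\int[mu]_(y in cell key j (key j x0)) (w y)%:E <=
     CB%:E * \int[mu]_(y in B) (w y)%:E)%E.
  apply: le_trans _ WB; rewrite -meshj; apply: ge0_subset_integral.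
  - exact: (borel_measurable_Rn (borel_grid_cell o s0 j _)).
  - exact: measurable_cube.
  - exact: cube_A1_measurable Hw.
  - by move=> y _; rewrite lee_fin; exact: qa_ge0 Hw y.
  - exact: grid_cell_cube.
have morrey' k x : (\int[mu]_(y in cell key k (key k x)) (Phi (6 ^+ n * h y) * w y)%:E <=
    (cK * N * fine (\int[mu]_(y in cell key k (key k x)) (w y)%:E) `^ kappa)%:E)%E.
  by apply: cell_morrey => //; rewrite k0.
have [E [mE subE WE]] := cell_bound key w b (fun y => 6 ^+ n * h y) c B j x0 (cK * N)
  (grid_filtration o s0) (cell_A1_grid Hw o s0) Hb.1 hc mB Bsub WB' mh' h'0 cKN morrey'.
exists E; split; [exact: mE| |by move: WE; rewrite mulrA].
move=> x [Bx [r r0' [[k mk Q_P] bad]]]; apply: subE; split; first exact: Bx.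
exists k.
have mP := borel_measurable_Rn (borel_grid_cell o s0 k (grid o s k x)).
have mQ := measurable_cube x r.
have muP : (mu (cell key k (key k x)) <= (6 ^+ n)%:E * mu (cube x r))%E.
  rewrite lebesgue_grid_cell// lebesgue_cube// -EFinM lee_fin -exprMn.
  apply: lerXn2r mk; rewrite nnegrE; first exact/ltW/mesh_gt0.
  by rewrite mulr_ge0// mulr_ge0// ltW.
case: bad => bad; [left|right].
  exact: (lt_integral_scale mP mQ Q_P six_gt0 muP mh h0 bad).
have mg : measurable_fun [set: T] (fun y : T => `|b x - b y| * h y : R).
  exact: measurable_dist_mul Hb.1 mh.
have g0 y : 0 <= `|b x - b y| * h y by apply: mulr_ge0; [exact: normr_ge0|exact: h0].
under eq_integral do rewrite mulrCA.
exact: (lt_integral_scale mP mQ Q_P six_gt0 muP mg g0 bad).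
Qed.

End cube_commutator.

(** * The commutator bound for cubes *)

Section cube_commutator.
Context {R : realType} {n : nat}.
Local Notation T := (Rn R n).
Local Notation mu := (@lebesgue_Rn R n).
Implicit Types (w b h : 'rV[R]_n -> R) (K A kappa CB N : R) (B : set T).

Definition large_average b h : set T := [set x | exists2 r, 0 < r &
  ((mu (cube x r) < \int[mu]_(y in cube x r) (h y)%:E)%E \/
   (mu (cube x r) < \int[mu]_(y in cube x r) (`|b x - b y| * h y)%:E)%E)].

(** A grid has a largest mesh and so sees only bounded radii. For each scale [s j],
    the finitely many shifts of a grid see all the radii up to that scale; the
    exceptional sets at the different scales have the same bound, and a bad point
    belongs to all of them from some scale on, hence to their inferior limit. *)
Theorem cube_commutator_bound w b K A kappa CB :
  cube_A1 w K -> cube_BMO b A -> 0 < A -> 0 < kappa < 1 -> 1 <= CB ->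
  exists2 C : R, 0 < C & forall h N B (x0 : T) r0,
  0 < r0 -> measurable B -> B `<=` cube x0 r0 ->
  (\int[mu]_(y in cube x0 (6 * r0)%R) (w y)%:E <=
     CB%:E * \int[mu]_(y in B) (w y)%:E)%E ->
  measurable_fun [set: T] (h : T -> R) -> (forall y, 0 <= h y) -> 0 <= N ->
  (forall x r, 0 < r -> (\int[mu]_(y in cube x r) (Phi (h y) * w y)%:E <=
    (N * fine (\int[mu]_(y in cube x r) (w y)%:E) `^ kappa)%:E)%E) ->
  exists E : set T, [/\ measurable E, B `&` large_average b h `<=` E &
    (\int[mu]_(y in E) (w y)%:E <=
      (C * N * fine (\int[mu]_(y in B) (w y)%:E) `^ kappa)%:E)%E].
Proof.
move=> Hw Hb A0 kappa01 CB1.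
have [C C0 grid_bound] := grid_commutator_bound Hw Hb A0 kappa01 CB1.
pose nE : R := (size (index_enum {ffun 'I_n -> bool})).+1%:R.
have nE0 : 0 < nE by rewrite ltr0n.
exists (nE * C); first exact: mulr_gt0.
move=> h N B x0 r0 r00 mB Bsub WB mh h0 N0 morrey.
pose M := C * N * fine (\int[mu]_(y in B) (w y)%:E)%E `^ kappa.
have M0 : 0 <= M.
  by apply: mulr_ge0; [apply: mulr_ge0; [exact: ltW|exact: N0]|exact: powR_ge0].
pose s j := 2 ^+ j * (6 * r0).
have s0 j : 0 < s j by apply: mulr_gt0; [exact: exprn_gt0|exact: mulr_gt0].
have meshK j : mesh (s j) j = 6 * r0.
  by rewrite /mesh /s mulrAC divff ?mul1r// expf_neq0.
pose o j := shifted (fun i => x0 ord0 i - mesh (s j) j / 2) (s j).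
have /choice[E hE] : forall je : nat * {ffun 'I_n -> bool}, exists E : set T,
  [/\ measurable E,
    B `&` [set x | exists2 r, 0 < r &
      (exists2 k, mesh (s je.1) k <= 6 * (2 * r) &
        cube x r `<=` cell (grid (o je.1 je.2) (s je.1) : nat -> T -> _) k
          (grid (o je.1 je.2) (s je.1) k x)) /\
      ((mu (cube x r) < \int[mu]_(y in cube x r) (h y)%:E)%E \/
       (mu (cube x r) < \int[mu]_(y in cube x r) (`|b x - b y| * h y)%:E)%E)]
      `<=` E &
    (\int[mu]_(y in E) (w y)%:E <= M%:E)%E].
  move=> [j e]; apply: (grid_bound h N B x0 r0 (o j e) (s j) j (s0 j) (meshK j) mB
    _ WB mh h0 N0 morrey) => y By.
  by apply: (centered_grid e (s0 j) _ (Bsub _ By)); rewrite meshK.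
pose F j := \big[setU/set0]_e E (j, e).
have mE je : measurable (E je) by have [] := hE je.
have mF j : measurable (F j) by apply: bigsetU_measurable => e _; exact: mE.
pose nu := density mu (qa_meas Hw) (qa_ge0 Hw).
have FM j : (nu (F j) <= (nE * M)%:E)%E.
  have : (nu (F j) <= ((size (index_enum {ffun 'I_n -> bool}))%:R * M)%:E)%E.
    by apply: measure_bigsetU_le => e; have [] := hE (j, e).
  move=> /le_trans; apply; rewrite lee_fin; apply: ler_wpM2r; first exact: M0.
  by rewrite ler_nat.
have [mEE nuE] := measure_liminf_le mF FM.
exists (\bigcup_i \bigcap_(j in [set j | (i <= j)%N]) F j); split.
- exact: mEE.
- move=> x [Bx [r r_gt0 bad]].
  exists (Num.truncn (r / r0)) => [//|j /= ij].
  have r_le : 6 * r <= s j.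
    rewrite /s mulrCA ler_wpM2l// -ler_pdivrMr//.
    apply: (le_trans (ltW (truncnS_gt _))); rewrite -natrX ler_nat.
    exact: (leq_ltn_trans ij (ltn_expl j _)).
  have [k r_mesh mesh_r] := mesh_comparable (s0 j) r_gt0 r_le.
  have [e he] := one_third_trick (fun i => x0 ord0 i - mesh (s j) j / 2) x (s0 j) r_mesh.
  rewrite /F (bigD1 e)//=; left; have [_ sub _] := hE (j, e); apply: sub.
  split; first exact: Bx.
  exists r; [exact: r_gt0|split; [|exact: bad]].
  by exists k; [exact: mesh_r|exact: he].
- by apply: (le_trans nuE); rewrite /M mulrA mulrA.
Qed.

End cube_commutator.

(** * A continuous version of the power function *)

Section truncated_power.
Context {R : realType}.
Implicit Types a u s t p : R.

(** The power of the positive part: unlike the power itself, whose value at a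
    negative number is 1, it is continuous. *)
Definition ppow a u : R := Num.max u 0 `^ a.

Lemma ppowE a u : 0 <= u -> ppow a u = u `^ a.
Proof. by move=> u0; rewrite /ppow max_l. Qed.

Lemma ppow_ge0 a u : 0 <= ppow a u.
Proof. exact: powR_ge0. Qed.

Lemma continuous_ppow a : 0 < a -> continuous (ppow a).
Proof.
move=> a0 u; have [u0|u0|u0] := ltgtP 0 u.
- have cv : v `^ a @[v --> u] --> ppow a u.
    have cu : {for u, continuous (fun v : R => v `^ a)}.
      apply: differentiable_continuous.
      by apply/derivable1_diffP; apply: derivable_powR; rewrite in_itv/= u0.
    by rewrite (ppowE _ (ltW u0)); exact: cu.
  apply: cvg_trans cv; apply: near_eq_cvg; near=> v.
  by rewrite ppowE//; near: v; exact: lt_le_nbhsr.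
- have cv : (0 : R) @[v --> u] --> ppow a u.
    by rewrite /ppow max_r ?powR0 ?gt_eqF ?ltW//; exact: cvg_cst.
  apply: cvg_trans cv; apply: near_eq_cvg; near=> v.
  rewrite /ppow max_r ?powR0 ?gt_eqF//.
  by near: v; exact: lt_le_nbhsl.
- rewrite -u0 {u u0}.
  suff cv : ppow a v @[v --> (0 : R)] --> ppow a 0 by exact: cv.
  apply/cvgrPdist_lt => e e0.
  have small : \forall v \near (0 : R), `|v| < e `^ a^-1.
    by apply: (@nbhs0_lt _ R^o); exact: powR_gt0.
  rewrite /ppow maxxx powR0 ?gt_eqF//; near=> v.
  rewrite sub0r normrN ger0_norm ?powR_ge0//.
  apply: (@le_lt_trans _ _ (`|v| `^ a)).
    apply: ge0_ler_powR; rewrite ?nnegrE ?(ltW a0)//.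
      by rewrite le_max lexx orbT.
    by rewrite ge_max ler_norm normr_ge0.
  have -> : e = (e `^ a^-1) `^ a by rewrite -powRrM mulVf ?gt_eqF// powRr1 ?ltW.
  apply: gt0_ltr_powR; rewrite ?nnegrE ?powR_ge0//.
  by near: v; exact: small.
Unshelve. all: by end_near. Qed.

Lemma is_derive_ppow p u : 0 < u -> is_derive u 1 (ppow p) (p * u `^ (p - 1)).
Proof.
move=> u0; apply: (@near_eq_is_derive R R^o R^o (fun v => v `^ p)).
- near=> v; rewrite ppowE//; near: v; exact: lt_le_nbhsr.
- have uin : u \in `]0, +oo[%R by rewrite in_itv/= u0.
  apply: DeriveDef; first exact: derivable_powR.
  by rewrite -derive1E powR_derive1.
Unshelve. all: by end_near. Qed.

End truncated_power.

(** * The integral representation of Bessel functions *)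

Section derivation_rules.
Context {R : realType}.
Implicit Types (f g : R -> R) (x a b : R).

Lemma is_derive_add f g x a b : is_derive x 1 f a -> is_derive x 1 g b ->
  is_derive x 1 (fun t => f t + g t) (a + b).
Proof. by move=> df dg; exact: (@is_deriveD _ _ _ f g). Qed.

Lemma is_derive_mul f g x a b : is_derive x 1 f a -> is_derive x 1 g b ->
  is_derive x 1 (fun t => f t * g t) (a * g x + f x * b).
Proof.
move=> df dg; have /= d := @is_deriveM R R f g x 1 a b df dg.
by apply: (is_derive_eq d); rewrite addrC; congr (_ + _); exact: mulrC.
Qed.

Lemma is_derive_const (k x : R) : is_derive x 1 (fun=> k) 0.
Proof. exact: is_derive_cst. Qed.

Lemma is_derive_idfun x : is_derive x 1 (fun t : R => t) 1.
Proof. exact: is_derive_id. Qed.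

Lemma is_derive_chain f g x a b : is_derive (g x) 1 f a -> is_derive x 1 g b ->
  is_derive x 1 (fun t => f (g t)) (a * b).
Proof. by move=> df dg; exact: (@is_derive1_comp _ f g). Qed.

Lemma is_derive_inv x : x != 0 -> is_derive x 1 (fun t : R => t^-1) (- (x ^- 2)).
Proof.
move=> x0; have d := @is_deriveV R (fun t : R => t) x 1 1 x0 (is_derive_id _ _).
by apply: (is_derive_eq d); exact: mulr1.
Qed.

End derivation_rules.

Section oscillatory_integral.
Context {R : realType}.
Variable a : R.
Hypothesis a_gt0 : 0 < a.
Implicit Types (s t th : R) (j : nat).
Local Notation leb := (@lebesgue_measure R).

Let jfun j th t s : R := s ^+ j * cos (t * s + th) * ppow a (1 - s ^+ 2).

(** Up to a constant and a power of [t], the Bessel function of order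
    [a + 1/2] is [jint 0 0 t]; the other values of the parameters account for
    its derivatives. *)
Definition jint j th t : R := (\int[leb]_(s in `[-1, 1]) jfun j th t s)%R.

Let continuous_weight p : 0 < p -> continuous (fun s : R => ppow p (1 - s ^+ 2)).
Proof.
move=> p0 s; apply: (@continuous_comp _ _ _ (fun s : R => 1 - s ^+ 2) (ppow p)).
  by apply: continuousB; [exact: cst_continuous|exact: exprn_continuous].
exact: continuous_ppow.
Qed.

Let continuous_phase t th : continuous (fun s : R => t * s + th).
Proof.
move=> s; apply: continuousD; last exact: cst_continuous.
by apply: continuousM; [exact: cst_continuous|exact: cvg_id].
Qed.

Let continuous_jfun j th t : continuous (jfun j th t).
Proof.
move=> s; apply: (@continuousM _ _ (fun s => s ^+ j * cos (t * s + th))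
  (fun s => ppow a (1 - s ^+ 2))); last exact: continuous_weight.
apply: (@continuousM _ _ (fun s => s ^+ j) (fun s => cos (t * s + th))).
  exact: exprn_continuous.
apply: (@continuous_comp _ _ _ (fun s => t * s + th) (@cos R)).
  exact: continuous_phase.
exact: continuous_cos.
Qed.

Let integrable_continuous (f : R -> R) : continuous f ->
  leb.-integrable `[-1, 1] (EFin \o f).
Proof.
move=> cf; apply: continuous_compact_integrable; first exact: segment_compact.
exact: continuous_subspaceT.
Qed.

Let cos_add_pihalf th : cos (th + pi / 2) = - sin th.
Proof. by rewrite cosD cos_pihalf sin_pihalf mulr0 mulr1 sub0r. Qed.

Let is_derive_jfun j th s t :
  is_derive t 1 (fun t => jfun j th t s) (jfun j.+1 (th + pi / 2) t s).
Proof.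
have dphase : is_derive t 1 (fun t : R => t * s + th) s.
  rewrite (_ : (fun t : R => _) = (s *: (@id R^o) + cst th : R^o -> R^o)).
    by apply: is_derive_eq; rewrite addr0; exact: mulr1.
  by apply/funext => t'; rewrite /= mulrC.
have dcos : is_derive t 1 (@cos R \o (fun t : R => t * s + th)) (- sin (t * s + th) * s).
  exact: (@is_derive1_comp _ (@cos R) (fun t : R => t * s + th)).
rewrite /jfun.
have -> : s ^+ j.+1 * cos (t * s + (th + pi / 2)) * ppow a (1 - s ^+ 2) =
   s ^+ j * ppow a (1 - s ^+ 2) * (- sin (t * s + th) * s).
  by rewrite addrA cos_add_pihalf exprS; ring.
rewrite (_ : (fun t => _) =
    (s ^+ j * ppow a (1 - s ^+ 2)) *: (@cos R \o (fun t => t * s + th)) :> (R^o -> R^o)).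
  exact: is_deriveZ.
apply/funext => t'.
transitivity (s ^+ j * ppow a (1 - s ^+ 2) * cos (t' * s + th)) => //.
by ring.
Qed.

Let jfun_le1 j th t s : `[-1, 1]%classic s -> `|jfun j th t s| <= 1.
Proof.
rewrite /= in_itv/= -ler_norml => s1.
have s2 : `|s| ^+ 2 <= 1 by apply: exprn_ile1.
have ps : 0 <= 1 - s ^+ 2 by rewrite subr_ge0 -real_normK ?num_real.
have gs : ppow a (1 - s ^+ 2) <= 1.
  have := @ge0_ler_powR R a (ltW a_gt0) (1 - s ^+ 2) 1.
  rewrite ppowE//= powR1 !nnegrE ps ler01 gerBl sqr_ge0.
  by apply.
rewrite /jfun !normrM normrX (ger0_norm (ppow_ge0 _ _)).
have cs : `|cos (t * s + th)| <= 1 by rewrite ler_norml cos_geN1 cos_le1.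
apply: mulr_ile1; [by apply: mulr_ge0; rewrite ?exprn_ge0|exact: ppow_ge0| |exact: gs].
by apply: mulr_ile1; rewrite ?exprn_ge0 ?exprn_ile1.
Qed.

Let integrable_jfun j th t : leb.-integrable `[-1, 1] (EFin \o jfun j th t).
Proof. by apply: integrable_continuous => s; exact: continuous_jfun. Qed.

(** A phase shift by [pi / 2] writes the derivatives as integrals of the same form. *)
Lemma is_derive_jint j th t :
  is_derive t 1 (jint j th) (jint j.+1 (th + pi / 2) t).
Proof.
have mI : @measurable _ (measurableTypeR R) `[-1, 1]%classic by exact: measurable_itv.
have ta : `](t - 1), (t + 1)[%classic t.
  by rewrite /= in_itv/=; apply/andP; split; lra.
have der x y : derivable (jfun j th ^~ y) x 1.
  exact: (@ex_derive _ _ _ _ _ _ _ (is_derive_jfun j th y x)).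
have derE x y : partial1of2 (jfun j th) x y = jfun j.+1 (th + pi / 2) x y.
  by rewrite partial1of2E; exact: (@derive_val _ _ _ _ _ _ _ (is_derive_jfun j th y x)).
have int1 : leb.-integrable `[-1, 1] (EFin \o (cst 1 : R -> R)).
  by apply: integrable_continuous => x; exact: cst_continuous.
have bound x y : `](t - 1), (t + 1)[%classic x -> `[-1, 1]%classic y ->
    `|partial1of2 (jfun j th) x y| <= (cst 1 : R -> R) y.
  by move=> _ y1; rewrite derE; exact: jfun_le1.
have D1 := derivable_under_integral mI ta (fun x _ => integrable_jfun j th x)
  (fun x y _ _ => der x y) (fun=> ler01) int1 bound.
have D2 := differentiation_under_integral mI ta (fun x _ => integrable_jfun j th x)
  (fun x y _ _ => der x y) (fun=> ler01) int1 bound.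
apply: DeriveDef; first exact: D1.
rewrite -derive1E; apply: (eq_trans D2).
by apply: eq_Rintegral => y _; exact: derE.
Qed.

Lemma jint_bound j th t : `|jint j th t| <= 2.
Proof.
have mI : @measurable _ (measurableTypeR R) `[-1, 1]%classic by exact: measurable_itv.
apply: (le_trans (le_normr_Rintegral mI (integrable_jfun j th t))).
apply: (@le_trans _ _ (\int[leb]_(s in `[-1, 1]) (cst 1 : R -> R) s)%R).
  apply: le_Rintegral => //.
  - have cn : continuous (fun s => `|jfun j th t s|).
      by move=> s; apply: continuous_comp; [exact: continuous_jfun|exact: norm_continuous].
    exact: (integrable_continuous cn).
  - by apply: integrable_continuous => x; exact: cst_continuous.
  - by move=> s; exact: jfun_le1.
have n11 : -1 < 1 :> R by lra.
by rewrite Rintegral_cst//= lebesgue_measure_itv/= lte_fin n11 -EFinD/= mul1r; lra.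
Qed.

Lemma jint_pi j th t : jint j (th + pi / 2 + pi / 2) t = - jint j th t.
Proof.
have mI : @measurable _ (measurableTypeR R) `[-1, 1]%classic by exact: measurable_itv.
rewrite -mulN1r /jint -RintegralZl//.
apply: eq_Rintegral => s _; rewrite /jfun.
have -> : cos (t * s + (th + pi / 2 + pi / 2)) = - cos (t * s + th).
  rewrite !addrA cos_add_pihalf; congr (- _).
  by rewrite sinD cos_pihalf sin_pihalf mulr0 add0r mulr1.
by ring.
Qed.

(** Integration by parts: the differential equation of Bessel functions. *)
Lemma jint_ode th t :
  t * (jint 0 th t - jint 2 th t) + 2 * (a + 1) * jint 1 (th + pi / 2) t = 0.
Proof.
have mI : @measurable _ (measurableTypeR R) `[-1, 1]%classic by exact: measurable_itv.
(* a primitive that vanishes at both ends, since [1 - s ^+ 2] does *)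
pose F s := ppow (a + 1) (1 - s ^+ 2) * sin (t * s + th).
pose f s := t * (jfun 0 th t s - jfun 2 th t s) + 2 * (a + 1) * jfun 1 (th + pi / 2) t s.
have a1 : 0 < a + 1 by rewrite addr_gt0.
have n11 : -1 < 1 :> R by lra.
have cF : continuous F.
  move=> s; apply: (@continuousM _ _ (fun s => ppow (a + 1) (1 - s ^+ 2))
    (fun s => sin (t * s + th))); first exact: continuous_weight.
  apply: (@continuous_comp _ _ _ (fun s => t * s + th) (@sin R)).
    exact: continuous_phase.
  exact: continuous_sin.
have cf : continuous f.
  move=> s; apply: (@continuousD _ _ _
    (fun s => t * (jfun 0 th t s - jfun 2 th t s))
    (fun s => 2 * (a + 1) * jfun 1 (th + pi / 2) t s)).
    apply: (@continuousM _ _ (fun=> t)); first exact: cst_continuous.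
    by apply: continuousB; exact: continuous_jfun.
  by apply: (@continuousM _ _ (fun=> 2 * (a + 1)));
    [exact: cst_continuous|exact: continuous_jfun].
have dF s : s \in `]-1, 1[ -> is_derive s 1 F (f s).
  rewrite in_itv/= -ltr_norml => s1.
  have ps : 0 < 1 - s ^+ 2 by rewrite subr_gt0 -real_normK ?num_real// exprn_ilt1.
  have ds2 : is_derive s 1 (fun s : R => 1 - s ^+ 2) (- (2 * s)).
    have d := is_derive_add (is_derive_const 1 s) (is_derive_mul
      (is_derive_const (-1) s) (is_derive_mul (is_derive_idfun s) (is_derive_idfun s))).
    rewrite (_ : (fun s : R => 1 - s ^+ 2) = (fun s => 1 + (-1) * (s * s))).
      by apply: (is_derive_eq d); ring.
    by apply/funext => s'; rewrite mulN1r expr2.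
  have dph : is_derive s 1 (fun s => t * s + th) t.
    have d := is_derive_add (is_derive_mul (is_derive_const t s) (is_derive_idfun s))
      (is_derive_const th s).
    by apply: (is_derive_eq d); ring.
  have d := is_derive_mul (is_derive_chain (g := fun s => 1 - s ^+ 2)
    (is_derive_ppow (a + 1) ps) ds2)
    (is_derive_chain (g := fun s => t * s + th)
    (is_derive_sin (t * s + th)) dph).
  apply: (is_derive_eq d).
  rewrite /f /jfun !(ppowE _ (ltW ps)) addrA cos_add_pihalf addrK.
  by rewrite -(mulr_powRB1 (ltW ps) a1) addrK; ring.
have FTC : (\int[leb]_(s in `[(-1)%R, 1%R]) (f s)%:E = (F 1)%:E - (F (-1))%:E)%E.
  apply: (continuous_FTC2 n11).
  - exact: continuous_subspaceT.
  - split.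
    + by move=> s /dF ds; exact: (@ex_derive _ _ _ _ _ _ _ ds).
    + exact: (cvg_at_right_filter (cF (-1))).
    + exact: (cvg_at_left_filter (cF 1)).
  - by move=> s /dF ds; rewrite derive1E; exact: (@derive_val _ _ _ _ _ _ _ ds).
have F1 : F 1 = 0 by rewrite /F expr1n subrr /ppow maxxx powR0 ?gt_eqF// mul0r.
have FN1 : F (-1) = 0 by rewrite /F sqrrN expr1n subrr /ppow maxxx powR0 ?gt_eqF// mul0r.
have I0 : (\int[leb]_(s in `[-1, 1]) f s)%R = 0.
  by rewrite /Rintegral FTC F1 FN1 subee.
have i0 j th' c : leb.-integrable `[-1, 1] (EFin \o (fun s => c * jfun j th' t s)).
  apply: integrable_continuous => s.
  by apply: (@continuousM _ _ (fun=> c)); [exact: cst_continuous|exact: continuous_jfun].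
have i1 : leb.-integrable `[-1, 1]
    (EFin \o (fun s => t * jfun 0 th t s - t * jfun 2 th t s)).
  apply: integrable_continuous => s.
  apply: (@continuousB _ _ _ (fun s => t * jfun 0 th t s) (fun s => t * jfun 2 th t s)).
    by apply: (@continuousM _ _ (fun=> t)); [exact: cst_continuous|exact: continuous_jfun].
  by apply: (@continuousM _ _ (fun=> t)); [exact: cst_continuous|exact: continuous_jfun].
transitivity (\int[leb]_(s in `[-1, 1]) f s)%R; last exact: I0.
rewrite (_ : f = fun s => (t * jfun 0 th t s - t * jfun 2 th t s) +
    2 * (a + 1) * jfun 1 (th + pi / 2) t s); last first.
  by apply/funext => s; rewrite /f mulrBr.
rewrite (RintegralD mI i1 (i0 _ _ _)) (RintegralB mI (i0 _ _ _) (i0 _ _ _)).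
by rewrite !(RintegralZl _ mI (integrable_jfun _ _ _)) /jint mulrBr.
Qed.

End oscillatory_integral.

(** * Decay of Bessel functions *)

Section decay.
Context {R : realType}.
Implicit Types (t m : R).

(** The energy [u ^+ 2 + x ^+ 2], where [u = y + m * x / t], satisfies
    [E' = - 2 * m / t * E + 2 * m * (m - 1) / t ^+ 2 * u * x]: it decays like
    [t `^ (- 2 * m)], up to the integrable perturbation coming from the last
    term, which the factor [expR (m * (m - 1) / t)] absorbs. *)
Lemma bessel_energy_decay m (x y z : R -> R) : 1 <= m ->
  (forall t, is_derive t 1 x (y t)) -> (forall t, is_derive t 1 y (z t)) ->
  (forall t, t * (x t + z t) + 2 * m * y t = 0) ->
  exists2 C, 0 <= C & forall t, 1 <= t -> `|x t| <= C * t `^ (- m).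
Proof.
move=> m1 dx dy ode.
have mm0 : 0 <= m * (m - 1) by apply: mulr_ge0; lra.
pose u t := y t + m * (x t * t^-1).
pose E t := u t * u t + x t * x t.
pose G t := 2 * m * ln t + m * (m - 1) * t^-1.
pose H t := expR (G t) * E t.
pose u' t := z t + m * (y t * t^-1 + x t * - t ^- 2).
pose E' t := (u' t * u t + u t * u' t) + (y t * x t + x t * y t).
pose G' t := 2 * m * t^-1 + m * (m - 1) * - t ^- 2.
pose H' t := (expR (G t) * G' t) * E t + expR (G t) * E' t.
have dH t : 0 < t -> is_derive t 1 H (H' t).
  move=> t0; have tn0 : t != 0 by rewrite gt_eqF.
  have dv := is_derive_inv tn0.
  have du : is_derive t 1 u (u' t).
    have d := is_derive_add (dy t) (is_derive_mul (is_derive_const m t)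
      (is_derive_mul (dx t) dv)).
    by apply: (is_derive_eq d); rewrite /u' mul0r add0r.
  have dE : is_derive t 1 E (E' t).
    exact: is_derive_add (is_derive_mul du du) (is_derive_mul (dx t) (dx t)).
  have dG : is_derive t 1 G (G' t).
    have d := is_derive_add
      (is_derive_mul (is_derive_const (2 * m) t) (is_derive1_ln t0))
      (is_derive_mul (is_derive_const (m * (m - 1)) t) dv).
    by apply: (is_derive_eq d); rewrite /G' !mul0r !add0r.
  exact: is_derive_mul (is_derive_chain (is_derive_expR (G t)) dG) dE.
have H'_le0 t : 0 < t -> H' t <= 0.
  move=> t0; have tn0 : t != 0 by rewrite gt_eqF.
  rewrite /H' -mulrA -mulrDr; apply: mulr_ge0_le0; first exact: expR_ge0.
  have zE : z t = - x t - 2 * m * y t * t^-1.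
    apply: (mulfI tn0); have := ode t.
    rewrite (_ : t * (- x t - 2 * m * y t * t^-1) = - (t * x t) - 2 * m * y t * (t * t^-1)); last by ring.
    by rewrite mulfV//; lra.
  have -> : G' t * E t + E' t = - (m * (m - 1) * t ^- 2 * (u t - x t) ^+ 2).
    rewrite /G' /E' /u' /E zE /u -exprVn.
    by move: (t^-1) (x t) (y t) => v p q; ring.
  rewrite oppr_le0; apply: mulr_ge0; last exact: sqr_ge0.
  by apply: mulr_ge0 => //; rewrite invr_ge0 sqr_ge0.
have Hle t : 1 <= t -> H t <= H 1.
  move=> t1.
  have cH : {within `[1, t], continuous H}.
    apply: derivable_within_continuous => s; rewrite in_itv/= => /andP[s1 _].
    exact: (@ex_derive _ _ _ _ _ _ _ (dH s (lt_le_trans ltr01 s1))).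
  have [|c] := MVT_segment t1 _ cH (df := H').
    by move=> s; rewrite in_itv/= => /andP[s1 _]; apply: dH; exact: lt_trans s1.
  rewrite in_itv/= => /andP[c1 _] e.
  rewrite -subr_le0 e; apply: mulr_le0_ge0; last by rewrite subr_ge0.
  by apply: H'_le0; exact: lt_le_trans c1.
exists (Num.sqrt (H 1)) => [|t t1]; first exact: sqrtr_ge0.
have t0 : 0 < t by exact: lt_le_trans t1.
have tm0 : 0 < t `^ m by exact: powR_gt0.
rewrite powRN ler_pdivlMr// -[leLHS]ger0_norm ?mulr_ge0 ?powR_ge0//.
rewrite -sqrtr_sqr ler_wsqrtr// (le_trans _ (Hle t t1))//.
have -> : (`|x t| * t `^ m) ^+ 2 = expR (2 * m * ln t) * x t ^+ 2.
  rewrite exprMn real_normK ?num_real// mulrC; congr (_ * _).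
  by rewrite /powR gt_eqF// -expRM_natl; congr expR; ring.
rewrite /H; apply: ler_pM; rewrite ?expR_ge0 ?sqr_ge0//.
  by rewrite ler_expR /G lerDl mulr_ge0// invr_ge0 ltW.
by rewrite /E expr2 lerDr -expr2 sqr_ge0.
Qed.

Lemma jint_decay (a th : R) : 0 < a -> exists2 C, 0 < C &
  forall t, 0 < t -> `|jint a 0 th t| <= C /\ `|jint a 0 th t| <= C * t `^ (- (a + 1)).
Proof.
move=> a0; have m1 : 1 <= a + 1 by lra.
have [|||C C0 HC] := @bessel_energy_decay (a + 1) (jint a 0 th) (jint a 1 (th + pi / 2))
  (jint a 2 (th + pi / 2 + pi / 2)) m1.
- by move=> t; exact: is_derive_jint.
- by move=> t; exact: is_derive_jint.
- by move=> t; rewrite jint_pi//; exact: jint_ode.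
exists (C + 2) => [|t t0]; first lra.
have b2 := jint_bound a0 0 th t.
split; first lra.
have pw : 0 < t `^ (- (a + 1)) by exact: powR_gt0.
have [t1|/ltW t1] := leP 1 t.
  apply: (le_trans (HC t t1)); apply: ler_wpM2r; [exact: ltW|lra].
have p1 : 1 <= t `^ (- (a + 1)).
  rewrite -[leLHS](powRr0 t); apply: ger_powR; first by rewrite t0.
  by rewrite oppr_le0; lra.
apply: (le_trans b2); rewrite -[leLHS]mulr1.
by apply: ler_pM => //; lra.
Qed.

End decay.

(** * The Bochner-Riesz kernel *)

Section profile.
Context {R : realType} (n : nat).
Implicit Types (delta rho : R).
Local Notation leb := (@lebesgue_measure R).

(** The real and imaginary parts of the kernel are the values of this function at
    the phases 0 and [- (pi / 2)], as [sin t = cos (t - pi / 2)]. *)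
Definition br_profile delta th rho : R :=
  pi `^ (- delta) * Gamma (delta + 1) * rho `^ (- (n%:R / 2 + delta)) *
  ((2 * pi * rho / 2) `^ (n%:R / 2 + delta) /
    (Gamma (n%:R / 2 + delta + 2^-1) * Gamma 2^-1)) *
  jint (n%:R / 2 + delta - 2^-1) 0 th (2 * pi * rho).

Lemma br_phi_profile delta (x : 'rV[R]_n) :
  br_phi delta x =
  (br_profile delta 0 (enorm x) +i* br_profile delta (- (pi / 2)) (enorm x))%C.
Proof.
rewrite /br_phi /besselJ mulrA -rmorphM /=.
have nn s : s \in `[(-1)%R, 1%R]%classic -> 0 <= 1 - s ^+ 2 :> R.
  rewrite inE/= in_itv/= -ler_norml => s1.
  by rewrite subr_ge0 -real_normK ?num_real//; apply: exprn_ile1.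
set t := 2 * pi * enorm x; set a := n%:R / 2 + delta - 2^-1.
have -> : integralC leb `[-1, 1]%classic
    (fun s => cis (t * s) * ((1 - s ^+ 2) `^ a)%:C%C) =
    (jint a 0 0 t +i* jint a 0 (- (pi / 2)) t)%C.
  rewrite /integralC /jint; congr (_ +i* _)%C; apply: eq_Rintegral => s /nn s1.
    by rewrite /cis/= mulr0 subr0 addr0 expr0 mul1r ppowE.
  rewrite /cis/= mulr0 add0r expr0 mul1r ppowE//; congr (_ * _).
  by rewrite cosB cos_pihalf sin_pihalf mulr0 mulr1 add0r.
rewrite /br_profile -/t -/a; apply/eqP; rewrite eq_complex/= !mul0r subr0 addr0.
by rewrite !eqxx.
Qed.

(** The powers of [rho] in the kernel and in the Bessel function cancel. At 0 the
    profile vanishes, by the convention on powers of 0. *)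
Lemma br_profile_bound delta th : 0 < n%:R / 2 + delta - 2^-1 ->
  exists2 K, 0 < K & forall rho, 0 <= rho -> `|br_profile delta th rho| <= K /\
    `|br_profile delta th rho| <= K * rho `^ (- (n%:R / 2 + delta + 2^-1)).
Proof.
move=> a0; have [C C0 HC] := jint_decay th a0.
set m := n%:R / 2 + delta in a0 *.
have m0 : 0 < m by lra.
pose A : R := `|pi `^ (- delta) * Gamma (delta + 1) * (pi `^ m /
  (Gamma (m + 2^-1) * Gamma 2^-1))|.
have pi0 : 0 < pi :> R by exact: pi_gt0.
have q1 : 0 <= (2 * pi : R) `^ (- (m + 2^-1)) by exact: powR_ge0.
exists (A * C * (1 + (2 * pi) `^ (- (m + 2^-1))) + 1) => [|rho].
  by rewrite ltr_wpDl// !mulr_ge0// ?normr_ge0 ?(ltW C0)//; lra.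
rewrite le_eqVlt => /predU1P[<-|r0].
  have -> : br_profile delta th 0 = 0.
    by rewrite /br_profile -/m powR0 ?oppr_eq0 ?gt_eqF// mulr0 !mul0r.
  have K0 : 0 <= A * C * (1 + (2 * pi) `^ (- (m + 2^-1))) + 1.
    by rewrite addr_ge0// !mulr_ge0// ?normr_ge0 ?(ltW C0)//; lra.
  by rewrite normr0 mulr_ge0// powR_ge0.
have -> : br_profile delta th rho =
    (pi `^ (- delta) * Gamma (delta + 1) * (pi `^ m / (Gamma (m + 2^-1) * Gamma 2^-1))) *
    jint (m - 2^-1) 0 th (2 * pi * rho).
  rewrite /br_profile -/m (_ : 2 * pi * rho / 2 = pi * rho); last by field.
  have -> : (pi * rho) `^ m = pi `^ m * rho `^ m by rewrite powRM ?ltW.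
  have e : rho `^ (- m) * rho `^ m = 1.
    by rewrite powRN mulVf// gt_eqF// powR_gt0.
  congr (_ * _).
  move: (_ `^ m) (rho `^ (- m)) (rho `^ m) e (Gamma _) (Gamma _) => P u v e G1 G2.
  rewrite -[RHS]mulr1 -e; ring.
have t0 : 0 < 2 * pi * rho by rewrite !mulr_gt0.
have [b1 b2] := HC _ t0.
rewrite normrM -/A; split.
  apply: (@le_trans _ _ (A * C)).
    by apply: ler_wpM2l => //; exact: normr_ge0.
  have : 0 <= A * C * (2 * pi) `^ (- (m + 2^-1)).
    by rewrite !mulr_ge0// ?normr_ge0 ?(ltW C0).
  by rewrite (mulrDr (A * C)) mulr1; lra.
apply: (@le_trans _ _ (A * (C * (2 * pi * rho) `^ (- (m + 2^-1))))).
  apply: ler_wpM2l; first exact: normr_ge0.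
  by move: b2; rewrite (_ : m - 2^-1 + 1 = m + 2^-1)//; lra.
rewrite powRM ?mulr_ge0 ?(ltW r0) ?(ltW pi0)//.
rewrite !mulrA; apply: ler_wpM2r; first exact: powR_ge0.
have : 0 <= A * C by rewrite mulr_ge0 ?normr_ge0 ?(ltW C0).
by rewrite (mulrDr (A * C)) mulr1; lra.
Qed.

Lemma measurable_br_profile delta th : 0 < n%:R / 2 + delta - 2^-1 ->
  measurable_fun [set: R] (br_profile delta th).
Proof.
move=> a0.
have cj : continuous (jint (n%:R / 2 + delta - 2^-1) 0 th).
  move=> t; apply: differentiable_continuous; apply/derivable1_diffP.
  exact: (@ex_derive _ _ _ _ _ _ _ (is_derive_jint a0 0 th t)).
have ml (c : R) : measurable_fun setT (fun t : R => c * t).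
  exact: mulrl_measurable.
apply: measurable_funM; last first.
  by apply: (measurableT_comp (continuous_measurable_fun cj)); exact: ml.
apply: measurable_funM.
  by apply: measurable_funM => //; exact: measurable_powR.
apply: measurable_funM => //.
apply: (@measurableT_comp _ _ _ _ _ _ (fun u : R => u `^ (n%:R / 2 + delta)) _
  (fun rho : R => 2 * pi * rho / 2)); first exact: measurable_powR.
by apply: measurable_funM => //; exact: ml.
Qed.

End profile.

(** * Radially decreasing kernels and averages *)

Section shells.
Context d (T : measurableType d) (R : realType) (mu : {measure set T -> \bar R}).

(** The function [g] is dominated by the constants [c j] on the sets [Q j],
    which exhaust the space; so its integral against [F] is at most the series
    of the integrals of [F] over the [Q j] weighted by the [c j]. *)
Lemma integral_shells_le (Q : nat -> set T) (c : nat -> R) (g F : T -> R) (D x : R) :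
  (forall j, measurable (Q j)) -> (forall j, 0 <= c j) ->
  measurable_fun [set: T] g -> measurable_fun [set: T] F ->
  (forall y, 0 <= g y) -> (forall y, 0 <= F y) ->
  (forall y, exists2 j, Q j y & g y <= c j) ->
  0 <= x < 1 -> 0 <= D ->
  (forall j, ((c j)%:E * \int[mu]_(y in Q j) (F y)%:E <= (D * x ^+ j)%:E)%E) ->
  (\int[mu]_y (g y * F y)%:E <= (D / (1 - x))%:E)%E.
Proof.
move=> mQ c0 mg mF g0 F0 gc x01 D0 cD.
pose v j y := (c j * (\1_(Q j) y * F y))%:E.
have v0 j y : (0 <= v j y)%E.
  by rewrite lee_fin; apply: mulr_ge0 => //; apply: mulr_ge0.
have m1 j : measurable_fun setT (fun y => (\1_(Q j) y * F y : R)).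
  by apply: measurable_funM => //; exact: measurable_indic.
have mv j : measurable_fun setT (v j).
  by apply/measurable_EFinP; apply: measurable_funM.
apply: (@le_trans _ _ (\int[mu]_y (\sum_(j <oo) v j y))%E).
  apply: ge0_le_integral => //.
  - by move=> y _; rewrite lee_fin mulr_ge0.
  - by apply/measurable_EFinP; exact: measurable_funM.
  - by apply: ge0_emeasurable_sum => // m y _ _; exact: v0.
  move=> y _; have [j Qj gj] := gc y.
  apply: (@le_trans _ _ (v j y)).
    by rewrite /v indicE mem_set// mul1r lee_fin ler_wpM2r.
  have := @nneseries_lim_ge R (v ^~ y) xpredT 0%N j.+1.
  rewrite big_nat_recr//= => /(_ (fun _ _ _ => v0 _ _)); apply: le_trans.
  by rewrite leeDr// sume_ge0.
rewrite integral_nneseries//.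
apply: (@le_trans _ _ (\sum_(j <oo) (D%:E * (x ^+ j)%:E))%E).
  apply: lee_nneseries => [j _ _|j _]; first by apply: integral_ge0.
  apply: le_trans (cD j).
  rewrite le_eqVlt; apply/orP; left; apply/eqP.
  rewrite /v; under eq_integral do rewrite EFinM.
  rewrite ge0_integralZl_EFin//; last 2 first.
  - by move=> y _; rewrite lee_fin mulr_ge0.
  - by apply/measurable_EFinP; exact: m1.
  congr (_ * _)%E; rewrite [RHS]integral_mkcond; apply: eq_integral => y _.
  by rewrite patchE indicE; case: ifPn => _; rewrite ?mul1r ?mul0r.
have [x0 x1] := andP x01.
rewrite nneseriesZl; last by move=> j _; rewrite lee_fin exprn_ge0.
apply: (le_trans (lee_wpmul2l _ (nneseries_geometric_le x01))).
  by rewrite lee_fin.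
by rewrite -EFinM.
Qed.

Lemma measurable_dilation (k : R -> R) (u : T -> R) (c r : R) :
  measurable_fun [set: R] k -> measurable_fun [set: T] u ->
  measurable_fun [set: T] (fun y => c * k (r * u y)).
Proof.
move=> mk mu'; apply: measurable_funM => //.
apply: (@measurableT_comp _ _ _ _ _ _ k _ (fun y => r * u y)) => //.
exact: measurable_funM.
Qed.

End shells.

Section radial_kernel.
Context {R : realType} {n : nat}.
Local Notation T := (Rn R n).
Local Notation mu := (@lebesgue_Rn R n).
Implicit Types (k : R -> R) (F : 'rV[R]_n -> R) (x y : 'rV[R]_n) (r p K : R).

Definition dilated k r x y : R := r ^+ n * k (r * enorm (x - y)).

Lemma measurable_dilated k r x : measurable_fun [set: R] k ->
  measurable_fun [set: T] (dilated k r x : T -> R).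
Proof.
move=> mk; exact: (measurable_dilation _ _ mk (measurable_enormB x)).
Qed.

Lemma cube_dyadic x r y : 0 < r ->
  exists2 j : nat, cube x (2 ^+ j / r) y & (j = 0)%N \/ 2 ^+ j / 2 <= r * enorm (x - y).
Proof.
move=> r0.
have ex : exists j, `[< cube x (2 ^+ j / r) y >].
  exists (Num.truncn (r * enorm (y - x))).+1; apply/asboolP => i.
  have := coord_le_enorm (y - x) i; rewrite !mxE => /le_lt_trans; apply.
  rewrite ltr_pdivlMr// mulrC; apply: (lt_le_trans (truncnS_gt _)).
  by rewrite -natrX ler_nat ltnW// ltn_expl.
have [j /asboolP jP jmin] := ex_minnP ex.
exists j => //; case: j jP jmin => [|j] jP jmin; [by left|right].
rewrite exprSr mulfK// leNgt; apply/negP => small.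
suff : (j.+1 <= j)%N by rewrite ltnn.
apply: jmin; apply/asboolP => i.
have := coord_le_enorm (x - y) i; rewrite !mxE distrC => /le_lt_trans; apply.
by rewrite ltr_pdivlMr// mulrC.
Qed.

(** A radial kernel decaying faster than [|x| `^ (- n)] is dominated by a
    geometric sum of normalized indicators of dyadic cubes. *)
Lemma dilated_le_average k p K : (n%:R < p) -> 0 < K -> measurable_fun [set: R] k ->
  (forall rho, 0 <= rho -> `|k rho| <= K /\ `|k rho| <= K * rho `^ (- p)) ->
  exists2 C, 0 < C & forall x r F, 0 < r -> measurable_fun [set: T] (F : T -> R) ->
  (forall y, 0 <= F y) ->
  (forall rho, 0 < rho -> (\int[mu]_(y in cube x rho) (F y)%:E <= ((2 * rho) ^+ n)%:E)%E) ->
  (\int[mu]_y (`|dilated k r x y| * F y)%:E <= C%:E)%E.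
Proof.
move=> np K0 mk kK.
have p0 : 0 < p by apply: le_lt_trans np.
pose q := 2 `^ (- p) : R.
have q0 : 0 < q by exact: powR_gt0.
have qj (j : nat) : (2 ^+ j) `^ (- p) = q ^+ j.
  rewrite /q -(powR_mulrn j (powR_ge0 2 (- p))) -(powR_mulrn j (ler0n R 2)).
  by rewrite -!powRrM mulrC.
pose z := q * 2 ^+ n.
have z0 : 0 < z by rewrite mulr_gt0// exprn_gt0.
have z1 : z < 1.
  rewrite /z /q powRN mulrC ltr_pdivrMr ?powR_gt0// mul1r -powR_mulrn//.
  rewrite /powR gt_eqF// ltr_expR ltr_pM2r//.
  by apply: ln_gt0; lra.
pose K' := K * 2 `^ p.
have p1 : 1 <= 2 `^ p :> R.
  by rewrite -[leLHS](powRr0 2); apply: ler_powR; [lra|exact: ltW].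
have K'0 : 0 < K' by rewrite mulr_gt0// powR_gt0.
exists (K' * 2 ^+ n / (1 - z)) => [|x r F r0 mF F0 avg].
  by rewrite divr_gt0 ?mulr_gt0 ?exprn_gt0 ?subr_gt0.
have rn : 0 < r ^+ n by rewrite exprn_gt0.
apply: (@integral_shells_le _ T R mu (fun j => cube x (2 ^+ j / r))
  (fun j => K' * r ^+ n * q ^+ j) (fun y => `|dilated k r x y|) F (K' * 2 ^+ n) z).
- by move=> j; exact: measurable_cube.
- by move=> j; rewrite !mulr_ge0 ?exprn_ge0 ?(ltW q0) ?(ltW K'0)// ltW.
- exact: (measurableT_comp (@normr_measurable _ _) (measurable_dilated r x mk)).
- exact: mF.
- by move=> y; exact: normr_ge0.
- exact: F0.
- move=> y; have [j jy hj] := cube_dyadic x y r0; exists j; first exact: jy.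
  have [k1 k2] := kK (r * enorm (x - y)) (mulr_ge0 (ltW r0) (enorm_ge0 _)).
  rewrite /dilated normrM (gtr0_norm rn) (mulrC K') -mulrA; apply: ler_wpM2l; first exact: ltW.
  case: hj => [->|big].
    by rewrite expr0 mulr1 (le_trans k1)// /K' ler_peMr// ltW.
  apply: (le_trans k2); rewrite /K' -mulrA; apply: ler_wpM2l; first exact: ltW.
  have b0 : 0 < 2 ^+ j / 2 :> R by rewrite divr_gt0// exprn_gt0.
  apply: (@le_trans _ _ ((2 ^+ j / 2) `^ (- p))).
    rewrite !powRN lef_pV2 ?posrE ?powR_gt0//; last exact: lt_le_trans big.
    apply: ge0_ler_powR; rewrite ?nnegrE ?(ltW p0) ?(ltW b0)//.
    exact: le_trans (ltW b0) big.
  rewrite powRM ?exprn_ge0// ?invr_ge0// mulrC; apply: ler_pM; rewrite ?powR_ge0//.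
    by rewrite -powR_inv1// -powRrM mulrN mulN1r opprK.
  by rewrite qj.
- by rewrite (ltW z0) z1.
- by rewrite mulr_ge0 ?exprn_ge0// ltW.
move=> j; have s0 : 0 < 2 ^+ j / r by rewrite divr_gt0// exprn_gt0.
apply: (le_trans (lee_wpmul2l _ (avg _ s0))).
  by rewrite lee_fin !mulr_ge0 ?exprn_ge0 ?(ltW q0) ?(ltW K'0)// ltW.
rewrite -EFinM lee_fin le_eqVlt; apply/orP; left; apply/eqP.
have e2 : (2 ^+ n) ^+ j = (2 ^+ j) ^+ n :> R by rewrite -!exprM mulnC.
rewrite /z !exprMn exprVn e2.
have e : r ^+ n * (r ^+ n)^-1 = 1 by rewrite mulfV// gt_eqF.
by move: (r ^+ n) ((r ^+ n)^-1) (q ^+ j) e ((2 ^+ j) ^+ n) (2 ^+ n) => u v w e s t; ring: e.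
Qed.

End radial_kernel.

(** * Commutators as integrals *)

Section complex_modulus.
Context {R : realType}.
Implicit Types z : R[i].

Definition l1norm z : R := `|complex.Re z| + `|complex.Im z|.

Lemma l1norm_ge0 z : 0 <= l1norm z.
Proof. by rewrite addr_ge0. Qed.

Lemma modulus_ge0 z : 0 <= modulus z.
Proof. by case: z => a b; exact: sqrtr_ge0. Qed.

Lemma modulus_le_l1norm z : modulus z <= l1norm z.
Proof.
case: z => a b; rewrite /modulus /l1norm /=.
rewrite -[leRHS]ger0_norm ?addr_ge0// -sqrtr_sqr ler_wsqrtr//.
rewrite sqrrD !real_normK ?num_real// lerD2r lerDl mulrn_wge0//.
Qed.

Lemma Re_le_modulus z : `|complex.Re z| <= modulus z.
Proof.
by case: z => a b; rewrite /modulus /= -sqrtr_sqr ler_wsqrtr// lerDl sqr_ge0.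
Qed.

Lemma Im_le_modulus z : `|complex.Im z| <= modulus z.
Proof.
by case: z => a b; rewrite /modulus /= -sqrtr_sqr ler_wsqrtr// lerDr sqr_ge0.
Qed.

Lemma modulusM z z' : modulus (z * z') = modulus z * modulus z'.
Proof. exact: Normc.normcM. Qed.

Lemma ReB z z' : complex.Re (z - z') = complex.Re z - complex.Re z'.
Proof. by case: z z' => [? ?] []. Qed.

Lemma ImB z z' : complex.Im (z - z') = complex.Im z - complex.Im z'.
Proof. by case: z z' => [? ?] []. Qed.

Lemma ReM z z' : complex.Re (z * z') =
  complex.Re z * complex.Re z' - complex.Im z * complex.Im z'.
Proof. by case: z z' => [? ?] []. Qed.

Lemma ImM z z' : complex.Im (z * z') =
  complex.Re z * complex.Im z' + complex.Im z * complex.Re z'.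
Proof. by case: z z' => [? ?] []. Qed.

End complex_modulus.

Section complex_integral.
Context d (T : measurableType d) (R : realType) (mu : {measure set T -> \bar R}).
Implicit Types (f k b : T -> R[i]).

Definition measurable_complex f : Prop :=
  measurable_fun setT (fun y => complex.Re (f y)) /\
  measurable_fun setT (fun y => complex.Im (f y)).

Lemma measurable_complexM f k : measurable_complex f -> measurable_complex k ->
  measurable_complex (fun y => f y * k y).
Proof.
move=> [f1 f2] [k1 k2]; split.
- under eq_fun do rewrite ReM.
  by apply: measurable_funB; exact: measurable_funM.
- under eq_fun do rewrite ImM.
  by apply: measurable_funD; exact: measurable_funM.
Qed.

Lemma measurable_modulus f : measurable_complex f ->
  measurable_fun setT (fun y => modulus (f y)).
Proof.
move=> [f1 f2].
rewrite (_ : (fun y => _) =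
  (fun y => Num.sqrt (complex.Re (f y) ^+ 2 + complex.Im (f y) ^+ 2))); last first.
  by apply/funext => y; case: (f y).
apply: (measurableT_comp (@measurable_sqrt R)).
by apply: measurable_funD; exact: measurable_funX.
Qed.

Lemma measurable_l1norm f : measurable_complex f ->
  measurable_fun setT (fun y => l1norm (f y)).
Proof.
by move=> [f1 f2]; apply: measurable_funD; exact: measurableT_comp.
Qed.

Let integrable_dominated (f g : T -> R) (M : R) :
  measurable_fun setT f -> measurable_fun setT g -> (forall y, `|f y| <= g y) ->
  (\int[mu]_y (g y)%:E <= M%:E)%E -> mu.-integrable setT (EFin \o f).
Proof.
move=> mf mg fg gM; apply/integrableP; split; first exact/measurable_EFinP.
apply: (@le_lt_trans _ _ (\int[mu]_y (g y)%:E)%E); last exact: le_lt_trans gM (ltry _).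
apply: ge0_le_integral => //.
- by apply/measurable_EFinP; exact: measurableT_comp.
- exact/measurable_EFinP.
- by move=> y _; rewrite /= lee_fin.
Qed.

Let Rintegral_dominated (f g : T -> R) (M : R) :
  measurable_fun setT f -> measurable_fun setT g -> (forall y, `|f y| <= g y) ->
  (\int[mu]_y (g y)%:E <= M%:E)%E -> `|\int[mu]_y f y| <= M.
Proof.
move=> mf mg fg gM; have If := integrable_dominated mf mg fg gM.
apply: (le_trans (le_normr_Rintegral measurableT If)).
rewrite -lee_fin; apply: le_trans gM.
rewrite /Rintegral fineK; last first.
  by apply: integrable_fin_num => //; exact: integrable_norm.
apply: ge0_le_integral => //.
- by apply/measurable_EFinP; exact: measurableT_comp.
- exact/measurable_EFinP.
- by move=> y _; rewrite lee_fin.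
Qed.

(** The commutator with [b], seen from a point where [b] takes the value
    [beta], is the integral of [k * (beta - b) * f], and this holds as soon as
    [k * f] and [k * (beta - b) * f] are integrable: the integrability of
    [k * b * f] follows. *)
Lemma commutator_modulus_le k b f (beta : R[i]) (M1 M2 : R) :
  measurable_complex k -> measurable_complex b -> measurable_complex f ->
  (\int[mu]_y (l1norm (k y) * modulus (f y))%:E <= M1%:E)%E ->
  (\int[mu]_y (l1norm (k y) * (l1norm (beta - b y) * modulus (f y)))%:E <= M2%:E)%E ->
  modulus (beta * integralC mu setT (fun y => k y * f y) -
           integralC mu setT (fun y => k y * (b y * f y))) <= 2 * M2.
Proof.
move=> mk mb mf H1 H2.
pose g1 y := k y * f y; pose g3 y := k y * ((beta - b y) * f y).
have mbb : measurable_complex (fun y => beta - b y).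
  case: mb => b1 b2; split.
  - by under eq_fun do rewrite ReB; exact: measurable_funB.
  - by under eq_fun do rewrite ImB; exact: measurable_funB.
have [m1r m1i] := measurable_complexM mk mf.
have [m3r m3i] := measurable_complexM mk (measurable_complexM mbb mf).
have kf (z z' : R[i]) : modulus (z * z') <= l1norm z * modulus z'.
  by rewrite modulusM ler_wpM2r ?modulus_ge0// modulus_le_l1norm.
have kfr z z' := le_trans (Re_le_modulus (z * z')) (kf z z').
have kfi z z' := le_trans (Im_le_modulus (z * z')) (kf z z').
have mg1 : measurable_fun setT (fun y => l1norm (k y) * modulus (f y)).
  by apply: measurable_funM; [exact: measurable_l1norm|exact: measurable_modulus].
have mg3 : measurable_fun setT
    (fun y => l1norm (k y) * (l1norm (beta - b y) * modulus (f y))).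
  apply: measurable_funM; first exact: measurable_l1norm.
  by apply: measurable_funM; [exact: measurable_l1norm|exact: measurable_modulus].
have kbf y : l1norm (k y) * modulus ((beta - b y) * f y) <=
    l1norm (k y) * (l1norm (beta - b y) * modulus (f y)).
  apply: ler_wpM2l; first exact: l1norm_ge0.
  by rewrite modulusM ler_wpM2r ?modulus_ge0// modulus_le_l1norm.
have I1r := integrable_dominated m1r mg1 (fun y => kfr _ _) H1.
have I1i := integrable_dominated m1i mg1 (fun y => kfi _ _) H1.
have d3r y := le_trans (kfr (k y) ((beta - b y) * f y)) (kbf y).
have d3i y := le_trans (kfi (k y) ((beta - b y) * f y)) (kbf y).
have I3r := integrable_dominated m3r mg3 d3r H2.
have I3i := integrable_dominated m3i mg3 d3i H2.
have IZ (c : R) (h : T -> R) : mu.-integrable setT (EFin \o h) ->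
    mu.-integrable setT (EFin \o (fun y => c * h y)).
  move=> Ih; apply: (eq_integrable measurableT _ _ _ (integrableZl measurableT c Ih)).
  by move=> y _; rewrite /= ?EFinM ?EFinB ?EFinD.
have IB (h h' : T -> R) : mu.-integrable setT (EFin \o h) ->
    mu.-integrable setT (EFin \o h') -> mu.-integrable setT (EFin \o (fun y => h y - h' y)).
  move=> Ih Ih'; apply: (eq_integrable measurableT _ _ _ (integrableB measurableT Ih Ih')).
  by move=> y _; rewrite /= ?EFinM ?EFinB ?EFinD.
have ID (h h' : T -> R) : mu.-integrable setT (EFin \o h) ->
    mu.-integrable setT (EFin \o h') -> mu.-integrable setT (EFin \o (fun y => h y + h' y)).
  move=> Ih Ih'; apply: (eq_integrable measurableT _ _ _ (integrableD measurableT Ih Ih')).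
  by move=> y _; rewrite /= ?EFinM ?EFinB ?EFinD.
have -> : beta * integralC mu setT (fun y => k y * f y) -
    integralC mu setT (fun y => k y * (b y * f y)) = integralC mu setT g3.
  have er : \int[mu]_y complex.Re (k y * (b y * f y)) =
      complex.Re beta * \int[mu]_y complex.Re (g1 y) -
      complex.Im beta * \int[mu]_y complex.Im (g1 y) - \int[mu]_y complex.Re (g3 y).
    have e y : complex.Re (k y * (b y * f y)) = complex.Re beta * complex.Re (g1 y) -
        complex.Im beta * complex.Im (g1 y) - complex.Re (g3 y).
      rewrite -ReM /g1 /g3 (_ : k y * (b y * f y) =
        beta * (k y * f y) - k y * ((beta - b y) * f y)); last by ring.
      by rewrite ReB.
    under eq_Rintegral do rewrite e.
    rewrite (RintegralB measurableT (IB _ _ (IZ _ _ I1r) (IZ _ _ I1i)) I3r).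
    rewrite (RintegralB measurableT (IZ _ _ I1r) (IZ _ _ I1i)).
    by rewrite (RintegralZl _ measurableT I1r) (RintegralZl _ measurableT I1i).
  have ei : \int[mu]_y complex.Im (k y * (b y * f y)) =
      complex.Re beta * \int[mu]_y complex.Im (g1 y) +
      complex.Im beta * \int[mu]_y complex.Re (g1 y) - \int[mu]_y complex.Im (g3 y).
    have e y : complex.Im (k y * (b y * f y)) = complex.Re beta * complex.Im (g1 y) +
        complex.Im beta * complex.Re (g1 y) - complex.Im (g3 y).
      rewrite -ImM /g1 /g3 (_ : k y * (b y * f y) =
        beta * (k y * f y) - k y * ((beta - b y) * f y)); last by ring.
      by rewrite ImB.
    under eq_Rintegral do rewrite e.
    rewrite (RintegralB measurableT (ID _ _ (IZ _ _ I1i) (IZ _ _ I1r)) I3i).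
    rewrite (RintegralD measurableT (IZ _ _ I1i) (IZ _ _ I1r)).
    by rewrite (RintegralZl _ measurableT I1r) (RintegralZl _ measurableT I1i).
  rewrite /integralC er ei /g1 /g3.
  move: (\int[mu]_y complex.Re (k y * f y))%R => u.
  apply/eqP; rewrite eq_complex ReB ImB ReM ImM/=.
  by apply/andP; split; apply/eqP; ring.
apply: (le_trans (modulus_le_l1norm _)); rewrite /l1norm /=.
have := Rintegral_dominated m3r mg3 d3r H2.
have := Rintegral_dominated m3i mg3 d3i H2.
lra.
Qed.

End complex_integral.

(** * Pointwise control of the maximal commutator *)

Section integral_bounds.
Context d (T : measurableType d) (R : realType) (mu : {measure set T -> \bar R}).
Implicit Types (f g : T -> R) (M N : R).

Lemma le_integral_add f g M N :
  measurable_fun setT f -> measurable_fun setT g ->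
  (forall y, 0 <= f y) -> (forall y, 0 <= g y) ->
  (\int[mu]_y (f y)%:E <= M%:E)%E -> (\int[mu]_y (g y)%:E <= N%:E)%E ->
  (\int[mu]_y (f y + g y)%:E <= (M + N)%:E)%E.
Proof.
move=> mf mg f0 g0 fM gN.
under eq_integral do rewrite EFinD.
rewrite ge0_integralD//; last 4 first.
- by move=> y _; rewrite lee_fin.
- exact/measurable_EFinP.
- by move=> y _; rewrite lee_fin.
- exact/measurable_EFinP.
by rewrite EFinD; exact: leeD.
Qed.

Lemma le_integral_scale f M (s : R) : 0 <= s ->
  measurable_fun setT f -> (forall y, 0 <= f y) -> (\int[mu]_y (f y)%:E <= M%:E)%E ->
  (\int[mu]_y (s * f y)%:E <= (s * M)%:E)%E.
Proof.
move=> s0 mf f0 fM.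
under eq_integral do rewrite EFinM.
rewrite ge0_integralZl_EFin//; last 2 first.
- by move=> y _; rewrite lee_fin.
- exact/measurable_EFinP.
by rewrite EFinM; apply: lee_wpmul2l; rewrite ?lee_fin.
Qed.

Lemma integral_kernel_product_le f1 f2 g1 g2 (h : T -> R) (s M : R) : 0 <= s ->
  measurable_fun setT f1 -> measurable_fun setT f2 ->
  measurable_fun setT g1 -> measurable_fun setT g2 -> measurable_fun setT h ->
  (forall y, 0 <= f1 y) -> (forall y, 0 <= f2 y) ->
  (forall y, 0 <= g1 y) -> (forall y, 0 <= g2 y) -> (forall y, 0 <= h y) ->
  (\int[mu]_y (f1 y * (g1 y * h y))%:E <= M%:E)%E ->
  (\int[mu]_y (f1 y * (g2 y * h y))%:E <= M%:E)%E ->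
  (\int[mu]_y (f2 y * (g1 y * h y))%:E <= M%:E)%E ->
  (\int[mu]_y (f2 y * (g2 y * h y))%:E <= M%:E)%E ->
  (\int[mu]_y ((f1 y + f2 y) * ((g1 y + g2 y) * (s * h y)))%:E <= (s * (4 * M))%:E)%E.
Proof.
move=> s0 mf1 mf2 mg1 mg2 mh f10 f20 g10 g20 h0 H11 H12 H21 H22.
have m f g : measurable_fun setT f -> measurable_fun setT g ->
    measurable_fun setT (fun y => f y * (g y * h y)).
  by move=> mf mg; apply: measurable_funM => //; exact: measurable_funM.
have p f g : (forall y, 0 <= f y) -> (forall y, 0 <= g y) ->
    forall y, 0 <= f y * (g y * h y).
  by move=> f0 g0 y; rewrite !mulr_ge0.
have -> : (\int[mu]_y ((f1 y + f2 y) * ((g1 y + g2 y) * (s * h y)))%:E =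
  \int[mu]_y (s * ((f1 y * (g1 y * h y) + f1 y * (g2 y * h y)) +
       (f2 y * (g1 y * h y) + f2 y * (g2 y * h y))))%:E)%E.
  by apply: eq_integral => y _; congr EFin; ring.
rewrite (_ : 4 * M = (M + M) + (M + M)); last by ring.
have A1 := le_integral_add (m _ _ mf1 mg1) (m _ _ mf1 mg2)
  (p _ _ f10 g10) (p _ _ f10 g20) H11 H12.
have A2 := le_integral_add (m _ _ mf2 mg1) (m _ _ mf2 mg2)
  (p _ _ f20 g10) (p _ _ f20 g20) H21 H22.
apply: le_integral_scale => //.
- by do 2 apply: measurable_funD; exact: m.
- by move=> y; do 2 apply: addr_ge0; exact: p.
apply: le_integral_add A1 A2.
- by apply: measurable_funD; exact: m.
- by apply: measurable_funD; exact: m.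
- by move=> y; apply: addr_ge0; exact: p.
- by move=> y; apply: addr_ge0; exact: p.
Qed.

Lemma integral_kernel_sum_le f1 f2 (h : T -> R) (s M : R) : 0 <= s ->
  measurable_fun setT f1 -> measurable_fun setT f2 -> measurable_fun setT h ->
  (forall y, 0 <= f1 y) -> (forall y, 0 <= f2 y) -> (forall y, 0 <= h y) ->
  (\int[mu]_y (f1 y * h y)%:E <= M%:E)%E ->
  (\int[mu]_y (f2 y * h y)%:E <= M%:E)%E ->
  (\int[mu]_y ((f1 y + f2 y) * (s * h y))%:E <= (s * (M + M))%:E)%E.
Proof.
move=> s0 mf1 mf2 mh f10 f20 h0 H1 H2.
have -> : (\int[mu]_y ((f1 y + f2 y) * (s * h y))%:E =
  \int[mu]_y (s * (f1 y * h y + f2 y * h y))%:E)%E.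
  by apply: eq_integral => y _; congr EFin; ring.
apply: le_integral_scale => //.
- by apply: measurable_funD; exact: measurable_funM.
- by move=> y; rewrite addr_ge0 ?mulr_ge0.
- by apply: le_integral_add => //;
    [exact: measurable_funM|exact: measurable_funM|
     move=> y; rewrite mulr_ge0|move=> y; rewrite mulr_ge0].
Qed.

End integral_bounds.

Section pointwise.
Context {R : realType} {n : nat}.
Local Notation T := (Rn R n).
Local Notation mu := (@lebesgue_Rn R n).
Implicit Types (b f : 'rV[R]_n -> R[i]) (x y : 'rV[R]_n) (r delta sigma : R).

Lemma enormZ r x : 0 <= r -> enorm (r *: x) = r * enorm x.
Proof.
move=> r0; rewrite /enorm -[in RHS](ger0_norm r0) -sqrtr_sqr -sqrtrM ?sqr_ge0//.
by congr Num.sqrt; rewrite mulr_sumr; apply: eq_bigr => i _; rewrite mxE exprMn.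
Qed.

Lemma br_kernel_dilated delta r x y : 0 < r -> br_kernel delta r (x - y) =
  (dilated (br_profile n delta 0) r x y +i*
   dilated (br_profile n delta (- (pi / 2))) r x y)%C.
Proof.
move=> r0; rewrite /br_kernel br_phi_profile enormZ ?ltW//.
by apply/eqP; rewrite eq_complex/= !mul0r subr0 addr0 !eqxx.
Qed.

Lemma not_large_average (b h : 'rV[R]_n -> R) x r : 0 < r -> ~ large_average b h x ->
  (\int[mu]_(y in cube x r) (h y)%:E <= ((2 * r) ^+ n)%:E)%E /\
  (\int[mu]_(y in cube x r) (`|b x - b y| * h y)%:E <= ((2 * r) ^+ n)%:E)%E.
Proof.
move=> r0 nl; rewrite -(lebesgue_cube x r0); split; rewrite leNgt; apply/negP => lt.
- by apply: nl; exists r => //; left.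
- by apply: nl; exists r => //; right.
Qed.

(** Where the averages of [h] and of its products with the oscillations of the
    real and imaginary parts of [b] are all at most 1, the maximal commutator is
    controlled, the kernels being dominated by averages. *)
Lemma br_max_commutator_le delta : (0 < n)%N -> (n%:R - 1) / 2 < delta ->
  exists2 L, 0 < L & forall b f sigma x, 0 < sigma ->
  measurable_funC b -> measurable_funC f ->
  let h y := L * (modulus (f y) / sigma) in
  ~ large_average (fun y => complex.Re (b y)) h x ->
  ~ large_average (fun y => complex.Im (b y)) h x ->
  (`|br_max_commutator delta b f x| <= sigma%:E)%E.
Proof.
move=> n0 delta_gt.
have n1 : 1 <= n%:R :> R by rewrite ler1n.
have a0 : 0 < n%:R / 2 + delta - 2^-1 by lra.
have np : n%:R < n%:R / 2 + delta + 2^-1 by lra.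
have [K1 K10 HK1] := br_profile_bound 0 a0.
have [K2 K20 HK2] := br_profile_bound (- (pi / 2)) a0.
have mp1 := measurable_br_profile 0 a0.
have mp2 := measurable_br_profile (- (pi / 2)) a0.
have [C1 C10 avg1] := dilated_le_average np K10 mp1 HK1.
have [C2 C20 avg2] := dilated_le_average np K20 mp2 HK2.
(* 2 for the real and imaginary parts of the integral, 4 for those of the kernel
   and of [b] *)
pose L := 8 * (C1 + C2).
have L0 : 0 < L by rewrite /L; lra.
exists L => // b f sigma x s0 mb mf h nR nI.
have mh : measurable_fun [set: T] (h : T -> R).
  exact: (measurable_funM (measurable_cst L)
    (measurable_funM (measurable_modulus mf) (measurable_cst sigma^-1))).
have h0 y : 0 <= h y.
  exact: (mulr_ge0 (ltW L0) (divr_ge0 (modulus_ge0 _) (ltW s0))).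
have fh y : modulus (f y) = sigma / L * h y.
  by rewrite /h; field; rewrite !(gt_eqF L0, gt_eqF s0).
have m1 x' r := measurable_dilated r x' mp1.
have m2 x' r := measurable_dilated r x' mp2.
have [mbr mbi] := mb.
have mB (g : 'rV[R]_n -> R) : measurable_fun [set: T] (g : T -> R) ->
    measurable_fun [set: T] (fun y : T => `|g x - g y|).
  by move=> mg; apply: (measurableT_comp (@normr_measurable _ _)); exact: measurable_funB.
have mBh (g : 'rV[R]_n -> R) : measurable_fun [set: T] (g : T -> R) ->
    measurable_fun [set: T] (fun y : T => `|g x - g y| * h y).
  by move=> mg; apply: measurable_funM; [exact: mB|exact: mh].
have B0 (g : 'rV[R]_n -> R) y : 0 <= `|g x - g y| * h y.
  by rewrite mulr_ge0.
have comm r : 0 < r -> modulus (br_commutator delta b r f x) <= sigma.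
  move=> r0.
  pose f1 (y : T) := `|dilated (br_profile n delta 0) r x y|.
  pose f2 (y : T) := `|dilated (br_profile n delta (- (pi / 2))) r x y|.
  have mf1 : measurable_fun setT f1.
    exact: (measurableT_comp (@normr_measurable _ _) (m1 x r)).
  have mf2 : measurable_fun setT f2.
    exact: (measurableT_comp (@normr_measurable _ _) (m2 x r)).
  have f10 y : 0 <= f1 y by exact: normr_ge0.
  have f20 y : 0 <= f2 y by exact: normr_ge0.
  have ke y : l1norm (br_kernel delta r (x - y)) = f1 y + f2 y.
    by rewrite br_kernel_dilated.
  have mk : measurable_complex (fun y : T => br_kernel delta r (x - y)).
    split.
    - by under eq_fun do rewrite br_kernel_dilated//; exact: m1.
    - by under eq_fun do rewrite br_kernel_dilated//; exact: m2.
  have avg (g : 'rV[R]_n -> R) : measurable_fun [set: T] (g : T -> R) ->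
      ~ large_average g h x -> [/\
      (\int[mu]_y (f1 y * h y)%:E <= (C1 + C2)%:E)%E,
      (\int[mu]_y (f2 y * h y)%:E <= (C1 + C2)%:E)%E,
      (\int[mu]_y (f1 y * (`|g x - g y| * h y))%:E <= (C1 + C2)%:E)%E &
      (\int[mu]_y (f2 y * (`|g x - g y| * h y))%:E <= (C1 + C2)%:E)%E].
    move=> mg ng.
    have C1C : (C1%:E <= (C1 + C2)%:E)%E by rewrite lee_fin lerDl ltW.
    have C2C : (C2%:E <= (C1 + C2)%:E)%E by rewrite lee_fin lerDr ltW.
    have na rho (rho0 : 0 < rho) := not_large_average rho0 ng.
    split.
    - by apply: (le_trans (avg1 x r h r0 mh h0 _)) => // rho /na[].
    - by apply: (le_trans (avg2 x r h r0 mh h0 _)) => // rho /na[].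
    - by apply: (le_trans (avg1 x r _ r0 (mBh _ mg) (B0 g) _)) => // rho /na[].
    - by apply: (le_trans (avg2 x r _ r0 (mBh _ mg) (B0 g) _)) => // rho /na[].
  have [h1 h2 r1 r2] := avg _ mbr nR; have [_ _ i1 i2] := avg _ mbi nI.
  have sL0 : 0 <= sigma / L by rewrite divr_ge0// ltW.
  have H1 : (\int[mu]_y (l1norm (br_kernel delta r (x - y)) * modulus (f y))%:E <=
      (sigma / L * ((C1 + C2) + (C1 + C2)))%:E)%E.
    apply: le_trans (integral_kernel_sum_le sL0 mf1 mf2 mh f10 f20 h0 h1 h2).
    rewrite le_eqVlt; apply/orP; left; apply/eqP.
    by apply: eq_integral => y _; rewrite ke fh.
  have H2 := integral_kernel_product_le sL0 mf1 mf2 (mB _ mbr) (mB _ mbi) mh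
    f10 f20 (fun y => normr_ge0 _) (fun y => normr_ge0 _) h0 r1 i1 r2 i2.
  apply: (le_trans (commutator_modulus_le mk mb mf H1 (M2 := sigma / L * (4 * (C1 + C2))) _)).
    apply: le_trans H2; rewrite le_eqVlt; apply/orP; left; apply/eqP.
    apply: eq_integral => y _; rewrite ke fh.
    by rewrite /l1norm ReB ImB.
  have e : sigma / L * L = sigma by rewrite divfK// gt_eqF.
  have LE : L = 8 * (C1 + C2) by [].
  rewrite le_eqVlt; apply/orP; left; apply/eqP; rewrite -[RHS]e.
  by move: (sigma / L) => u; rewrite LE; ring.
have sup0 : (0 <= br_max_commutator delta b f x)%E.
  apply: (@le_trans _ _ (modulus (br_commutator delta b 1 f x))%:E).
    by rewrite lee_fin modulus_ge0.
  by apply: ereal_sup_ubound; exists 1 => //=; rewrite in_itv/= ltr01.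
rewrite gee0_abs//; apply: ge_ereal_sup => z [r] /=; rewrite in_itv/= andbT => r0 <-.
by rewrite lee_fin; exact: comm.
Qed.

End pointwise.

(** * From Euclidean balls to cubes *)

Section general_integral.
Context d (T : measurableType d) (R : realType) (mu : {measure set T -> \bar R}).

(** The level sets of the maximal commutator need not be measurable: the integral
    over an arbitrary set is still a supremum over simple functions, and so is
    monotone. *)
Lemma ge0_le_integral_nonmeasurable (A B : set T) (f g : T -> R) :
  (forall x, 0 <= f x) -> (forall x, 0 <= g x) -> A `<=` B ->
  (forall x, A x -> f x <= g x) ->
  (\int[mu]_(x in A) (f x)%:E <= \int[mu]_(x in B) (g x)%:E)%E.
Proof.
move=> f0 g0 AB fg; rewrite integral_mkcond [leRHS]integral_mkcond.
rewrite !ge0_integralTE; last 2 first.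
- by move=> x; rewrite erestrict_ge0// => y _; rewrite lee_fin.
- by move=> x; rewrite erestrict_ge0// => y _; rewrite lee_fin.
apply: le_ereal_sup => _ [h hA <-] /=; exists h => // x; apply: (le_trans (hA x)).
rewrite !patchE; case: ifPn => [/set_mem Ax|_].
  by rewrite mem_set ?lee_fin; [exact: fg|exact: AB].
by case: ifP => _ //; rewrite lee_fin.
Qed.

Lemma ge0_integral_mono (A B : set T) (f : T -> R) : (forall x, 0 <= f x) ->
  A `<=` B -> (\int[mu]_(x in A) (f x)%:E <= \int[mu]_(x in B) (f x)%:E)%E.
Proof. by move=> f0 AB; exact: ge0_le_integral_nonmeasurable. Qed.

Lemma integral_le0_ae (A : set T) (f : T -> R) : measurable A ->
  measurable_fun A f -> (forall x, 0 <= f x) ->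
  ((\int[mu]_(x in A) (f x)%:E <= 0)%E <-> {ae mu, forall x, A x -> f x = 0}).
Proof.
move=> mA mf f0.
have If0 : (0 <= \int[mu]_(x in A) (f x)%:E)%E.
  by apply: integral_ge0 => x _; rewrite lee_fin.
have ab : (\int[mu]_(x in A) `|(f x)%:E| = \int[mu]_(x in A) (f x)%:E)%E.
  by apply: eq_integral => x _; rewrite gee0_abs ?lee_fin.
have mEf : measurable_fun A (fun x => (f x)%:E) by exact/measurable_EFinP.
split=> [le0|ae0].
- have h : ae_eq mu A (fun x => (f x)%:E) (cst 0%E).
    apply: (ae_eq_integral_abs mu mA mEf).1; rewrite ab.
    by apply/eqP; rewrite eq_le le0.
  by apply: (ae_mono _ h) => x hx Ax; exact: (EFin_inj (hx Ax)).
- rewrite -ab; have -> // : (\int[mu]_(x in A) `|(f x)%:E| = 0)%E.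
  apply: (ae_eq_integral_abs mu mA mEf).2.
  by apply: (ae_mono _ ae0) => x hx Ax; rewrite (hx Ax).
Qed.

Lemma ae_mono2 (P Q S : T -> Prop) : (forall x, P x -> Q x -> S x) ->
  {ae mu, forall x, P x} -> {ae mu, forall x, Q x} -> {ae mu, forall x, S x}.
Proof. by move=> PQS; apply: filterS2. Qed.

End general_integral.

Section euclidean_transfer.
Context {R : realType} {n : nat}.
Hypothesis n_gt0 : (0 < n)%N.
Local Notation T := (Rn R n).
Local Notation mu := (@lebesgue_Rn R n).
Implicit Types (w : 'rV[R]_n -> R) (b : 'rV[R]_n -> R[i]) (x : 'rV[R]_n) (r : R).

Let nR_gt0 : 0 < n%:R :> R. Proof. by rewrite ltr0n. Qed.

Lemma eball_measure x r : 0 < r ->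
  exists2 m : R, 0 < m <= (2 * r) ^+ n & mu (eball x r) = m%:E.
Proof.
move=> r0.
have le : (mu (eball x r) <= ((2 * r) ^+ n)%:E)%E.
  rewrite -(lebesgue_cube x r0); apply: le_measure; rewrite ?inE.
  - exact: measurable_eball.
  - exact: measurable_cube.
  - exact: eball_cube.
have rn : 0 < r / n%:R by rewrite divr_gt0.
have gt : (0 < mu (eball x r))%E.
  apply: (@lt_le_trans _ _ (mu (cube x (r / n%:R)))).
    by rewrite lebesgue_cube// lte_fin exprn_gt0// mulr_gt0.
  apply: le_measure; rewrite ?inE.
  - exact: measurable_cube.
  - exact: measurable_eball.
  - by apply: subset_trans (cube_eball n_gt0) _; rewrite mulrC divfK// gt_eqF.
have fin : mu (eball x r) \is a fin_num.
  by rewrite ge0_fin_numE ?ltW// (le_lt_trans le)// ltry.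
exists (fine (mu (eball x r))); last by rewrite fineK.
by rewrite fine_gt0 ?gt ?(le_lt_trans le (ltry _))//= -lee_fin fineK.
Qed.

Let box x r := [set y : 'rV[R]_n | forall i, `|y ord0 i - x ord0 i| <= r].

Let compact_box x r : compact (box x r).
Proof.
rewrite /box.
rewrite (_ : [set _ | _] =
    [set y : 'rV[R]_n | forall i, `[x ord0 i - r, x ord0 i + r]%classic (y ord0 i)]).
  apply: (@rV_compact R n (fun i => `[x ord0 i - r, x ord0 i + r]%classic)) => i.
  exact: segment_compact.
by apply/seteqP; split => y h i; move: (h i); rewrite /= in_itv/= ler_distl.
Qed.

(** If [w] vanished on a cube, its essential infimum on every larger ball would be
    0, and [w] would vanish almost everywhere by the [A1] condition; hence the
    positivity on cubes. *)
Lemma A1_cube w : A1 w -> exists K, cube_A1 w K.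
Proof.
move=> [[w0 [mw wfin] wpos] [C [C0 HC]]].
have W0 (A : set T) : (0 <= \int[mu]_(y in A) (w y)%:E)%E.
  by apply: integral_ge0 => y _; rewrite lee_fin.
have cfin x r : (\int[mu]_(y in cube x r) (w y)%:E < +oo)%E.
  apply: (le_lt_trans _ (wfin _ (@compact_box x r))).
  have -> : (\int[mu]_(y in box x r) `|w y|%:E = \int[mu]_(y in box x r) (w y)%:E)%E.
    by apply: eq_integral => y _; rewrite ger0_norm.
  by apply: ge0_integral_mono => // y xy i; exact: ltW.
have ae0 (A : set T) : measurable A -> {ae mu, forall y, ~ A y} -> mu A = 0%E.
  move=> mA h; apply: (measure_negligible mA).
  have h' : mu.-negligible (~` [set y | ~ A y]) := h.
  by apply: negligibleS h' => y Ay nAy; exact: nAy.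
have cgt0 x r : 0 < r -> (0 < \int[mu]_(y in cube x r) (w y)%:E)%E.
  move=> r0; rewrite lt_neqAle W0 andbT; apply/negP => /eqP/esym ze.
  have mwA (A : set T) : measurable_fun A (w : T -> R) by exact: measurable_funTS.
  have wcube : {ae mu, forall y, cube x r y -> w y = 0}.
    apply: (integral_le0_ae mu (measurable_cube x r) (mwA _) w0).1.
    by rewrite ze.
  have rN0 (N : nat) : 0 < r + N%:R by rewrite ltr_pwDl.
  have wball (N : nat) : {ae mu, forall y, eball x (r + N%:R) y -> w y = 0}.
    apply: (integral_le0_ae mu (measurable_eball x _) (mwA _) w0).1.
    have [m /andP[m0 _] mE] := eball_measure x (rN0 N).
    have := HC _ (ex_intro _ x (ex_intro _ _ (conj (rN0 N) erefl))).
    rewrite mE inver gt_eqF// lee_pdivrMl// => /le_trans; apply.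
    apply: mule_ge0_le0; first by rewrite lee_fin ltW.
    apply: mule_ge0_le0; first by rewrite lee_fin ltW.
    apply: ge_ereal_sup => y hy; rewrite leNgt; apply/negP => y0.
    have [m' /andP[m'0 _] m'E] := eball_measure x r0.
    suff : mu (eball x r) = 0%E by rewrite m'E => -[] m'z; rewrite m'z ltxx in m'0.
    apply: ae0; first exact: measurable_eball.
    apply: (ae_mono2 _ hy wcube) => z {}hy hw zx.
    have : (y <= (w z)%:E)%E.
      by apply: hy; move: zx; rewrite /eball /= => /lt_le_trans; apply; rewrite lerDl.
    by rewrite (hw (eball_cube zx)) leNgt y0.
  move: wpos; rewrite ae0 ?ltxx//.
    rewrite (_ : [set _ | _] = (w : T -> R) @^-1` `]0, +oo[).
      by rewrite -[X in measurable X]setTI; exact: mw.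
    by apply/seteqP; split => y; rewrite /= in_itv/= andbT.
  apply: (ae_mono _ (ae_foralln wball)) => y hy wy0.
  have yN : eball x (r + (Num.truncn (enorm (y - x))).+1%:R) y.
    by rewrite /eball /= ltr_wpDl ?(ltW r0)// truncnS_gt.
  by rewrite /= (hy _ yN) ltxx in wy0.
exists (Num.max 1 (2 * C * n%:R ^+ n)); apply: CubeA1 => //.
  by rewrite le_max lexx.
move=> x r r0; have nr0 : 0 < n%:R * r by rewrite mulr_gt0.
have [m /andP[m0 mle] mE] := eball_measure x nr0.
have cB : (\int[mu]_(y in cube x r) (w y)%:E <=
    \int[mu]_(y in eball x (n%:R * r)%R) (w y)%:E)%E.
  exact: (@ge0_integral_mono _ T R mu (cube x r) (eball x (n%:R * r)) w w0
    (cube_eball n_gt0)).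
have Bgt0 := lt_le_trans (cgt0 x r r0) cB.
have Bfin : (\int[mu]_(y in eball x (n%:R * r)%R) (w y)%:E < +oo)%E.
  apply: le_lt_trans (cfin x (n%:R * r)).
  exact: (@ge0_integral_mono _ T R mu (eball x (n%:R * r)) (cube x (n%:R * r)) w w0
    (@eball_cube _ _ _ _)).
have [I I0 IE] : exists2 I : R, 0 < I &
    (\int[mu]_(y in eball x (n%:R * r)%R) (w y)%:E = I%:E)%E.
  exists (fine (\int[mu]_(y in eball x (n%:R * r)%R) (w y)%:E)%E).
    by rewrite fine_gt0// Bgt0.
  by rewrite fineK// ge0_fin_numE// ltW.
have := HC _ (ex_intro _ x (ex_intro _ _ (conj nr0 erefl))).
rewrite mE IE inver gt_eqF// -EFinM muleC -lee_pdivrMr// -EFinM => vS.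
(* half of the lower bound for the essential infimum is below some a.e. bound *)
have : ((m^-1 * I * C^-1 / 2)%:E < ess_inf_in (eball x (n%:R * r)) w)%E.
  apply: lt_le_trans vS; rewrite lte_fin.
  have : 0 < m^-1 * I * C^-1 by rewrite !mulr_gt0// invr_gt0.
  by move: (m^-1 * I * C^-1) => v; lra.
move=> /ereal_sup_gt[v hv lt_v].
apply: (ae_mono _ hv) => z {}hv zx; apply: (le_trans cB); rewrite IE lee_fin.
have : ((m^-1 * I * C^-1 / 2)%:E < (w z)%:E)%E.
  by apply: lt_le_trans lt_v _; apply: hv; exact: cube_eball.
rewrite lte_fin => {}lt_v.
have e : I = 2 * C * m * (m^-1 * I * C^-1 / 2) by field; rewrite !gt_eqF.
rewrite e; apply: (@le_trans _ _ (2 * C * (2 * (n%:R * r)) ^+ n * w z)).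
  by apply: ler_pM; rewrite ?(ltW lt_v) ?mulr_ge0 ?invr_ge0 ?(ltW m0) ?(ltW I0) ?(ltW C0)//;
    apply: ler_wpM2l => //; rewrite mulr_ge0// ltW.
rewrite mulrCA exprMn mulrA; apply: ler_wpM2r => //; apply: ler_wpM2r.
  by rewrite exprn_ge0// mulr_ge0// ltW.
by rewrite le_max lexx orbT.
Qed.

Lemma BMO_cube b : BMO b -> exists2 A, 0 < A &
  cube_BMO (fun y => complex.Re (b y)) A /\ cube_BMO (fun y => complex.Im (b y)) A.
Proof.
move=> [[[mr mi] _]]; set S := ereal_sup _ => Sfin.
have val0 B : (0 <= (mu B)^-1 *
    \int[mu]_(x in B) (modulus (b x - average b B))%:E)%E.
  rewrite mule_ge0// ?inve_ge0//.
  by apply: integral_ge0 => y _; rewrite lee_fin; exact: modulus_ge0.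
have Sball x r : 0 < r -> ((mu (eball x r))^-1 * \int[mu]_(y in eball x r)
    (modulus (b y - average b (eball x r)))%:E <= S)%E.
  by move=> r0; apply: ereal_sup_ubound; exists (eball x r) => //; exists x, r.
have S0 : (0 <= S)%E by apply: le_trans (Sball 0 1 ltr01); exact: val0.
have [A0 A00 SE] : exists2 A0 : R, 0 <= A0 & S = A0%:E.
  by exists (fine S); rewrite ?fine_ge0// fineK// ge0_fin_numE.
exists (A0 * n%:R ^+ n + 1); first by rewrite ltr_wpDl// mulr_ge0// exprn_ge0.
have bound x r : 0 < r -> (\int[mu]_(y in cube x r)
    (modulus (b y - average b (eball x (n%:R * r))))%:E <=
    ((A0 * n%:R ^+ n + 1) * (2 * r) ^+ n)%:E)%E.
  move=> r0; have nr0 : 0 < n%:R * r by rewrite mulr_gt0.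
  have [m /andP[m0 mle] mE] := eball_measure x nr0.
  have := Sball x _ nr0; rewrite SE mE inver gt_eqF// lee_pdivrMl// => h.
  apply: (@le_trans _ _ (\int[mu]_(y in eball x (n%:R * r)%R)
    (modulus (b y - average b (eball x (n%:R * r)%R)))%:E)%E).
    exact: (@ge0_integral_mono _ T R mu (cube x r) (eball x (n%:R * r))
      (fun y => modulus (b y - average b (eball x (n%:R * r))))
      (fun y => modulus_ge0 _) (cube_eball n_gt0)).
  apply: (le_trans h); rewrite -EFinM lee_fin mulrC.
  have r2 : 0 <= (2 * r) ^+ n by rewrite exprn_ge0// mulr_ge0// ltW.
  apply: (@le_trans _ _ (A0 * (n%:R ^+ n * (2 * r) ^+ n))).
    by apply: ler_wpM2l => //; rewrite -exprMn mulrCA.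
  by rewrite mulrA; apply: ler_wpM2r; rewrite ?lerDl.
split; split=> // x r r0.
- exists (complex.Re (average b (eball x (n%:R * r)))).
  apply: le_trans (bound x r r0).
  apply: (@ge0_le_integral_nonmeasurable _ T R mu (cube x r) (cube x r)
    (fun y => `|complex.Re (b y) - _|) (fun y => modulus _)) => // y.
    exact: modulus_ge0.
  by move=> _; rewrite -ReB; exact: Re_le_modulus.
- exists (complex.Im (average b (eball x (n%:R * r)))).
  apply: le_trans (bound x r r0).
  apply: (@ge0_le_integral_nonmeasurable _ T R mu (cube x r) (cube x r)
    (fun y => `|complex.Im (b y) - _|) (fun y => modulus _)) => // y.
    exact: modulus_ge0.
  by move=> _; rewrite -ImB; exact: Im_le_modulus.
Qed.

End euclidean_transfer.

(** * Doubling *)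

Section doubling.
Context {R : realType} {n : nat}.
Hypothesis n_gt0 : (0 < n)%N.
Local Notation T := (Rn R n).
Local Notation mu := (@lebesgue_Rn R n).
Context {w : 'rV[R]_n -> R} {K : R} (Hw : cube_A1 w K).
Implicit Types (x : 'rV[R]_n) (r : R).
Local Notation W A := (\int[mu]_(y in A) (w y)%:E)%E.

Lemma cube_weight x r : 0 < r -> exists2 v : R, 0 < v & W (cube x r) = v%:E.
Proof.
move=> r0; have p := qa_gt0 Hw x r0; have f := qa_fin Hw x r.
exists (fine (W (cube x r))); first by rewrite fine_gt0// p.
by rewrite fineK// ge0_fin_numE// ltW.
Qed.

Lemma cube_doubling x r s : 0 < r -> 1 <= s ->
  (W (cube x (s * r)%R) <= (K * s ^+ n)%:E * W (cube x r))%E.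
Proof.
move=> r0 s1; have s0 : 0 < s by exact: lt_le_trans s1.
have sr0 : 0 < s * r by rewrite mulr_gt0.
have sub : cube x r `<=` cube x (s * r) by apply: cubeS; rewrite ler_peMl// ltW.
have := cube_A1_subset Hw sr0 (measurable_cube x r) sub.
have [v v0 ->] := cube_weight x sr0; have [u u0 ->] := cube_weight x r0.
rewrite (lebesgue_cube x r0) -!EFinM !lee_fin => h.
have q0 : 0 < (2 * r) ^+ n by rewrite exprn_gt0// mulr_gt0.
rewrite -(ler_pM2r q0); apply: (le_trans h).
rewrite (mulrCA 2) exprMn le_eqVlt; apply/orP; left; apply/eqP.
by move: (s ^+ n) ((2 * r) ^+ n) => p q; ring.
Qed.

Lemma eball_weight x r : 0 < r -> exists v : R, [/\ 0 < v, W (eball x r) = v%:E,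
  (W (cube x r) <= (K * n%:R ^+ n)%:E * W (eball x r))%E &
  (W (eball x r) <= W (cube x r))%E].
Proof.
move=> r0.
have nR : 0 < n%:R :> R by rewrite ltr0n.
have rn : 0 < r / n%:R by rewrite divr_gt0.
have e : n%:R * (r / n%:R) = r by rewrite mulrC divfK// gt_eqF.
have le1 : (W (eball x r) <= W (cube x r))%E.
  exact: (@ge0_integral_mono _ T R mu (eball x r) (cube x r) w (qa_ge0 Hw)
    (@eball_cube _ _ _ _)).
have le2 : (W (cube x (r / n%:R)%R) <= W (eball x r))%E.
  apply: (@ge0_integral_mono _ T R mu (cube x (r / n%:R)) (eball x r) w (qa_ge0 Hw)).
  by apply: subset_trans (cube_eball n_gt0) _; rewrite e.
have p := lt_le_trans (qa_gt0 Hw x rn) le2.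
have f := le_lt_trans le1 (qa_fin Hw x r).
exists (fine (W (eball x r))); split => //.
- by rewrite fine_gt0// p.
- by rewrite fineK// ge0_fin_numE// ltW.
- have := @cube_doubling x (r / n%:R) n%:R rn; rewrite ler1n e => /(_ n_gt0)/le_trans.
  apply; apply: lee_wpmul2l => //.
  by rewrite lee_fin mulr_ge0 ?exprn_ge0// (le_trans ler01)// (qa_K_ge1 Hw).
Qed.

(** A cube lies in a ball whose weight is comparable to that of the cube, and [Phi]
    is doubling. *)
Lemma morrey_ball_cube kappa (g : 'rV[R]_n -> R) N L : 0 < kappa -> 0 < L -> 0 <= N ->
  measurable_fun [set: T] (g : T -> R) -> (forall y, 0 <= g y) ->
  (forall x r, 0 < r -> (\int[mu]_(y in eball x r) (Phi (g y) * w y)%:E <=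
     (N * fine (W (eball x r)) `^ kappa)%:E)%E) ->
  forall x r, 0 < r -> (\int[mu]_(y in cube x r) (Phi (L * g y) * w y)%:E <=
    (L * (1 + log_plus L) * (K * n%:R ^+ n) `^ kappa * N *
     fine (W (cube x r)) `^ kappa)%:E)%E.
Proof.
move=> k0 L0 N0 mg g0 H x r r0.
have nR : 0 < n%:R :> R by rewrite ltr0n.
have nr0 : 0 < n%:R * r by rewrite mulr_gt0.
have K0 : 0 <= K * n%:R ^+ n.
  by rewrite mulr_ge0 ?exprn_ge0// (le_trans ler01)// (qa_K_ge1 Hw).
have s0 : 0 <= L * (1 + log_plus L).
  by rewrite mulr_ge0 ?(ltW L0)// addr_ge0// log_plus_ge0.
have [u [u0 uE _ ule]] := eball_weight x nr0.
have [v v0 vE] := cube_weight x r0.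
have n1 : 1 <= n%:R :> R by rewrite ler1n.
have uv : u <= K * n%:R ^+ n * v.
  by rewrite -lee_fin -uE (le_trans ule)// EFinM -vE; exact: cube_doubling.
have sub : cube x r `<=` eball x (n%:R * r) := cube_eball n_gt0.
apply: (le_trans (integral_Phi_scale mu (measurable_cube x r) (measurable_eball x _) sub L0
  mg g0 (qa_meas Hw) (qa_ge0 Hw))).
apply: (le_trans (lee_wpmul2l _ (H _ _ nr0))); first by rewrite lee_fin.
rewrite uE vE -EFinM lee_fin /= -!mulrA; apply: ler_wpM2l; first exact: ltW.
apply: ler_wpM2l; first by rewrite addr_ge0// log_plus_ge0.
rewrite mulrCA; apply: ler_wpM2l => //.
rewrite -powRM ?(ltW v0)//; apply: ge0_ler_powR.
- exact: ltW.
- by rewrite nnegrE ltW.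
- by rewrite nnegrE mulr_ge0 ?(ltW v0).
- exact: uv.
Qed.

End doubling.

(** * The weak type estimate *)

Section weak_type.
Context {R : realType} {n : nat}.
Hypothesis n_gt0 : (0 < n)%N.
Local Notation T := (Rn R n).
Local Notation mu := (@lebesgue_Rn R n).
Implicit Types (w : 'rV[R]_n -> R) (b f : 'rV[R]_n -> R[i]) (sigma : R).

(** A point of the level set is one where an average involving the real part or the
    imaginary part of [b] is large. *)
Lemma commutator_weak_type (delta kappa : R) w b :
  (n%:R - 1) / 2 < delta -> 0 < kappa < 1 -> A1 w -> BMO b ->
  exists2 C : R, 0 < C & forall f (x0 : 'rV[R]_n) (r0 sigma N : R),
  measurable_funC f -> 0 < r0 -> 0 < sigma -> 0 <= N ->
  (forall x r, 0 < r ->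
    (\int[mu]_(y in eball x r) (Phi (modulus (f y) / sigma) * w y)%:E <=
     (N * fine (\int[mu]_(y in eball x r) (w y)%:E) `^ kappa)%:E)%E) ->
  (\int[mu]_(x in [set x | eball x0 r0 x /\
      (sigma%:E < `|br_max_commutator delta b f x|)%E]) (w x)%:E <=
   (C * N * fine (\int[mu]_(y in eball x0 r0) (w y)%:E) `^ kappa)%:E)%E.
Proof.
move=> delta_gt k01 w_A1 b_BMO; have [k0 _] := andP k01.
have [K Hw] := A1_cube n_gt0 w_A1.
have [A A0 [bR bI]] := BMO_cube n_gt0 b_BMO.
have [L L0 HL] := br_max_commutator_le n_gt0 delta_gt.
have K1 := qa_K_ge1 Hw.
have K0 : 0 < K by exact: lt_le_trans K1.
have n1 : 1 <= n%:R :> R by rewrite ler1n.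
have n0 : 0 < n%:R :> R by exact: lt_le_trans n1.
pose CB := K * 6 ^+ n * (K * n%:R ^+ n).
have CB1 : 1 <= CB.
  rewrite /CB; apply: mulr_ege1; apply: mulr_ege1 => //; apply: exprn_ege1 => //.
  by rewrite ler1n.
have [C1 C10 H1] := cube_commutator_bound Hw bR A0 k01 CB1.
have [C2 C20 H2] := cube_commutator_bound Hw bI A0 k01 CB1.
pose c := L * (1 + log_plus L) * (K * n%:R ^+ n) `^ kappa.
have c0 : 0 < c.
  apply: mulr_gt0; last by rewrite powR_gt0// mulr_gt0// exprn_gt0.
  by apply: mulr_gt0 => //; apply: ltr_wpDr => //; exact: log_plus_ge0.
exists ((C1 + C2) * c) => [|f x0 r0 sigma N mf r00 s0 N0 HN].
  by rewrite mulr_gt0// addr_gt0.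
pose g y := modulus (f y) / sigma; pose h y := L * g y.
have mg : measurable_fun [set: T] (g : T -> R).
  exact: (measurable_funM (measurable_modulus mf) (measurable_cst sigma^-1)).
have g0 y : 0 <= g y by exact: (divr_ge0 (modulus_ge0 _) (ltW s0)).
have mh : measurable_fun [set: T] (h : T -> R).
  exact: (measurable_funM (measurable_cst L) mg).
have h0 y : 0 <= h y by exact: (mulr_ge0 (ltW L0) (g0 _)).
have morrey := morrey_ball_cube n_gt0 Hw k0 L0 N0 mg g0 HN.
have cN0 : 0 <= c * N by exact: (mulr_ge0 (ltW c0) N0).
have [v [v0 vE vle _]] := eball_weight n_gt0 Hw x0 r00.
have WB : (\int[mu]_(y in cube x0 (6 * r0)%R) (w y)%:E <=
    CB%:E * \int[mu]_(y in eball x0 r0) (w y)%:E)%E.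
  have l6 : 1 <= 6 :> R by rewrite ler1n.
  apply: (le_trans (cube_doubling Hw x0 r00 l6)).
  rewrite /CB (EFinM (K * 6 ^+ n)) -muleA; apply: lee_wpmul2l => //.
  by rewrite lee_fin mulr_ge0 ?exprn_ge0// ltW.
have [E1 [mE1 sE1 WE1]] := H1 h (c * N) _ x0 r0 r00 (measurable_eball x0 r0)
  (@eball_cube _ _ _ _) WB mh h0 cN0 morrey.
have [E2 [mE2 sE2 WE2]] := H2 h (c * N) _ x0 r0 r00 (measurable_eball x0 r0)
  (@eball_cube _ _ _ _) WB mh h0 cN0 morrey.
pose nu := density mu (qa_meas Hw) (qa_ge0 Hw).
apply: (@le_trans _ _ (nu (E1 `|` E2))).
  apply: (@ge0_integral_mono _ T R mu _ (E1 `|` E2) w (qa_ge0 Hw)) => x [Bx lt].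
  have [l1|n1'] := pselect (large_average (fun y => complex.Re (b y)) h x).
    by left; apply: sE1.
  have [l2|n2'] := pselect (large_average (fun y => complex.Im (b y)) h x).
    by right; apply: sE2.
  have [[mb _] _] := b_BMO.
  by move: lt; rewrite ltNge (HL b f sigma x s0 mb mf n1' n2').
have U2 : (nu (E1 `|` E2) <= nu E1 + nu E2)%E by exact: measureU2.
apply: (le_trans U2).
apply: (@le_trans _ _ ((C1 * (c * N) * fine (\int[mu]_(y in eball x0 r0) (w y)%:E)%E `^ kappa)%:E +
  (C2 * (c * N) * fine (\int[mu]_(y in eball x0 r0) (w y)%:E)%E `^ kappa)%:E)%E).
  exact: leeD WE1 WE2.
rewrite -EFinD lee_fin le_eqVlt; apply/orP; left; apply/eqP.
by move: (_ `^ kappa) => p; ring.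
Qed.

End weak_type.

Theorem corollary5p15 (R : realType) (n : nat) (n_gt0 : (0 < n)%N)
    (delta kappa : R) (w : 'rV[R]_n -> R) (b : 'rV[R]_n -> R[i])
    (delta_gt : (n%:R - 1) / 2 < delta)
    (kappa_gt0 : 0 < kappa) (kappa_lt1 : kappa < 1)
    (w_A1 : A1 w) (b_BMO : BMO b) :
  exists C : R, 0 < C /\
    forall (f : 'rV[R]_n -> R[i]) (B : set 'rV[R]_n) (sigma : R),
      measurable_funC f -> euclidean_ball B -> 0 < sigma ->
      ((wmeasure w B `^ kappa)^-1 *
         wmeasure w
           [set x | B x /\ sigma%:E < `|br_max_commutator delta b f x| ]
       <= C%:E *
          ereal_sup
            [set (wmeasure w B' `^ kappa)^-1 *
                 \int[@lebesgue_Rn R n]_(x in B')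
                   (Phi (modulus (f x) / sigma) * w x)%:E
            | B' in @euclidean_ball R n])%E.

Proof.
have k01 : 0 < kappa < 1 by rewrite kappa_gt0 kappa_lt1.
have [C C0 HC] := commutator_weak_type n_gt0 delta_gt k01 w_A1 b_BMO.
have [K Hw] := A1_cube n_gt0 w_A1.
exists C; split=> // f B sigma mf [x0 [r0 [r00 ->]]] s0.
set S := ereal_sup _.
have inv x r : 0 < r -> exists2 p : R, 0 < p &
    ((wmeasure w (eball x r) `^ kappa)^-1 = (p^-1)%:E)%E /\
    fine (wmeasure w (eball x r)) `^ kappa = p.
  move=> r1; have [v [v0 vE _ _]] := eball_weight n_gt0 Hw x r1.
  exists (v `^ kappa); first exact: powR_gt0.
  by rewrite /wmeasure vE poweR_EFin inver gt_eqF ?powR_gt0.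
have Sball x r : 0 < r -> ((wmeasure w (eball x r) `^ kappa)^-1 *
    \int[@lebesgue_Rn R n]_(y in eball x r)
      (Phi (modulus (f y) / sigma) * w y)%:E <= S)%E.
  by move=> r1; apply: ereal_sup_ubound; exists (eball x r) => //; exists x, r.
have S0 : (0 <= S)%E.
  apply: le_trans (Sball x0 r0 r00); have [p p0 [-> _]] := inv x0 r0 r00.
  apply: mule_ge0; first by rewrite lee_fin invr_ge0 ltW.
  apply: integral_ge0 => y _; rewrite lee_fin; apply: mulr_ge0; last exact: (qa_ge0 Hw).
  by apply: Phi_ge0; exact: (divr_ge0 (modulus_ge0 _) (ltW s0)).
have [Soo|] := eqVneq S +oo%E; first by rewrite Soo gt0_muley ?lte_fin// leey.
rewrite -ltey => Sfin.
have [N N0 SE] : exists2 N : R, 0 <= N & S = N%:E.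
  by exists (fine S); rewrite ?fine_ge0// fineK// ge0_fin_numE.
have HN x r : 0 < r -> (\int[@lebesgue_Rn R n]_(y in eball x r)
    (Phi (modulus (f y) / sigma) * w y)%:E <=
    (N * fine (wmeasure w (eball x r)) `^ kappa)%:E)%E.
  move=> r1; have := Sball x r r1; have [p p0 [-> ->]] := inv x r r1.
  by rewrite SE lee_pdivrMl// -EFinM mulrC.
have := HC f x0 r0 sigma N mf r00 s0 N0 HN.
have [p p0 [-> e]] := inv x0 r0 r00; move: e; rewrite /wmeasure => ->.
by rewrite SE lee_pdivrMl// -!EFinM mulrC.
Qed.
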